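(* Let $(E,d)$ be a Polish space, $x_0\in E$, let $(X_i)_{1\le i\le n}$ be i.i.d. $E$-valued random variables with common law $\mu$, $X$ a random variable with law $\mu$, and $L_n=\frac1n\sum_{i=1}^n\delta_{X_i}$. Let $S\subset E$ with $\mu(S)=1$. Let $p\ge1$ and assume there exists $\beta>0$ such that, with $\alpha=2p$, for every $r>0$ and every $\delta\in(0,2r]$, $N(S\cap B(x_0,r),\delta)\le\beta(2r/\delta)^\alpha$. Then, with positive constants $C_{\cdot}$ depending only on the indicated parameters (constants with the same subscripts in one formula may differ): (1) If $\|X\|_{rp,w}<\infty$ for some $r>2$, then for any $q>r$ and any $x>0$, $$\mathbb P(W_p^p(\mu,L_n)>x)\le e^2\exp\left(-nC_{p,\alpha,\beta}\left[\frac{x}{I_{2p,p}\log\left(e+C_{p,\alpha,\beta}\frac{I_{2p,p}}{x}\right)}\right]^2\right)\mathbf 1_{x\le C_p\|d(x_0,X)\|_p^p}+C_{p,q,r}\left\{\frac{I_{2p,p}^q}{x^qn^{q/2}}+\frac{\|X\|_{rp,w}^{rp}}{x^rn^{r-1}}\right\}.$$ (2) If $I_{2p,p}<\infty$, then for any $x>0$, $$\mathbb P(W_p^p(\mu,L_n)>x)\le e^2\exp\left(-nC_{p,\alpha,\beta}\left[\frac{x}{I_{2p,p}\log\left(e+C_{p,\alpha,\beta}\frac{I_{2p,p}}{x}\right)}\right]^2\right)\mathbf 1_{x\le C_p\|d(x_0,X)\|_p^p}+C_{p,\alpha,\beta}\frac{I_{2p,p}^2}{x^2n}.$$ (3) If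 $\|X\|_{rp,w}<\infty$ for some $r\in(1,2)$, then for any $x>0$, $\mathbb P(W_p^p(\mu,L_n)>x)\le C_{p,\alpha,\beta,r}\frac{\|X\|_{rp,w}^{rp}}{x^rn^{r-1}}$.
   Context: For $p\ge1$ and probability measures $\mu,\nu$ on $E$ with finite $p$-th moments, $W_p^p(\mu,\nu)=\inf_{\pi}\int d^p(x,y)\,\pi(dx,dy)$ over couplings $\pi$ of $\mu$ and $\nu$. For a bounded set $Y\subset E$ and $\delta>0$, $N(Y,\delta)$ is the minimal $m\in\mathbb N$ such that there exist $y_1,\dots,y_m\in Y$ with $Y\subset\bigcup_{j}B(y_j,\delta)$, $B(y,\rho)$ being the closed ball. The tail function is $H(t)=\mu(B(x_0,t)^c)$, the weak moment of order $s\ge1$ is defined by $\|X\|_{s,w}^s=\sup_{t\ge0}t^sH(t)$, and $I_{2p,p}=\int_0^\infty\sqrt{H(t)}\,t^{p-1}dt$. Also $\|d(x_0,X)\|_p^p=\mathbb E[d(x_0,X)^p]$. *)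

(* Defs.v *)
From HB Require Import structures.
From mathcomp Require Import all_boot all_order all_algebra.
From mathcomp Require Import all_classical all_reals all_analysis.
Set Implicit Arguments. Unset Strict Implicit. Unset Printing Implicit Defensive.
Import Order.TTheory GRing.Theory Num.Theory.
Local Open Scope classical_set_scope.
Local Open Scope ring_scope.

Section MetricDefs.
Context {R : realType} {E : Type} (dist : E -> E -> R).

Definition is_metric : Prop :=
  (forall x y, 0 <= dist x y) /\ (forall x y, dist x y = 0 <-> x = y) /\
  (forall x y, dist x y = dist y x) /\
  (forall x y z, dist x z <= dist x y + dist y z).

Definition cball (y : E) (rho : R) : set E := [set z | dist y z <= rho].

Definition mopen (A : set E) : Prop :=
  forall x, A x -> exists2 e : R, 0 < e & [set y | dist x y < e] `<=` A.

Definition mseparable : Prop :=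
  exists2 D : set E, countable D &
    forall x (e : R), 0 < e -> exists2 y, D y & dist x y < e.

Definition mcomplete : Prop :=
  forall u : nat -> E,
    (forall e : R, 0 < e -> exists N, forall m k, (N <= m)%N -> (N <= k)%N ->
        dist (u m) (u k) < e) ->
    exists l, forall e : R, 0 < e -> exists N, forall k, (N <= k)%N -> dist (u k) l < e.

Definition polish : Prop := [/\ is_metric, mseparable & mcomplete].

(* covering number N(Y, delta) : minimal m such that Y is covered by m closed
   balls of radius delta centered in Y (+oo if no such finite m) *)
Definition covering_number (Y : set E) (delta : R) : \bar R :=
  ereal_inf [set (m%:R)%:E | m in
    [set m : nat | exists y : 'I_m -> E,
        (forall i, Y (y i)) /\ (forall z, Y z -> exists i, cball (y i) delta z)]].
End MetricDefs.

Section Measures.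
Context {R : realType} {dE : measure_display} {E : measurableType dE}
        (dist : E -> E -> R).

Definition borel_of_metric : Prop :=
  (@measurable _ E) = <<s [set A : set E | mopen dist A] >>.

Definition coupling (mu nu : set E -> \bar R) (pi : probability (E * E)%type R) : Prop :=
  (forall A, measurable A -> pi (fst @^-1` A) = mu A) /\
  (forall A, measurable A -> pi (snd @^-1` A) = nu A).

Definition Wpp (p : R) (mu nu : set E -> \bar R) : \bar R :=
  ereal_inf [set (\int[pi]_z ((dist z.1 z.2) `^ p)%:E)%E | pi in coupling mu nu].

Definition empirical (n : nat) (xs : 'I_n -> E) : set E -> \bar R :=
  fun A => ((n%:R)^-1%:E * \sum_(i < n) \d_(xs i) A)%E.

Definition tailH (mu : set E -> \bar R) (x0 : E) (t : R) : \bar R :=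
  mu (~` cball dist x0 t).

Definition weak_moment (mu : set E -> \bar R) (x0 : E) (s : R) : \bar R :=
  ereal_sup [set ((t `^ s)%:E * tailH mu x0 t)%E | t in [set t : R | (0 <= t)%R]].

Definition I2pp (mu : set E -> \bar R) (x0 : E) (p : R) : \bar R :=
  (\int[@lebesgue_measure R]_(t in [set t : R | (0 <= t)%R])
      (Num.sqrt (fine (tailH mu x0 t)) * t `^ (p - 1))%R%:E)%E.

Definition pmoment (mu : {measure set E -> \bar R}) (x0 : E) (p : R) : \bar R :=
  (\int[mu]_y ((dist x0 y) `^ p)%:E)%E.
End Measures.

Section Indep.
Context {R : realType} {dO : measure_display} {Om : measurableType dO}
        {dE : measure_display} {E : measurableType dE}.

Definition mutually_independent (P : probability Om R) (n : nat) (X : 'I_n -> Om -> E) : Prop :=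
  forall A : 'I_n -> set E, (forall i, measurable (A i)) ->
    P (\bigcap_(i in [set: 'I_n]) (X i @^-1` A i)) = (\prod_(i < n) P (X i @^-1` A i))%E.

Definition iid_law (P : probability Om R) (n : nat) (X : 'I_n -> Om -> E)
    (mu : probability E R) : Prop :=
  [/\ forall i, measurable_fun setT (X i),
      forall i A, measurable A -> P (X i @^-1` A) = mu A &
      mutually_independent P X].
End Indep.

(* Main.v *)
Require Import Defs.
From HB Require Import structures.
From mathcomp Require Import all_boot all_order all_algebra.
From mathcomp Require Import all_classical all_reals all_analysis.
From mathcomp Require Import measurable_realfun.
From mathcomp Require Import zify ring lra.
Import Order.TTheory GRing.Theory Num.Theory.
Local Open Scope classical_set_scope.
Local Open Scope ring_scope.
Set Implicit Arguments. Unset Strict Implicit. Unset Printing Implicit Defensive.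

(** Write H(t) for the tail of mu. Points are truncated at a radius M with M^p of
    order n x, which costs n H(M). The rest of [S] is cut into dyadic annuli and
    each annulus into nested partitions built from the covers, so that only
    finitely many cells remain and the sample becomes an i.i.d. sample from a
    finite law. A greedy coupling on the resulting tree bounds the transport cost
    by a deterministic term plus a weighted sum D, over the nodes, of the
    differences between the mu-mass and the empirical mass.

    Since alpha = 2p, every level of annulus k contributes the same amount
    (of order the p-th power of its radius times the square root of its mass,
    divided by sqrt n) to the L^2 norm of D; the number of levels needed is
    logarithmic in I/x, which gives the logarithm in (1) and (2). Where the
    exponential term is below 1 (up to e^2), the mean of D is at most x/4, and D
    concentrates as a sum of independent variables does because it has bounded
    differences controlled by the p-th power of the distance to x0; this is the
    Fuk-Nagaev bound. Beyond a multiple of the p-th moment no level is needed at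
    all, which is why the constants there do not involve beta. In (3) the level
    at annulus k is chosen as K - k, the sum over annuli is geometric, and
    Chebyshev's inequality suffices. *)

(** * Expectation over a finite product law *)

(** The exponent 2p enters through one cancellation. Depth l of an annulus has of order 2^(2pl)
    cells, so Cauchy-Schwarz over the cells gives a factor 2^(pl), which is the inverse of the p-th
    power of the relative mesh. Coding points by cells turns all probabilities into finite sums over
    words. Two issues stay outside this finite model. The event W > x must be measurable before its
    probability can be compared with anything; this follows from upper semicontinuity of the cost in
    the sample points. The mass of mu beyond the outermost radius must also be transported although
    no sample point lies there; its cost is bounded by a tail integral [tau]. Probabilities are at
    most 1, so there is nothing to prove where the claimed bound exceeds 1. This supplies the
    smallness of [tau] that the remaining cases use. Finiteness of I already bounds t^(2p) H(t), so
    (2) is obtained from the same estimate as (1), taken at q = r = 2. *)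

Lemma sum_cauchy_schwarz (R : realFieldType) (I : finType) (w y z : I -> R) :
  (forall i, 0 <= w i) ->
  (\sum_i w i * (y i * z i)) ^+ 2
    <= (\sum_i w i * y i ^+ 2) * (\sum_i w i * z i ^+ 2).
Proof.
move=> w0.
(* Lagrange's identity: the double sum of [f] is twice the gap between the two sides. *)
pose f i j := w i * w j * (y i * z j - y j * z i) ^+ 2.
have f0 : 0 <= \sum_i \sum_j f i j.
  by apply: sumr_ge0 => i _; apply: sumr_ge0 => j _; apply: mulr_ge0; rewrite ?sqr_ge0 // mulr_ge0.
have fE : \sum_i \sum_j f i j =
    2 * ((\sum_i w i * y i ^+ 2) * (\sum_i w i * z i ^+ 2)
         - (\sum_i w i * (y i * z i)) ^+ 2).
  set a := \sum_i w i * y i ^+ 2; set b := \sum_i w i * z i ^+ 2.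
  set c := \sum_i w i * (y i * z i).
  have -> : 2 * (a * b - c ^+ 2) = a * b + b * a - (c * c + c * c) by ring.
  rewrite !big_distrlr /= -!big_split -sumrB; apply: eq_bigr => i _.
  rewrite -!big_split -sumrB; apply: eq_bigr => j _.
  by rewrite /f /=; ring.
by rewrite -subr_ge0 -(pmulr_rge0 _ (ltr0Sn R 1)) -fE.
Qed.

Section FiniteExpectation.
Context {R : realType} {T : finType}.
Variable w : T -> R.

(** The sample is passed to [F] as a plain sequence, not a tuple, so that conditioning on a draw is
    a [cons] and replacing a draw is a concatenation. *)
Definition Ex (n : nat) (F : seq T -> R) : R :=
  \sum_(s : n.-tuple T) (\prod_(t <- s) w t) * F s.

Lemma Ex0 F : Ex 0 F = F [::].
Proof.
rewrite /Ex (bigD1 [tuple]) //= big_nil mul1r big1 ?addr0 // => s.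
by move=> /negP[]; apply/eqP; apply: val_inj; rewrite [s]tuple0.
Qed.

Lemma ExS n F : Ex n.+1 F = \sum_t w t * Ex n (fun s => F (t :: s)).
Proof.
rewrite /Ex (reindex (fun q : T * n.-tuple T => [tuple of q.1 :: q.2])) /=; last first.
  exists (fun s => (thead s, [tuple of behead s])) => [[t s] _ | s _] /=.
    by congr (_, _); apply: val_inj.
  by rewrite [RHS]tuple_eta; apply: val_inj.
rewrite -(pair_bigA _ (fun (t : T) (s : n.-tuple T) =>
  (\prod_(u <- t :: s) w u) * F (t :: s))) /=.
by apply: eq_bigr => t _; rewrite mulr_sumr; apply: eq_bigr => s _;
  rewrite big_cons mulrA.
Qed.

Hypothesis w_ge0 : forall t, 0 <= w t.
Hypothesis w_sum1 : \sum_t w t = 1.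

Lemma prodw_ge0 (s : seq T) : 0 <= \prod_(t <- s) w t.
Proof. exact: prodr_ge0. Qed.

Lemma le_Ex n F G : (forall s, size s = n -> F s <= G s) -> Ex n F <= Ex n G.
Proof.
move=> FG; apply: ler_sum => s _; rewrite ler_wpM2l ?prodw_ge0 //.
by rewrite FG ?size_tuple.
Qed.

Lemma eq_Ex n F G : (forall s, size s = n -> F s = G s) -> Ex n F = Ex n G.
Proof. by move=> FG; apply: eq_bigr => s _; rewrite FG ?size_tuple. Qed.

Lemma ExD n F G : Ex n (fun s => F s + G s) = Ex n F + Ex n G.
Proof. by rewrite -big_split; apply: eq_bigr => s _; rewrite mulrDr. Qed.

Lemma ExZ n c F : Ex n (fun s => c * F s) = c * Ex n F.
Proof. by rewrite mulr_sumr; apply: eq_bigr => s _; rewrite mulrCA. Qed.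

Lemma Ex_sum (I : finType) n (F : I -> seq T -> R) :
  Ex n (fun s => \sum_i F i s) = \sum_i Ex n (F i).
Proof. by rewrite exchange_big; apply: eq_bigr => s _; rewrite mulr_sumr. Qed.

Lemma Ex_cst n c : Ex n (fun=> c) = c.
Proof.
elim: n => [|n IH]; first by rewrite Ex0.
by rewrite ExS IH -mulr_suml w_sum1 mul1r.
Qed.

Lemma Ex_ge0 n F : (forall s, 0 <= F s) -> 0 <= Ex n F.
Proof. by move=> F0; rewrite -(Ex_cst n 0); apply: le_Ex => s _. Qed.

Lemma Ex_cauchy_schwarz n F G :
  Ex n (fun s => F s * G s) ^+ 2
    <= Ex n (fun s => F s ^+ 2) * Ex n (fun s => G s ^+ 2).
Proof.
pose W (s : n.-tuple T) := \prod_(t <- s) w t.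
exact: (@sum_cauchy_schwarz R _ W (F \o val) (G \o val) (fun s => prodw_ge0 s)).
Qed.

Lemma Ex_le_sqrt n F : Ex n F <= Num.sqrt (Ex n (fun s => F s ^+ 2)).
Proof.
have := Ex_cauchy_schwarz n F (fun=> 1).
rewrite (eq_Ex (G := F)); last by move=> s _; rewrite mulr1.
rewrite expr1n Ex_cst mulr1 => h.
by rewrite (le_trans (ler_norm _)) // -sqrtr_sqr ler_wsqrtr.
Qed.

(** Minkowski's inequality in L^2: expand the square and apply Cauchy-Schwarz to each cross term.
    The [Y i] may be dependent. *)
Lemma Ex_sqr_sum (I : finType) n (h sg : I -> R) (Y : I -> seq T -> R) :
  (forall i, 0 <= h i) -> (forall i, 0 <= sg i) ->
  (forall i, Ex n (fun s => Y i s ^+ 2) <= sg i ^+ 2) ->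
  Ex n (fun s => (\sum_i h i * Y i s) ^+ 2) <= (\sum_i h i * sg i) ^+ 2.
Proof.
move=> h0 s0 hY.
rewrite (eq_Ex (G := fun s => \sum_i \sum_j (h i * h j) * (Y i s * Y j s))); last first.
  move=> s _; rewrite expr2 big_distrlr /=; apply: eq_bigr => i _.
  by apply: eq_bigr => j _; ring.
rewrite Ex_sum expr2 big_distrlr /=; apply: ler_sum => i _.
rewrite Ex_sum; apply: ler_sum => j _.
rewrite ExZ mulrACA ler_wpM2l ?mulr_ge0 //.
rewrite (le_trans (ler_norm _)) // -(@ger0_norm _ (sg i * sg j)) ?mulr_ge0 //.
rewrite -ler_sqr ?nnegrE ?normr_ge0 // !real_normK ?num_real //.
by rewrite (le_trans (Ex_cauchy_schwarz _ _ _)) // exprMn ler_pM //;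
  apply: Ex_ge0 => s; rewrite sqr_ge0.
Qed.

Lemma Ex_sum_centered n (z : T -> R) : \sum_t w t * z t = 0 ->
  Ex n (fun s => \sum_(t <- s) z t) = 0.
Proof.
move=> z0; elim: n => [|n IH]; first by rewrite Ex0 big_nil.
rewrite ExS -[RHS]z0; apply: eq_bigr => t _.
rewrite (eq_Ex (G := fun s => z t + \sum_(u <- s) z u)); last by move=> s _; rewrite big_cons.
by rewrite ExD Ex_cst IH addr0.
Qed.

(** Conditionally on the first draw the cross term vanishes, the other draws being centred, so
    variances add up. *)
Lemma Ex_sqr_sum_centered n (z : T -> R) : \sum_t w t * z t = 0 ->
  Ex n (fun s => (\sum_(t <- s) z t) ^+ 2) = n%:R * \sum_t w t * z t ^+ 2.
Proof.
move=> z0; elim: n => [|n IH]; first by rewrite Ex0 big_nil expr0n mul0r.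
rewrite ExS -natr1 mulrDl mul1r -{}IH addrC -[X in _ = _ + X]mul1r -w_sum1.
rewrite mulr_suml -big_split; apply: eq_bigr => t _.
rewrite (eq_Ex (G := fun s => z t ^+ 2 + (2 * z t * (\sum_(u <- s) z u)
   + (\sum_(u <- s) z u) ^+ 2))); last by move=> s _; rewrite big_cons; ring.
by rewrite ExD Ex_cst ExD ExZ Ex_sum_centered // mulr0 add0r mulrDr.
Qed.

Definition Pr (n : nat) (A : pred (seq T)) : R := Ex n (fun s => (A s)%:R).

Lemma Pr_orb n (A B : pred (seq T)) :
  Pr n (fun s => A s || B s) <= Pr n A + Pr n B.
Proof.
rewrite -ExD; apply: le_Ex => s _.
by case: (A s); case: (B s); rewrite ?addr0 ?add0r // lerDl.
Qed.

Lemma Pr_mem n t : Pr n (fun s => t \in s) <= n%:R * w t.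
Proof.
elim: n => [|n IH]; first by rewrite /Pr Ex0 mul0r.
rewrite /Pr ExS (le_trans (y := \sum_u w u * ((u == t)%:R + Pr n (fun s => t \in s)))) //.
  apply: ler_sum => u _; rewrite ler_wpM2l // -[X in _ <= X + _](Ex_cst n) -ExD.
  apply: le_Ex => s _; rewrite in_cons eq_sym.
  by case: (u == t); case: (t \in s) => /=; rewrite ?addr0 ?add0r // lerDl.
rewrite (eq_bigr _ (fun u _ => mulrDr _ _ _)) big_split /= -mulr_suml w_sum1 mul1r.
rewrite (bigD1 t) //= eqxx mulr1 big1 ?addr0; last by move=> u /negbTE ->; rewrite mulr0.
by rewrite -natr1 mulrDl mul1r addrC lerD2r.
Qed.

Lemma Pr_markov n (F : seq T -> R) (a : R) : 0 < a -> (forall s, 0 <= F s) ->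
  Pr n (fun s => a <= F s) <= Ex n F / a.
Proof.
move=> a0 F0; rewrite mulrC -ExZ; apply: le_Ex => s _.
have [h|h] := boolP (a <= F s); first by rewrite mulrC ler_pdivlMr // mul1r.
by rewrite mulr_ge0 // invr_ge0 ltW.
Qed.

Lemma Pr_chebyshev n (F : seq T -> R) (a : R) : 0 < a ->
  Pr n (fun s => a < F s) <= Ex n (fun s => F s ^+ 2) / a ^+ 2.
Proof.
move=> a0; apply: le_trans (@Pr_markov n (fun s => F s ^+ 2) _ _ _); last 2 first.
- by rewrite exprn_gt0.
- by move=> s; rewrite sqr_ge0.
apply: le_Ex => s _; rewrite ler_nat; case: ltP => //= h.
by rewrite ler_sqr ?nnegrE ?(ltW h) ?ltW // (lt_trans a0).
Qed.

End FiniteExpectation.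

(** * Exponential moments and a Fuk-Nagaev inequality under bounded differences *)

Lemma expR_le_quadratic (R : realType) (z : R) :
  expR z <= 1 + z + z ^+ 2 * expR `|z|.
Proof.
have [z0|z0] := leP 0 z.
  rewrite ger0_norm //.
  have h1 : expR z - 1 <= z * expR z.
    have := expR_ge1Dx (- z); rewrite expRN => h.
    have e0 := expR_gt0 z.
    have : (1 - z) * expR z <= 1 by rewrite -ler_pdivlMr // mul1r.
    lra.
  have h2 : z * (expR z - 1) <= z * (z * expR z) by rewrite ler_wpM2l.
  by rewrite expr2; lra.
rewrite ltr0_norm //; have y0 : 0 < - z by lra.
have h : expR z <= 1 / (1 - z).
  rewrite ler_pdivlMr; last lra.
  have := expR_ge1Dx (- z); rewrite expRN => h.
  by rewrite mulrC -ler_pdivlMr ?expR_gt0 // mul1r.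
(* (1 - z)(1 + z + z^2) = 1 - z^3, which is at least 1 for negative z. *)
have h2 : 1 / (1 - z) <= 1 + z + z ^+ 2.
  by rewrite ler_pdivrMr; nra.
have h3 : z ^+ 2 <= z ^+ 2 * expR (- z).
  by rewrite ler_peMr ?sqr_ge0 // -expR0 ler_expR ltW.
lra.
Qed.

Lemma sqr_le_expR (R : realType) (y : R) : 0 <= y -> y ^+ 2 <= expR y.
Proof.
move=> y0.
have h := expR_ge1Dx (y / 4).
have -> : expR y = (expR (y / 4) ^+ 2) ^+ 2.
  by rewrite -exprM -expRM_natl; congr expR; field.
have h2 : y <= expR (y / 4) ^+ 2.
  apply: (le_trans (y := (1 + y / 4) ^+ 2)).
    by rewrite -subr_ge0 [leRHS](_ : _ = (1 - y / 4) ^+ 2) ?sqr_ge0 //; field.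
  by rewrite ler_sqr ?nnegrE ?expR_ge0 // addr_ge0 // divr_ge0.
by rewrite ler_sqr ?nnegrE // (le_trans y0).
Qed.

Section Concentration.
Context {R : realType} {T : finType}.
Variables (w g : T -> R) (G : R).
Hypothesis w_ge0 : forall t, 0 <= w t.
Hypothesis w_sum1 : \sum_t w t = 1.
Hypothesis g_ge0 : forall t, 0 <= g t.
Hypothesis g_le : forall t, g t <= G.

(** Variance proxy of one coordinate. With gb the mean of g, the 4 comes from (g + gb)^2 <= 2 g^2 +
    2 gb^2 and from gb^2 being at most the mean of g^2. *)
Let v := 4 * \sum_t w t * g t ^+ 2.

(** Averaging the oscillation bound over u shows that [phi t] is within g t + gb of its mean, so its
    variance is at most v and its deviations at most 2G. In [expR_le_quadratic] the linear term
    averages to zero. *)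
Lemma mgf_step (phi : T -> R) (lam : R) : 0 <= lam ->
  (forall t u, `|phi t - phi u| <= g t + g u) ->
  \sum_t w t * expR (lam * (phi t - \sum_u w u * phi u))
    <= expR (lam ^+ 2 * v * expR (lam * (2 * G))).
Proof.
move=> lam0 hphi; set m := \sum_u w u * phi u; set gb := \sum_t w t * g t.
have gb0 : 0 <= gb by apply: sumr_ge0 => t _; rewrite mulr_ge0.
have gbG : gb <= G.
  rewrite -[G]mul1r -w_sum1 mulr_suml; apply: ler_sum => t _.
  by rewrite ler_wpM2l.
have dev t : `|phi t - m| <= g t + gb.
  have -> : phi t - m = \sum_u w u * (phi t - phi u).
    rewrite (eq_bigr (fun u => w u * phi t - w u * phi u)); last by move=> u _; ring.
    by rewrite sumrB -mulr_suml w_sum1 mul1r.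
  have -> : g t + gb = \sum_u w u * (g t + g u).
    rewrite (eq_bigr (fun u => w u * g t + w u * g u)); last by move=> u _; ring.
    by rewrite big_split /= -mulr_suml w_sum1 mul1r.
  apply: (le_trans (ler_norm_sum _ _ _)); apply: ler_sum => u _.
  by rewrite normrM ger0_norm // ler_wpM2l.
have sq t : (phi t - m) ^+ 2 <= 2 * g t ^+ 2 + 2 * gb ^+ 2.
  have h : (phi t - m) ^+ 2 <= (g t + gb) ^+ 2.
    by rewrite -(real_normK (num_real (_ - _))) ler_sqr ?nnegrE ?addr_ge0.
  by rewrite (le_trans h) // -subr_ge0; have := sqr_ge0 (g t - gb); nra.
have gb2 : gb ^+ 2 <= \sum_t w t * g t ^+ 2.
  have := @sum_cauchy_schwarz R T w g (fun=> 1) w_ge0.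
  under eq_bigr do rewrite mulr1.
  by under [X in _ <= _ * X]eq_bigr do rewrite expr1n mulr1; rewrite w_sum1 mulr1.
set e := expR (lam * (2 * G)).
have e0 : 0 <= e by rewrite expR_ge0.
apply: le_trans (expR_ge1Dx _).
apply: (le_trans (y := \sum_t (w t + lam * (w t * phi t - w t * m) +
   lam ^+ 2 * e * (w t * (2 * g t ^+ 2) + w t * (2 * gb ^+ 2))))).
  apply: ler_sum => t _.
  have -> : w t + lam * (w t * phi t - w t * m) +
     lam ^+ 2 * e * (w t * (2 * g t ^+ 2) + w t * (2 * gb ^+ 2)) =
     w t * (1 + lam * (phi t - m) + lam ^+ 2 * (2 * g t ^+ 2 + 2 * gb ^+ 2) * e).
    by ring.
  rewrite ler_wpM2l // (le_trans (expR_le_quadratic _)) // lerD2l exprMn.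
  apply: ler_pM; [by apply: mulr_ge0; exact: sqr_ge0 | exact: expR_ge0
    | by rewrite ler_wpM2l ?sqr_ge0 | ].
  rewrite ler_expR normrM ger0_norm // ler_wpM2l // (le_trans (dev t)) //.
  by have := g_le t; lra.
rewrite big_split big_split /= w_sum1 -!mulr_sumr sumrB -mulr_suml w_sum1 mul1r.
rewrite subrr mulr0 addr0 big_split /= -[X in _ + lam ^+ 2 * e * (_ + X)]mulr_suml w_sum1 mul1r.
rewrite (eq_bigr (fun t => 2 * (w t * g t ^+ 2))); last by move=> t _; ring.
rewrite -mulr_sumr lerD2l [leRHS]mulrAC; apply: ler_wpM2l; first by rewrite mulr_ge0 ?sqr_ge0.
by rewrite /v; lra.
Qed.

(** The bound depends on the two values exchanged and is not uniform, so the second moment of g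
    enters the exponential moment and its maximum only acts as a cap. *)
Definition bounded_diff (n : nat) (f : seq T -> R) : Prop :=
  forall s1 s2 t u, (size s1 + size s2).+1 = n ->
    `|f (s1 ++ t :: s2) - f (s1 ++ u :: s2)| <= g t + g u.

(** Doob's martingale argument as an induction on n: [phi t] is the conditional mean given a first
    draw t and inherits the oscillation bound, so [mgf_step] treats the first draw and the induction
    hypothesis the others. *)
Lemma Ex_mgf n (f : seq T -> R) (lam : R) : 0 <= lam -> bounded_diff n f ->
  Ex w n (fun s => expR (lam * (f s - Ex w n f)))
    <= expR (n%:R * (lam ^+ 2 * v * expR (lam * (2 * G)))).
Proof.
move=> lam0; elim: n f => [|n IH] f hf.
  by rewrite !Ex0 subrr mulr0 mul0r.
set B := _ * _ * expR _ in IH *.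
pose phi t := Ex w n (fun s => f (t :: s)).
have Ef : Ex w n.+1 f = \sum_t w t * phi t by rewrite ExS.
rewrite ExS Ef; set m := \sum_t w t * phi t.
have -> : n.+1%:R * B = n%:R * B + B by rewrite -natr1; ring.
rewrite expRD.
apply: (le_trans (y := \sum_t w t * (expR (lam * (phi t - m)) * expR (n%:R * B)))).
  apply: ler_sum => t _; rewrite ler_wpM2l //.
  have -> : Ex w n (fun s => expR (lam * (f (t :: s) - m))) =
     expR (lam * (phi t - m)) * Ex w n (fun s => expR (lam * (f (t :: s) - phi t))).
    rewrite -ExZ; apply: eq_Ex => s _; rewrite -expRD; congr expR; ring.
  rewrite ler_wpM2l ?expR_ge0 //; apply: (IH (fun s => f (t :: s))).
  by move=> s1 s2 u u' hs; apply: (hf (t :: s1)); rewrite /= addSn hs.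
under eq_bigr do rewrite mulrA.
rewrite -mulr_suml mulrC ler_wpM2l ?expR_ge0 // mgf_step // => t u.
rewrite /phi -[X in _ - X]mul1r -mulNr -ExZ -ExD.
have bd s : size s = n -> `|f (t :: s) - f (u :: s)| <= g t + g u.
  by move=> hs; apply: (hf [::] s); rewrite hs.
rewrite ler_norml; apply/andP; split.
  rewrite -[leLHS](Ex_cst w_sum1 n); apply: le_Ex => // s /bd.
  by rewrite ler_norml => /andP[]; lra.
rewrite -[leRHS](Ex_cst w_sum1 n); apply: le_Ex => // s /bd.
by rewrite ler_norml => /andP[]; lra.
Qed.

(** Chernoff's bound with lam = l q / a, where l is half the logarithm of a^2 / V (if V >= a^2 the
    claim is trivial). Then e^(-lam a) is the announced power, 2 G q <= a gives e^(2 G lam) <= e^l,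
    and the remaining exponent V lam^2 e^l equals q^2 l^2 e^(-l), at most q^2. *)
Lemma Pr_fuk_nagaev n (f : seq T -> R) (q a V : R) :
  0 < q -> 0 < a -> 0 < V -> n%:R * v <= V -> 2 * G * q <= a ->
  bounded_diff n f ->
  Pr w n (fun s => Ex w n f + a < f s) <= expR (q ^+ 2) * (V / a ^+ 2) `^ (q / 2).
Proof.
move=> q0 a0 V0 nv bG hf.
have a20 : 0 < a ^+ 2 by rewrite exprn_gt0.
have Y0 : 0 < V / a ^+ 2 by rewrite divr_gt0.
have [h|h] := leP 1 (V / a ^+ 2).
  apply: (le_trans (y := 1)).
    rewrite -[leRHS](Ex_cst w_sum1 n); apply: le_Ex => // s _.
    by rewrite lern1 leq_b1.
  rewrite -[leLHS]mulr1 ler_pM //.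
    by rewrite -expR0 ler_expR sqr_ge0.
  by rewrite -[leLHS](powRr0 (V / a ^+ 2)) ler_powR // divr_ge0 // ltW.
pose l := - (ln (V / a ^+ 2) / 2).
have l0 : 0 < l by rewrite oppr_gt0 pmulr_llt0 ?invr_gt0 // ln_lt0 // Y0.
have Vl : V = a ^+ 2 * expR (- (2 * l)).
  rewrite /l; have -> : - (2 * - (ln (V / a ^+ 2) / 2)) = ln (V / a ^+ 2) by field.
  by rewrite lnK ?posrE // mulrCA divff ?mulr1 // gt_eqF.
have -> : (V / a ^+ 2) `^ (q / 2) = expR (- (q * l)).
  by rewrite /powR gt_eqF // /l; congr expR; field.
pose lam := l * q / a.
have lam0 : 0 <= lam by rewrite divr_ge0 ?mulr_ge0 // ltW.
apply: (le_trans (y := Ex w n (fun s => expR (lam * (f s - Ex w n f))) / expR (lam * a))).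
  apply: le_trans (@Pr_markov _ _ w w_ge0 n (fun s => expR (lam * (f s - Ex w n f))) _ _ _).
  - apply: le_Ex => // s _; rewrite ler_nat; case: ltP => //= hs.
    rewrite ler_expR; rewrite ler_wpM2l //; lra.
  - exact: expR_gt0.
  - by move=> s; exact: expR_ge0.
rewrite -expRN (le_trans (ler_wpM2r (expR_ge0 _) (Ex_mgf lam0 hf))) // -!expRD ler_expR.
have -> : lam * a = q * l by rewrite /lam; field; rewrite gt_eqF.
rewrite lerD2r.
have hG : expR (lam * (2 * G)) <= expR l.
  rewrite ler_expR /lam mulrAC ler_pdivrMr // -mulrA ler_wpM2l ?(ltW l0) //.
  by rewrite mulrC.
have v0 : 0 <= v.
  by rewrite mulr_ge0 // sumr_ge0 // => t _; rewrite mulr_ge0 // sqr_ge0.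
apply: (le_trans (y := V * lam ^+ 2 * expR l)).
  rewrite mulrA [n%:R * _]mulrCA [V * _]mulrC; apply: ler_pM => //.
  - by rewrite mulr_ge0 ?sqr_ge0 // mulr_ge0.
  - by rewrite ler_wpM2l ?sqr_ge0.
have -> : V * lam ^+ 2 * expR l = q ^+ 2 * (l ^+ 2 * expR (- l)).
  rewrite {1}Vl /lam; have -> : expR (- l) = expR (- (2 * l)) * expR l.
    by rewrite -expRD; congr expR; ring.
  by field; rewrite gt_eqF.
rewrite -[leRHS]mulr1 ler_wpM2l ?sqr_ge0 // expRN ler_pdivrMr ?expR_gt0 // mul1r.
exact: sqr_le_expR (ltW l0).
Qed.

End Concentration.

(** * Greedy coupling along a tree of partitions *)

Section TreeCoupling.
Context {R : realType} {T : finType}.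
Implicit Types (w nu : T -> R) (Q : T -> T -> R).

Definition subcoupling w nu Q :=
  [/\ forall t u, 0 <= Q t u, forall t, \sum_u Q t u <= w t
    & forall u, \sum_t Q t u <= nu u].

Definition block Q (C : eqType) (f : T -> C) (c : C) : R :=
  \sum_(t | f t == c) \sum_(u | f u == c) Q t u.

(** As much mass is matched inside each class as the marginals allow; the reverse inequality holds
    for every [subcoupling]. *)
Definition tight w nu Q (C : eqType) (f : T -> C) :=
  forall c, Num.min (\sum_(t | f t == c) w t) (\sum_(t | f t == c) nu t)
            <= block Q f c.

(* Match as much as possible of the mass left over by [Q] inside each class of
   the coarser partition [f]; the finer partitions stay tight because the
   coupling only grows. *)
Lemma subcoupling_extend w nu Q (C : eqType) (f : T -> C) :
  subcoupling w nu Q -> (forall t u, f t != f u -> Q t u = 0) ->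
  exists2 Q', subcoupling w nu Q' &
    [/\ forall t u, Q t u <= Q' t u, forall t u, f t != f u -> Q' t u = 0
      & tight w nu Q' f].
Proof.
move=> [Q0 Qw Qnu] Qf.
pose a t := w t - \sum_u Q t u; pose b u := nu u - \sum_t Q t u.
pose A c := \sum_(t | f t == c) a t; pose B c := \sum_(u | f u == c) b u.
have a0 t : 0 <= a t by rewrite subr_ge0.
have b0 t : 0 <= b t by rewrite subr_ge0.
have A0 c : 0 <= A c by apply: sumr_ge0.
have B0 c : 0 <= B c by apply: sumr_ge0.
(* The leftovers are matched by their product divided by the larger of the two totals: the marginals
   stay within the leftovers and min(A, B) is matched. If both totals vanish, the inverse is 0 and
   nothing is added. *)
pose N c := (Num.max (A c) (B c))^-1.
have N0 c : 0 <= N c by rewrite invr_ge0 le_max A0.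
have AN c : A c * N c <= 1.
  have [h|h] := eqVneq (Num.max (A c) (B c)) 0; first by rewrite /N h invr0 mulr0.
  rewrite ler_pdivrMr ?mul1r ?le_max ?lexx //.
  by rewrite lt0r h le_max A0.
have BN c : B c * N c <= 1.
  have [h|h] := eqVneq (Num.max (A c) (B c)) 0; first by rewrite /N h invr0 mulr0.
  rewrite ler_pdivrMr ?mul1r ?le_max ?lexx ?orbT //.
  by rewrite lt0r h le_max A0.
pose P t u := if f t == f u then a t * b u * N (f t) else 0.
have P0 t u : 0 <= P t u by rewrite /P; case: ifP => // _; rewrite !mulr_ge0.
exists (fun t u => Q t u + P t u).
  split => [t u|t|u]; first by rewrite addr_ge0.
    rewrite big_split /= -lerBrDl -/(a t).
    rewrite (eq_bigr (fun u => if f u == f t then a t * N (f t) * b u else 0)); last first.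
      by move=> u _; rewrite /P eq_sym; case: ifP => // _; ring.
    rewrite -big_mkcond -mulr_sumr -/(B (f t)) -mulrA.
    by rewrite ler_piMr // mulrC.
  rewrite big_split /= -lerBrDl -/(b u).
  rewrite (eq_bigr (fun t => if f t == f u then b u * N (f u) * a t else 0)); last first.
    by move=> t _; rewrite /P; case: ifP => // /eqP ->; ring.
  rewrite -big_mkcond -mulr_sumr -/(A (f u)) -mulrA.
  by rewrite ler_piMr // mulrC.
split => [t u|t u h|c]; first by rewrite lerDl.
  by rewrite /P (negbTE h) Qf // addr0.
have inner t : f t = c -> \sum_(u | f u == c) Q t u = \sum_u Q t u.
  move=> ftc; rewrite [RHS](bigID (fun u => f u == c)) /= [X in _ = _ + X]big1 ?addr0 //.
  by move=> u hu; rewrite Qf // ftc eq_sym.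
have inner' u : f u = c -> \sum_(t | f t == c) Q t u = \sum_t Q t u.
  move=> fuc; rewrite [RHS](bigID (fun t => f t == c)) /= [X in _ = _ + X]big1 ?addr0 //.
  by move=> t ht; rewrite Qf // fuc.
set q := block Q f c.
(* Q never leaves a class, so the mass of a class is its leftover plus the mass [q] already matched
   inside; the smaller marginal is q + min(A, B). *)
have wA : \sum_(t | f t == c) w t = A c + q.
  rewrite /A /q /block -big_split; apply: eq_bigr => t /eqP ht /=.
  by rewrite inner // subrK.
have nB : \sum_(t | f t == c) nu t = B c + q.
  rewrite /B /q /block exchange_big -big_split; apply: eq_bigr => t /eqP ht /=.
  by rewrite inner' // subrK.
have -> : block (fun t u => Q t u + P t u) f c = A c * B c * N c + q.
  rewrite /block [RHS]addrC.
  rewrite (eq_bigr (fun t => \sum_(u | f u == c) Q t u + a t * B c * N c)).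
    by rewrite big_split /= -!mulr_suml.
  move=> t /eqP ht; rewrite big_split /=; congr (_ + _).
  rewrite -mulrA mulr_suml mulr_sumr; apply: eq_bigr => u /eqP hu.
  by rewrite /P ht hu eqxx; ring.
rewrite wA nB -addr_minl lerD2r /N.
have [h|h] := eqVneq (Num.max (A c) (B c)) 0.
  by rewrite h invr0 mulr0 ge_min -h le_max lexx.
have h0 : 0 < Num.max (A c) (B c) by rewrite lt0r h le_max A0.
by rewrite ler_pdivlMr //; case: (leP (A c) (B c)) => _ //; rewrite mulrC.
Qed.

(* [f j] is the partition of depth [j] counted from the finest one. *)
Lemma subcoupling_levels w nu (C : eqType) (f : nat -> T -> C) m :
  (forall t, 0 <= w t) -> (forall t, 0 <= nu t) ->
  (forall j t u, f j t = f j u -> f j.+1 t = f j.+1 u) ->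
  exists2 Q, subcoupling w nu Q &
    (forall t u, f m t != f m u -> Q t u = 0) /\
    (forall j, (j <= m)%N -> tight w nu Q (f j)).
Proof.
move=> w0 nu0 nest; elim: m => [|m [Q hQ [Qs Qt]]].
  case: (@subcoupling_extend w nu (fun _ _ => 0) _ (f 0%N)) => //.
    by split=> // t; rewrite big1.
  move=> Q hQ [_ Qs Qt]; exists Q => //; split => // j.
  by rewrite leqn0 => /eqP ->.
case: (@subcoupling_extend w nu Q _ (f m.+1) hQ).
  move=> t u h; apply: Qs; apply: contra h => /eqP h; apply/eqP; exact: nest.
move=> Q' hQ' [le_Q Qs' Qt']; exists Q' => //; split => // j.
rewrite leq_eqVlt => /orP[/eqP -> //|]; rewrite ltnS => jm c.
rewrite (le_trans (Qt j jm c)) //.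
by apply: ler_sum => t _; apply: ler_sum => u _.
Qed.

(** If q is the mass matched inside class c, the masses leaving and entering c add up to (w(c) - q)
    + (nu(c) - q), and tightness, q >= min(w(c), nu(c)), makes this at most |w(c) - nu(c)|. One
    coupling achieves it at all depths. *)
Lemma tree_coupling w nu (C : eqType) (e : nat -> T -> C) m :
  (forall t, 0 <= w t) -> (forall t, 0 <= nu t) ->
  \sum_t w t = \sum_t nu t ->
  (forall l t u, e l.+1 t = e l.+1 u -> e l t = e l u) ->
  exists2 Q : T -> T -> R,
    [/\ forall t u, 0 <= Q t u, forall t, \sum_u Q t u = w t
      & forall u, \sum_t Q t u = nu u] &
    forall l, (l <= m)%N -> forall c,
      \sum_t \sum_u Q t u * (if e l t != e l u then (e l t == c)%:R + (e l u == c)%:R else 0)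
      <= `|\sum_(t | e l t == c) w t - \sum_(t | e l t == c) nu t|.
Proof.
move=> w0 nu0 wnu nest.
(* [subcoupling_levels] counts from the finest partition, [e] from the root. Truncated subtraction
   repeats [e 0] beyond m, so the sequence stays nested. *)
pose f j t := e (m - j)%N t.
case: (@subcoupling_levels w nu C f m w0 nu0).
  move=> j t u; rewrite /f => h.
  have [jm|jm] := ltnP j m; first by apply: nest; rewrite -subSn // subSS.
  by have -> : (m - j.+1 = m - j)%N by lia.
move=> Q0 hQ0 [_ Qt0].
(* A last round with the one-class partition matches all that is left; equality of the total masses
   then turns the marginal inequalities into equalities. *)
case: (@subcoupling_extend w nu Q0 _ (fun=> tt) hQ0) => // Q [Qge Qw Qnu] [le_Q _ Qt].
have eqrows : forall (x y : T -> R), (forall t, x t <= y t) ->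
    \sum_t y t <= \sum_t x t -> forall t, x t = y t.
  move=> x y xy h t; apply/eqP; rewrite eq_le xy /= -subr_ge0 -oppr_le0 opprB.
  have : \sum_t (y t - x t) <= 0 by rewrite sumrB subr_le0.
  rewrite (bigD1 t) //= => h2; apply: le_trans h2.
  by rewrite lerDl sumr_ge0 // => u _; rewrite subr_ge0.
have tot : \sum_t w t <= \sum_t \sum_u Q t u.
  by have := Qt tt; rewrite /block /= eqxx wnu minxx.
have Qw' := eqrows _ _ Qw tot.
have Qnu' : forall u, \sum_t Q t u = nu u.
  by apply: eqrows => //; rewrite -wnu exchange_big.
exists Q; first by split.
move=> l lm c.
have hb : Num.min (\sum_(t | e l t == c) w t) (\sum_(t | e l t == c) nu t) <= block Q (e l) c.
  have := Qt0 (m - l)%N (leq_subr _ _) c; rewrite /f subKn // => h.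
  rewrite (le_trans h) //.
  by apply: ler_sum => t _; apply: ler_sum => u _.
set q := block _ _ _ in hb.
pose X := \sum_(t | e l t == c) w t; pose Y := \sum_(t | e l t == c) nu t.
have -> : \sum_t \sum_u Q t u * (if e l t != e l u then (e l t == c)%:R + (e l u == c)%:R else 0)
   = (X - q) + (Y - q).
  have key1 : X - q = \sum_t \sum_u Q t u * ((e l t == c) && (e l u != c))%:R.
    rewrite /X /q /block big_mkcond [X in _ - X]big_mkcond -sumrB; apply: eq_bigr => t _.
    case: ifP => ht; last by rewrite subr0 big1 // => u _; rewrite mulr0.
    rewrite -Qw' [X in _ - X]big_mkcond -sumrB; apply: eq_bigr => u _.
    by case: ifP => hu; rewrite /= ?mulr1 ?mulr0 ?subrr ?subr0.
  have key2 : Y - q = \sum_t \sum_u Q t u * ((e l u == c) && (e l t != c))%:R.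
    rewrite /Y /q /block exchange_big [in RHS]exchange_big.
    rewrite big_mkcond [X in _ - X]big_mkcond -sumrB; apply: eq_bigr => t _.
    case: ifP => ht; last by rewrite subr0 big1 // => u _; rewrite mulr0.
    rewrite -Qnu' [X in _ - X]big_mkcond -sumrB; apply: eq_bigr => u _.
    by case: ifP => hu; rewrite /= ?mulr1 ?mulr0 ?subrr ?subr0.
  rewrite key1 key2 -big_split; apply: eq_bigr => t _.
  rewrite -big_split; apply: eq_bigr => u _ /=; rewrite -mulrDr; congr (_ * _).
  have [->|h] := eqVneq (e l t) (e l u).
    by case: eqP => //=; rewrite addr0.
  have [h1|h1] := eqVneq (e l t) c; have [h2|h2] := eqVneq (e l u) c => //=.
  by rewrite h1 h2 eqxx in h.
rewrite -/X -/Y; have [XY|XY] := leP X Y.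
  by rewrite ler0_norm ?subr_le0 //; move: hb; rewrite -/X -/Y min_l //; lra.
by rewrite gtr0_norm ?subr_gt0 //; move: hb; rewrite -/X -/Y min_r ?(ltW XY) //; lra.
Qed.

End TreeCoupling.

(** * Measurability of the transport cost to the empirical measure *)

Lemma ge0_integral_mrestr d (Y : measurableType d) (R : realType)
    (m : {measure set Y -> \bar R}) (D : set Y) (mD : measurable D)
    (f : Y -> \bar R) :
  measurable_fun setT f -> (forall y, (0 <= f y)%E) ->
  (\int[mrestr m mD]_y f y = \int[m]_(y in D) f y)%E.
Proof.
move=> mf f0.
have mDC : measurable (~` D) by exact: measurableC.
rewrite -(setvU D) ge0_integral_setU //=; last 2 first.
- by rewrite setvU.
- by rewrite disj_set2E setICl.
rewrite [X in (X + _)%E]null_set_integral ?add0e //; last 2 first.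
- exact: measurable_funTS.
- change (m (~` D `&` D) = 0%E); rewrite setICl.
  exact: measure0.
apply: eq_measure_integral => A mA AD; change (m (A `&` D) = m A).
by rewrite setIidl.
Qed.

(** A measure assembled from pieces: restrict m0 to [D j], scale by [kap j], push forward by
    [phi j], sum over j. It serves to move the atoms of an empirical measure and to realize a matrix
    of masses between cells. *)
Lemma glue_probability d1 d2 (Y : measurableType d1) (Z : measurableType d2)
    (R : realType) (m0 : {measure set Y -> \bar R}) (J : finType)
    (kap : J -> R) (D : J -> set Y) (phi : J -> Y -> Z) :
  (forall j, 0 <= kap j) -> (forall j, measurable (D j)) ->
  (forall j, measurable_fun setT (phi j)) ->
  (\sum_j (kap j)%:E * m0 (D j) = 1)%E ->
  exists pi : probability Z R,
    (forall A, measurable A ->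
       pi A = \sum_j (kap j)%:E * m0 (phi j @^-1` A `&` D j))%E /\
    (forall f : Z -> \bar R, measurable_fun setT f -> (forall z, 0 <= f z)%E ->
       \int[pi]_z f z = \sum_j (kap j)%:E * \int[m0]_(y in D j) f (phi j y))%E.
Proof.
move=> kap0 mD mphi tot.
pose mj j : {measure set Z -> \bar R} := mscale (NngNum (kap0 j))
  (measure_function_pushforward__canonical__measure_function_Measure
     (mrestr m0 (mD j)) (mphi j)).
(* [msum] adds a sequence indexed by [nat], so J is enumerated and the sequence completed by the
   zero measure. *)
pose m_ (k : nat) : {measure set Z -> \bar R} :=
  if (insub k : option 'I_#|J|) is Some i then mj (enum_val i) else mzero.
have mE (F : {measure set Z -> \bar R} -> \bar R) :
    (\sum_(k < #|J|) F (m_ k) = \sum_j F (mj j))%E.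
  rewrite (reindex (@enum_rank J)) /=; last first.
    by exists enum_val => ? _; rewrite ?enum_rankK ?enum_valK.
  by apply: eq_bigr => j _; rewrite /m_ valK enum_rankK.
pose q : {measure set Z -> \bar R} := msum m_ #|J|.
have qE A : q A = (\sum_j (kap j)%:E * m0 (phi j @^-1` A `&` D j))%E.
  by rewrite /q /= /msum (mE (fun m => m A)).
have q1 : q setT = 1%E.
  by rewrite qE -tot; apply: eq_bigr => j _; rewrite preimage_setT setTI.
pose pi : probability Z R := HB.pack (msum m_ #|J|)
  (Measure_isProbability.Build _ _ _ (msum m_ #|J|) q1).
exists pi; split => [A mA|f mf f0]; first exact: qE.
rewrite [LHS](_ : _ = \int[msum m_ #|J|]_z f z)%E //.
rewrite ge0_integral_measure_sum // (mE (fun m => \int[m]_z f z)%E).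
apply: eq_bigr => j _; rewrite /mj ge0_integral_mscale //=; congr (_ * _)%E.
rewrite ge0_integral_pushforward //= preimage_setT ge0_integral_mrestr //.
by apply: measurableT_comp.
Qed.

Section MetricMeasurability.
Context {R : realType} {dE : measure_display} {E : measurableType dE}.
Variable dist : E -> E -> R.
Hypothesis dist_polish : polish dist.
Hypothesis dist_borel : borel_of_metric dist.

Lemma dist_ge0 x y : 0 <= dist x y.
Proof. by case: dist_polish => -[]. Qed.

Lemma dist_sym x y : dist x y = dist y x.
Proof. by case: dist_polish => -[_ [_ []]]. Qed.

Lemma dist_triangle y x z : dist x z <= dist x y + dist y z.
Proof. by case: dist_polish => -[_ [_ []]]. Qed.

Lemma dist_eq0 x y : dist x y = 0 <-> x = y.
Proof. by case: dist_polish => -[_ []]. Qed.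

Lemma mopen_measurable (A : set E) : mopen dist A -> measurable A.
Proof. by move=> oA; rewrite dist_borel; apply: sub_sigma_algebra. Qed.

Lemma measurable_mball x (r : R) : measurable [set y | dist x y < r].
Proof.
apply: mopen_measurable => y /= yr; exists (r - dist x y); first by rewrite subr_gt0.
by move=> z /= yz; have := dist_triangle y x z; lra.
Qed.

Lemma measurable_dist x : measurable_fun setT (dist x).
Proof.
move=> _; apply: (measurability _ (RGenInftyO.measurableE R)) => //.
move=> _ [_ [r ->] <-]; rewrite setTI.
rewrite [X in measurable X](_ : _ = [set y | dist x y < r]).
  exact: measurable_mball.
by apply/seteqP; split=> y /=; rewrite in_itv.
Qed.

Lemma measurable_cball x (r : R) : measurable (cball dist x r).
Proof.
rewrite (_ : cball dist x r = setT `&` dist x @^-1` `]-oo, r]%classic).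
  by apply: measurable_dist => //; exact: measurable_itv.
by apply/seteqP; split=> y /=; rewrite /cball /= in_itv /=; [split|case].
Qed.

Lemma dense_sequence (x0 : E) : exists u : nat -> E,
  forall x (e : R), 0 < e -> exists k, dist (u k) x < e.
Proof.
case: dist_polish => _ [D cD dD] _.
case/countable_injP : cD => f finj.
exists (fun k => xget x0 [set y | D y /\ f y = k]) => x e e0.
have [y Dy xy] := dD x e e0; exists (f y).
set z := xget _ _.
have [Dz fz] : D z /\ f z = f y.
  by apply: (@xgetPex _ x0 [set y' | D y' /\ f y' = f y]); exists y.
by rewrite (finj z y) ?inE // dist_sym.
Qed.

(** The sigma-algebra on E * E is the product one, so continuity has to be combined with
    separability: {dist < r} is a countable union of rectangles of balls around a dense sequence. *)
Lemma measurable_dist2 : measurable_fun setT (fun z : E * E => dist z.1 z.2).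
Proof.
have [[x0 _]|E0] := pselect (exists x : E, True); last first.
  move=> _ Y mY; rewrite (_ : _ `&` _ = set0) //.
  by apply/seteqP; split => // -[x y] _; apply: E0; exists x.
have [u du] := dense_sequence x0.
move=> _; apply: (measurability _ (RGenInftyO.measurableE R)) => //.
move=> _ [_ [r ->] <-]; rewrite setTI.
rewrite [X in measurable X](_ : _ = \bigcup_(q : nat * nat)
   ([set y | dist (u q.1) y < q.2.+1%:R^-1] `*` [set y | dist (u q.1) y < r - q.2.+1%:R^-1])).
  apply: countable_bigcupT_measurable => // q.
  by apply: measurableX; exact: measurable_mball.
apply/seteqP; split => [[x y] /= | [x y] [[k m] _ /= [h1 h2]]]; rewrite in_itv /=.
  move=> xy; have e0 : 0 < (r - dist x y) / 2 by lra.
  have [m hm] : exists m, (m.+1%:R^-1 : R) < (r - dist x y) / 2.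
    have [m hm] := ltr_add_invr e0.
    by exists m; rewrite add0r in hm.
  have [k hk] := du x m.+1%:R^-1 ltac:(by rewrite invr_gt0).
  exists (k, m) => //=; split => //.
  by move: hm hk; move: (m.+1%:R^-1) => a; have := dist_triangle x (u k) y; lra.
by move: h1 h2; move: (m.+1%:R^-1) => a; have := dist_triangle (u k) x y;
  rewrite (dist_sym x (u k)); lra.
Qed.

Lemma measurable_cost (p : R) :
  measurable_fun setT (fun z : E * E => ((dist z.1 z.2) `^ p)%:E).
Proof.
apply/measurable_EFinP.
exact: (measurableT_comp (measurable_powR p) measurable_dist2).
Qed.

(** An open condition on n points is a countable union of boxes of balls with dense centres and
    radii 1/(m+1). Only boxes included in U are kept, so each piece is empty or a finite
    intersection of preimages of balls. *)
Lemma measurable_open_event dO (Om : measurableType dO) (x0 : E) n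
    (X : 'I_n -> Om -> E) (U : ('I_n -> E) -> Prop) :
  (forall i, measurable_fun setT (X i)) ->
  (forall xs, U xs -> exists2 e : R, 0 < e &
     forall ys, (forall i, dist (xs i) (ys i) < e) -> U ys) ->
  measurable [set om | U (fun i => X i om)].
Proof.
move=> mX oU; have [u du] := dense_sequence x0.
pose B (q : nat * {ffun 'I_n -> nat}) : set ('I_n -> E) :=
  [set ys | forall i, dist (u (q.2 i)) (ys i) < q.1.+1%:R^-1].
pose F q : set Om := [set om | B q `<=` U /\ B q (fun i => X i om)].
rewrite [X in measurable X](_ : _ = \bigcup_q F q).
  apply: countable_bigcupT_measurable => // q.
  have [BU|BU] := pselect (B q `<=` U); last first.
    by rewrite (_ : F q = set0) //; apply/seteqP; split=> // om [].
  rewrite (_ : F q = \bigcap_(i in [set: 'I_n])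
      (X i @^-1` [set y | dist (u (q.2 i)) y < q.1.+1%:R^-1])).
    apply: fin_bigcap_measurable => // i _.
    by rewrite -[X in measurable X]setTI; apply: mX => //; exact: measurable_mball.
  by apply/seteqP; split => [om [_ h] i _|om h]; [exact: h|split => // i; exact: h].
apply/seteqP; split => [om /= Uom|om [q _ [BU Bom]]]; last exact: BU.
have [e e0 he] := oU _ Uom.
have [m hm] : exists m, (m.+1%:R^-1 : R) < e / 2.
  have [m hm] := ltr_add_invr (divr_gt0 e0 (ltr0Sn R 1)).
  by exists m; rewrite add0r in hm.
have hk i : exists k, dist (u k) (X i om) < m.+1%:R^-1.
  by apply: du; rewrite invr_gt0.
pose k i := xchoose (hk i).
exists (m, [ffun i => k i]) => //; split => [ys hys|i] /=; last first.
  by rewrite ffunE; exact: (xchooseP (hk i)).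
apply: he => i; have := hys i; rewrite /= ffunE => h1.
have := dist_triangle (u (k i)) (X i om) (ys i); rewrite (dist_sym (X i om) (u (k i))).
by have := xchooseP (hk i); rewrite -/(k i); move: hm h1; move: (m.+1%:R^-1) => a; lra.
Qed.

End MetricMeasurability.

(** The margin e does not depend on t. If e <= dl t, the increase is absorbed by the factor a with
    a^p = 1 + eta; for smaller t, s is at most eta^(1/p), hence s^p at most eta. *)
Lemma powR_perturb (R : realType) (p eta : R) : 1 <= p -> 0 < eta ->
  exists2 e : R, 0 < e & forall t s, 0 <= t -> 0 <= s -> s <= t + e ->
    s `^ p <= (1 + eta) * t `^ p + eta.
Proof.
move=> p1 eta0; have p0 : 0 < p by lra.
have pV : p^-1 * p = 1 by rewrite mulVf // gt_eqF.
pose a := (1 + eta) `^ p^-1.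
have a1 : 1 < a.
  rewrite -[ltLHS](powRr0 (1 + eta)) /a /powR gt_eqF; last lra.
  by rewrite ltr_expR ltr_pM2r ?invr_gt0 // ln_gt0; lra.
have ap : a `^ p = 1 + eta by rewrite -powRrM pV powRr1; lra.
pose dl := a - 1; have dl0 : 0 < dl by rewrite subr_gt0.
have k0 : 0 < 1 + dl^-1 by rewrite addr_gt0 // invr_gt0.
exists (eta `^ p^-1 / (1 + dl^-1)); first by rewrite divr_gt0 // powR_gt0.
set e := _ / _ => t s t0 s0 ste.
have e0 : 0 < e by rewrite divr_gt0 // powR_gt0.
have [h|h] := leP e (dl * t).
  have : s `^ p <= (t * a) `^ p.
    by apply: ge0_ler_powR; rewrite ?nnegrE ?mulr_ge0 //; rewrite /dl in h; nra.
  by rewrite powRM //; [rewrite ap mulrC; lra | lra].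
have : s `^ p <= (eta `^ p^-1) `^ p.
  apply: ge0_ler_powR; rewrite ?nnegrE ?powR_ge0 //; first lra.
  have -> : eta `^ p^-1 = e + e / dl by rewrite /e; field; rewrite !gt_eqF //; lra.
  have : t <= e / dl by rewrite ler_pdivlMr // mulrC ltW.
  lra.
rewrite -powRrM pV powRr1; last lra.
have : 0 <= (1 + eta) * t `^ p by rewrite mulr_ge0 ?powR_ge0 //; lra.
lra.
Qed.

Lemma perturb_lt (R : realType) (a b d : R) :
  b * (2 * (a + 1)) = d - a -> a < d -> (1 + b) * a + b < d.
Proof. lra. Qed.

Section WassersteinMeasurability.
Context {R : realType} {dE : measure_display} {E : measurableType dE}.
Variable dist : E -> E -> R.
Hypothesis dist_polish : polish dist.
Hypothesis dist_borel : borel_of_metric dist.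

Lemma measurable_point (x : E) : measurable [set x].
Proof.
rewrite (_ : [set x] = cball dist x 0); first exact: measurable_cball.
apply/seteqP; split=> y /=; rewrite /cball /=.
  by move=> ->; have [_ ->] := dist_eq0 dist_polish x x.
move=> h; apply/esym/(dist_eq0 dist_polish)/eqP.
by rewrite eq_le h (dist_ge0 dist_polish).
Qed.

Lemma empiricalE n (xs : 'I_n -> E) (A : set E) :
  empirical (R := R) xs A = (n%:R^-1 * \sum_(i < n) (xs i \in A)%:R)%:E.
Proof.
by rewrite /empirical EFinM -sumEFin; congr (_ * _)%E; apply: eq_bigr => i _; rewrite diracE.
Qed.

Variables (p : R) (mu : probability E R).
Hypothesis p_ge1 : 1 <= p.

(* A coupling of mu and the empirical measure of xs is turned into one for ys by
   sending the mass carried by each atom to the corresponding points of ys. *)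
Lemma Wpp_usc n (xs : 'I_n -> E) (c : R) : (0 < n)%N ->
  (Wpp dist p mu (empirical xs) < c%:E)%E ->
  exists2 e : R, 0 < e & forall ys, (forall i, dist (xs i) (ys i) < e) ->
    (Wpp dist p mu (empirical ys) < c%:E)%E.
Proof.
move=> n0 /ereal_inf_lt[_ [pi [pi1 pi2] <-]] cost_c.
set cost := (\int[pi]_z _)%E in cost_c.
have cost0 : (0 <= cost)%E by apply: integral_ge0 => z _; rewrite lee_fin powR_ge0.
have costfin : cost \is a fin_num by rewrite ge0_fin_numE // (lt_trans cost_c) // ltry.
pose I := fine cost; have costE : cost = I%:E by rewrite fineK.
have I0 : 0 <= I by rewrite -lee_fin -costE.
have Ic : I < c by rewrite -lte_fin -costE.
(* Chosen so that (1 + eta) I + eta < c. *)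
pose eta := (c - I) / (2 * (I + 1)).
have eta0 : 0 < eta by rewrite divr_gt0 //; lra.
have [e e0 he] := powR_perturb p_ge1 eta0.
exists e => // ys xys.
(* Multiplicity of the value [xs i]. Equal sample points share one atom, and each index receives the
   fraction 1/m i of its mass. *)
pose m i : R := \sum_(j < n) (xs j == xs i)%:R.
have m0 i : 0 < m i.
  rewrite /m (bigD1 i) //= eqxx ltr_wpDr // sumr_ge0 // => j _.
pose D i := [set z : E * E | z.2 = xs i].
have mD i : measurable (D i).
  rewrite (_ : D i = setT `&` snd @^-1` [set xs i]); last by rewrite setTI.
  by apply: measurable_snd => //; exact: measurable_point.
have piD i : pi (D i) = (n%:R^-1 * m i)%:E.
  have -> : pi (D i) = pi (snd @^-1` [set xs i]) by [].
  rewrite pi2; last exact: measurable_point.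
  rewrite empiricalE; congr (_ * _)%:E; apply: eq_bigr => j _.
  rewrite (_ : (xs j \in [set xs i]) = (xs j == xs i)) //.
  by apply/idP/idP; rewrite in_setE /= => /eqP.
have mI i : m i != 0 by rewrite gt_eqF.
have nR0 : (n%:R : R) != 0 by rewrite pnatr_eq0 -lt0n.
case: (@glue_probability _ _ _ (E * E)%type R pi 'I_n (fun i => (m i)^-1) D
         (fun i z => (z.1, ys i))).
- by move=> i; rewrite invr_ge0 ltW.
- exact: mD.
- by move=> i; apply: measurable_fun_pair => //; exact: measurable_cst.
- rewrite (eq_bigr (fun=> (n%:R^-1)%:E)); last first.
    move=> i _; transitivity (((m i)^-1)%:E * (n%:R^-1 * m i)%:E)%E.
      by congr (_ * _)%E; exact: piD.
    by rewrite -EFinM mulrCA mulVf // mulr1.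
  by rewrite sumEFin sumr_const card_ord -[_ *+ n]mulr_natl mulfV.
move=> rho [rhoE rhoI].
have sum1 v : (exists i, xs i = v) -> \sum_i (m i)^-1 * (xs i == v)%:R = 1.
  move=> [i <-]; rewrite -[RHS](mulVf (mI i)) /m mulr_sumr; apply: eq_bigr => j _.
  have [ji|_] := eqVneq (xs j) (xs i); last by rewrite !mulr0.
  by rewrite mulr1 ji mulr1.
(* The second marginal charges only the sample points, so the sets [D i] exhaust the coupling up to
   a null set. *)
have null : pi (~` [set z : E * E | exists i, xs i = z.2]) = 0%E.
  have mr : measurable [set v | exists i, xs i = v].
    rewrite (_ : mkset _ = \bigcup_(i in [set: 'I_n]) [set xs i]).
      by apply: fin_bigcup_measurable => // i _; exact: measurable_point.
    by apply/seteqP; split => [v [i <-]|v [i _ ->]]; [exists i|exists i].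
  have -> : pi (~` [set z : E * E | exists i, xs i = z.2]) =
     pi (snd @^-1` ~` [set v | exists i, xs i = v]) by [].
  rewrite pi2; last exact: measurableC.
  rewrite empiricalE big1 ?mulr0 // => i _.
  by rewrite memNset //= => h; apply: h; exists i.
have split_mass (B : set (E * E)) : measurable B ->
    (\sum_i ((m i)^-1)%:E * pi (B `&` D i) = pi B)%E.
  move=> mB.
  have mN : measurable [set z : E * E | exists i, xs i = z.2].
    rewrite (_ : mkset _ = \bigcup_(i in [set: 'I_n]) D i).
      exact: fin_bigcup_measurable.
    by apply/seteqP; split => [v [i hi]|v [i _ hi]]; exists i.
  have mi i : measurable_fun B (fun z => (\1_(D i) z : R)%:E).
    by apply/measurable_EFinP; exact: measurable_indic.
  transitivity (\int[pi]_(z in B) (\sum_(i < n) ((m i)^-1)%:E * (\1_(D i) z)%:E))%E.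
    rewrite ge0_integral_sum //; last 2 first.
    - by move=> i; apply: measurable_funeM.
    - by move=> i z _; rewrite mule_ge0 // lee_fin ?invr_ge0 ?ltW.
    apply: eq_bigr => i _; rewrite ge0_integralZl //; last by rewrite lee_fin invr_ge0 ltW.
    by rewrite integral_indic // setIC.
  transitivity (\int[pi]_(z in B) (\1_[set z : E * E | exists i, xs i = z.2] z)%:E)%E.
    apply: eq_integral => z _; rewrite indicE.
    under eq_bigr => i _ do rewrite indicE -EFinM.
    rewrite sumEFin; congr EFin.
    have [h|h] := pselect (exists i, xs i = z.2).
      rewrite [RHS](_ : _ = 1) ?mem_set //= -[RHS](sum1 _ h).
      apply: eq_bigr => i _; rewrite (_ : (z \in D i) = (xs i == z.2)) //.
      by apply/idP/eqP; rewrite in_setE /D /= => ->.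
    rewrite memNset //= big1 // => i _; rewrite memNset ?mulr0 //= => hz.
    by apply: h; exists i.
  rewrite integral_indic // setIC -[in RHS](setIT B) -(setUv [set z : E * E | exists i, xs i = z.2]).
  rewrite setIUr measureU //=.
  - rewrite [X in (_ + X)%E](_ : _ = 0%E) ?adde0 //.
    apply/eqP; rewrite eq_le measure_ge0 andbT -[leRHS]null.
    by apply: le_measure; rewrite ?inE; [apply: measurableI => //; exact: measurableC | exact: measurableC | exact: subIsetr].
  - exact: measurableI.
  - by apply: measurableI => //; exact: measurableC.
  - by rewrite setIACA setICr setI0.
apply: (@le_lt_trans _ _ (\int[rho]_z (dist z.1 z.2 `^ p)%:E)%E).
  apply: ereal_inf_lbound; exists rho => //; split => A mA.
    rewrite rhoE; last by rewrite -[X in measurable X]setTI; exact: measurable_fst.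
    rewrite -pi1 // -[RHS]split_mass //.
    by rewrite -[X in measurable X]setTI; exact: measurable_fst.
  rewrite rhoE; last by rewrite -[X in measurable X]setTI; exact: measurable_snd.
  rewrite empiricalE mulr_sumr -sumEFin; apply: eq_bigr => i _.
  have [Ay|Ay] := boolP (ys i \in A).
    transitivity (((m i)^-1)%:E * (n%:R^-1 * m i)%:E)%E.
      congr (_ * _)%E; rewrite (_ : _ `&` _ = D i); first exact: piD.
      by apply/seteqP; split => [z []//|z Dz]; split => //=; rewrite inE in Ay.
    by rewrite -EFinM mulrCA mulVf.
  rewrite (_ : _ `&` _ = set0) ?measure0 ?mule0 ?mulr0 //.
  by apply/seteqP; split => // z [/= h _]; rewrite notin_setE in Ay.
rewrite rhoI; last 2 first.
- exact: measurable_cost.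
- by move=> z; rewrite lee_fin powR_ge0.
have mc := measurable_cost dist_polish dist_borel p.
pose g (z : E * E) : \bar R := ((1 + eta)%:E * (dist z.1 z.2 `^ p)%:E + eta%:E)%E.
have mg : measurable_fun setT g.
  by apply: emeasurable_funD => //; apply: measurable_funeM.
have g0 z : (0 <= g z)%E.
  by rewrite /g -EFinM -EFinD lee_fin addr_ge0 ?(ltW eta0) // mulr_ge0 ?powR_ge0 // addr_ge0 // ltW.
have splitI : (\sum_(i < n) ((m i)^-1)%:E * \int[pi]_(z in D i) g z = \int[pi]_z g z)%E.
  under eq_bigr => i _.
    rewrite integral_mkcond -ge0_integralZl //; last 3 first.
    + by apply/(measurable_restrictT _ _).1 => //; exact: measurable_funTS.
    + by move=> z _; apply: erestrict_ge0.
    + by rewrite lee_fin invr_ge0 ltW.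
    over.
  rewrite -ge0_integral_sum //; last 2 first.
  - move=> i; apply: measurable_funeM; apply/(measurable_restrictT _ _).1 => //.
    exact: measurable_funTS.
  - by move=> i z _; apply: mule_ge0; [rewrite lee_fin invr_ge0 ltW|apply: erestrict_ge0].
  have mN : measurable (~` [set z : E * E | exists i, xs i = z.2]).
    apply: measurableC.
    rewrite (_ : mkset _ = \bigcup_(i in [set: 'I_n]) D i).
      exact: fin_bigcup_measurable.
    by apply/seteqP; split => [v [i hi]|v [i _ hi]]; exists i.
  apply: ge0_ae_eq_integral => //.
  - apply: emeasurable_sum => i; apply: measurable_funeM.
    by apply/(measurable_restrictT _ _).1 => //; exact: measurable_funTS.
  - move=> z _; apply: sume_ge0 => i _; apply: mule_ge0; first by rewrite lee_fin invr_ge0 ltW.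
    exact: erestrict_ge0.
  exists (~` [set z : E * E | exists i, xs i = z.2]); split => // z /= hz hex.
  apply: hz => _; pose G := fine (g z); have gE : g z = G%:E by rewrite /G fineK.
  rewrite gE (eq_bigr (fun i => ((m i)^-1 * (xs i == z.2)%:R * G)%:E)).
    by rewrite sumEFin -mulr_suml sum1 // mul1r.
  move=> i _; rewrite patchE; have [h|h] := boolP (z \in D i).
    by move: h; rewrite inE /D /= => <-; rewrite eqxx mulr1 gE -EFinM.
  have -> : (xs i == z.2) = false.
    by apply: contraNF h => /eqP h; rewrite inE /D /= h.
  by rewrite mulr0 mul0r mule0.
apply: (@le_lt_trans _ _ (\int[pi]_z g z)%E).
  rewrite -splitI; apply: lee_sum => i _; apply: lee_wpmul2l.
    by rewrite lee_fin invr_ge0 ltW.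
  apply: ge0_le_integral => //.
  - by move=> z _; rewrite lee_fin powR_ge0.
  - apply: measurable_funTS.
    apply: (measurableT_comp mc).
    by apply: measurable_fun_pair => //; exact: measurable_cst.
  - exact: measurable_funTS.
  move=> z Dz /=; rewrite /g -EFinM -EFinD lee_fin he ?(dist_ge0 dist_polish) //.
  have := dist_triangle dist_polish (xs i) z.1 (ys i); have := xys i.
  by move: Dz; rewrite /D /= => ->; lra.
rewrite /g ge0_integralD //; last 3 first.
- by move=> z _; rewrite -EFinM lee_fin mulr_ge0 ?powR_ge0 // addr_ge0 // ltW.
- exact: measurable_funeM.
- by move=> z _; rewrite lee_fin ltW.
rewrite ge0_integralZl //; last 2 first.
- by move=> z _; rewrite lee_fin powR_ge0.
- by rewrite lee_fin; lra.
have -> : (\int[pi]_z eta%:E = eta%:E)%E.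
  transitivity (eta%:E * pi setT)%E; first exact: (integral_cst pi).
  by rewrite probability_setT mule1.
rewrite -/cost costE -EFinM -EFinD lte_fin.
have eE : eta * (2 * (I + 1)) = c - I.
  by rewrite /eta divfK // gt_eqF // mulr_gt0 // ltr_wpDl.
exact: perturb_lt eE Ic.
Qed.

(** {W <= x} is the intersection of the events {W < x + 1/(k+1)}, which are open conditions on the
    sample by [Wpp_usc]. *)
Lemma measurable_Wpp_gt dO (Om : measurableType dO) (x0 : E) n
    (X : 'I_n -> Om -> E) (x : R) : (0 < n)%N ->
  (forall i, measurable_fun setT (X i)) ->
  measurable [set om | (x%:E < Wpp dist p mu (empirical (fun i => X i om)))%E].
Proof.
move=> n0 mX.
rewrite (_ : mkset _ = ~` \bigcap_k [set om |
   (Wpp dist p mu (empirical (fun i => X i om)) < (x + k.+1%:R^-1)%:E)%E]).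
  apply/measurableC/bigcapT_measurable => k.
  apply: (measurable_open_event dist_polish dist_borel x0 (U := fun xs =>
    (Wpp dist p mu (empirical xs) < (x + k.+1%:R^-1)%:E)%E)) => // xs.
  exact: Wpp_usc.
apply/seteqP; split => om /=.
  move=> h1 h2.
  suff : (Wpp dist p mu (empirical (fun i => X i om)) <= x%:E)%E by rewrite leNgt h1.
  apply/lee_addgt0Pr => e e0.
  have [k hk] := ltr_add_invr e0; rewrite add0r in hk.
  apply: (le_trans (ltW (h2 k Logic.I))).
  by rewrite -EFinD lee_fin lerD2l ltW.
move=> h; rewrite ltNge; apply/negP => h'; apply: h => k _ /=.
by rewrite (le_lt_trans h') // lte_fin ltrDl invr_gt0.
Qed.

End WassersteinMeasurability.

(** * Discretized transport *)

Lemma measure_fibers d (Y : measurableType d) (R : realType)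
    (m : {measure set Y -> \bar R}) (T : finType) (f : Y -> T) (A : pred T) :
  (forall t, measurable (f @^-1` [set t])) ->
  measurable [set y | A (f y)] /\
  m [set y | A (f y)] = (\sum_(t | A t) m (f @^-1` [set t]))%E.
Proof.
move=> mf.
have key (r : seq T) : uniq r -> measurable [set y | f y \in r] /\
    m [set y | f y \in r] = (\sum_(t <- r) m (f @^-1` [set t]))%E.
  elim: r => [_|t r IH /= /andP[tr ur]].
    rewrite (_ : mkset _ = set0); first by rewrite measure0 big_nil.
    by apply/seteqP; split => y.
  have [m1 e1] := IH ur.
  have -> : [set y | f y \in t :: r] = f @^-1` [set t] `|` [set y | f y \in r].
    apply/seteqP; split => y /=; rewrite in_cons.
      by case/orP => [/eqP ->|->]; [left|right].
    by case => [->|->]; rewrite ?eqxx ?orbT.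
  split; first exact: measurableU.
  rewrite big_cons -e1 measureU //.
  by apply/seteqP; split => // y [/= -> ]; rewrite (negbTE tr).
have [mr er] := key (enum A) (enum_uniq A).
rewrite (_ : [set y | A (f y)] = [set y | f y \in enum A]).
  by split => //; rewrite er big_enum.
by apply/seteqP; split => y /=; rewrite mem_enum.
Qed.

Section Discretization.
Context {R : realType} {dE : measure_display} {E : measurableType dE}.
Variables (mu : probability E R) (T : finType) (cell : E -> T).
Hypothesis mcell : forall t, measurable (cell @^-1` [set t]).

Definition cellw (t : T) : R := fine (mu (cell @^-1` [set t])).

Lemma cellwE t : mu (cell @^-1` [set t]) = (cellw t)%:E.
Proof. by rewrite fineK // fin_num_measure. Qed.

Lemma cellw_ge0 t : 0 <= cellw t.
Proof. by rewrite -lee_fin -cellwE measure_ge0. Qed.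

Lemma cellw_sum (A : pred T) :
  mu [set y | A (cell y)] = (\sum_(t | A t) cellw t)%:E.
Proof.
have [_ ->] := measure_fibers mu A mcell.
by rewrite -sumEFin; apply: eq_bigr => t _; exact: cellwE.
Qed.

Lemma cellw_sum1 : \sum_t cellw t = 1.
Proof.
apply/eqP; rewrite -eqe -(cellw_sum xpredT); apply/eqP.
by rewrite (_ : mkset _ = setT) ?probability_setT //; apply/seteqP; split.
Qed.

(** By independence the probability of a word of cells is the product of the cell weights, which is
    the weight used in [Ex]. *)
Lemma iid_cell_event dO (Om : measurableType dO) (P : probability Om R) n
    (X : 'I_n -> Om -> E) (A : pred (seq T)) : iid_law P X mu ->
  measurable [set om | A [seq cell (X i om) | i <- enum 'I_n]] /\
  P [set om | A [seq cell (X i om) | i <- enum 'I_n]] = (Pr cellw n A)%:E.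
Proof.
move=> [mX lawX indX].
pose f om : n.-tuple T := [tuple cell (X i om) | i < n].
have fE s : f @^-1` [set s] =
    \bigcap_(i in [set: 'I_n]) (X i @^-1` (cell @^-1` [set tnth s i])).
  apply/seteqP; split => om /=.
    by move=> <- i _ /=; rewrite tnth_mktuple.
  by move=> h; apply: eq_from_tnth => i; rewrite tnth_mktuple; exact: h.
have mf s : measurable (f @^-1` [set s]).
  rewrite fE; apply: fin_bigcap_measurable => // i _.
  by rewrite -[X in measurable X]setTI; exact: mX.
have [m1 e1] := measure_fibers P (fun s : n.-tuple T => A s) mf.
have fA : [set om | A (f om)] = [set om | A [seq cell (X i om) | i <- enum 'I_n]].
  by [].
rewrite -fA; split => //; rewrite e1 /Pr /Ex -sumEFin big_mkcond.
apply: eq_bigr => s _; case: ifP => _; last by rewrite mulr0.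
rewrite mulr1 fE; apply: (eq_trans (indX (fun i => cell @^-1` [set tnth s i]) _)) => //.
rewrite (eq_bigr (fun i => (cellw (tnth s i))%:E)); last first.
  by move=> i _; rewrite lawX //; exact: cellwE.
by rewrite big_tuple prodEFin.
Qed.

Variable dist : E -> E -> R.
Hypothesis dist_polish : polish dist.
Hypothesis dist_borel : borel_of_metric dist.
Variable p : R.

(** The mass Q t u is spread over cell t like mu and evenly over the sample points in cell u. The
    cost is bounded only after integration over a cell, because the cell of far points is
    unbounded. *)
Lemma Wpp_le_discrete n (xs : 'I_n -> E) (Q c : T -> T -> R) : (0 < n)%N ->
  (forall t u, 0 <= Q t u) -> (forall t, \sum_u Q t u = cellw t) ->
  (forall u, \sum_t Q t u = n%:R^-1 * \sum_(i < n) (cell (xs i) == u)%:R) ->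
  (forall t i, (\int[mu]_(y in cell @^-1` [set t]) (dist y (xs i) `^ p)%:E
     <= (cellw t * c t (cell (xs i)))%:E)%E) ->
  (Wpp dist p mu (empirical xs) <= (\sum_t \sum_u Q t u * c t u)%:E)%E.
Proof.
move=> n0 Q0 Qw Qnu Qc.
have nR0 : (n%:R : R) != 0 by rewrite pnatr_eq0 -lt0n.
pose N u : R := \sum_(i < n) (cell (xs i) == u)%:R.
have N0 u : 0 <= N u by apply: sumr_ge0.
have Ni i : N (cell (xs i)) != 0.
  by rewrite gt_eqF // /N (bigD1 i) //= eqxx ltr_wpDr // sumr_ge0.
have w0Q t u : cellw t = 0 -> Q t u = 0.
  move=> wt; apply/eqP; rewrite eq_le Q0 andbT -wt -Qw (bigD1 u) //= lerDl.
  by rewrite sumr_ge0.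
have N0Q t u : N u = 0 -> Q t u = 0.
  move=> Nu; apply/eqP; rewrite eq_le Q0 andbT.
  have : \sum_t Q t u = 0 by rewrite Qnu -/(N u) Nu mulr0.
  by move <-; rewrite (bigD1 t) //= lerDl sumr_ge0.
(* Density of the coupling on cell t times the point [xs i]. If [cellw t] is 0 then Q t u is 0 too,
   so the division by zero is harmless. *)
pose kap (q : T * 'I_n) := Q q.1 (cell (xs q.2)) / (cellw q.1 * N (cell (xs q.2))).
have kap0 q : 0 <= kap q by rewrite divr_ge0 // mulr_ge0 // cellw_ge0.
have kapw t i : kap (t, i) * cellw t = Q t (cell (xs i)) / N (cell (xs i)).
  rewrite /kap /=; have [wt|wt] := eqVneq (cellw t) 0.
    by rewrite wt w0Q // !mul0r.
  by field; rewrite wt Ni.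
have byclass (F : T -> R) : (forall u, N u = 0 -> F u = 0) ->
    \sum_(i < n) F (cell (xs i)) / N (cell (xs i)) = \sum_u F u.
  move=> F0.
  rewrite (eq_bigr (fun i => \sum_u (cell (xs i) == u)%:R * (F u / N u))); last first.
    move=> i _; rewrite (bigD1 (cell (xs i))) //= eqxx mul1r big1 ?addr0 //.
    by move=> u; rewrite eq_sym => /negbTE ->; rewrite mul0r.
  rewrite exchange_big; apply: eq_bigr => u _ /=; rewrite -mulr_suml -/(N u).
  have [Nu|Nu] := eqVneq (N u) 0; first by rewrite Nu F0 // mul0r.
  by rewrite mulrCA divff // mulr1.
have marg2 i : \sum_t kap (t, i) * cellw t = n%:R^-1.
  under eq_bigr do rewrite kapw.
  by rewrite -mulr_suml Qnu -/(N _) mulfK.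
case: (@glue_probability _ _ _ (E * E)%type R mu (T * 'I_n)%type kap
   (fun q => cell @^-1` [set q.1]) (fun q y => (y, xs q.2))) => //.
  rewrite (eq_bigr (fun q : T * 'I_n => (kap q * cellw q.1)%:E)).
    rewrite sumEFin -(pair_bigA _ (fun t i => kap (t, i) * cellw t)) /= exchange_big /=.
    under eq_bigr do rewrite marg2.
    by rewrite sumr_const card_ord -[_ *+ n]mulr_natl mulfV.
  by move=> q _; rewrite [RHS]EFinM; congr (_ * _)%E; exact: cellwE.
move=> pi [piE piI].
apply: (@le_trans _ _ (\int[pi]_z (dist z.1 z.2 `^ p)%:E)%E).
  apply: ereal_inf_lbound; exists pi => //; split => A mA.
    rewrite piE; last by rewrite -[X in measurable X]setTI; exact: measurable_fst.
    have mAt t : measurable (A `&` cell @^-1` [set t]) by exact: measurableI.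
    pose a t := fine (mu (A `&` cell @^-1` [set t])).
    have aE t : mu (A `&` cell @^-1` [set t]) = (a t)%:E.
      by rewrite fineK // fin_num_measure.
    have a0 t : cellw t = 0 -> a t = 0.
      move=> wt; apply/eqP; rewrite -eqe -aE eq_le measure_ge0 andbT.
      apply: (@le_trans _ _ (mu (cell @^-1` [set t]))).
        by apply: le_measure; rewrite ?inE //; exact: subIsetr.
      by rewrite cellwE wt.
    have -> : mu A = (\sum_t a t)%:E.
      have [_ e] := measure_fibers (mrestr mu mA) xpredT mcell.
      have -> : mu A = mrestr mu mA [set y | xpredT (cell y)].
        by rewrite /mrestr (_ : mkset _ = setT) ?setTI //; apply/seteqP; split.
      rewrite [LHS]e -sumEFin; apply: eq_bigr => t _; rewrite -aE.
      by change (mu (cell @^-1` [set t] `&` A) = mu (A `&` cell @^-1` [set t])); rewrite setIC.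
    rewrite (eq_bigr (fun q : T * 'I_n => (kap q * a q.1)%:E)); last first.
      by move=> q _; rewrite [RHS]EFinM; congr (_ * _)%E; exact: aE.
    rewrite sumEFin -(pair_bigA _ (fun t i => kap (t, i) * a t)) /=; congr EFin.
    apply: eq_bigr => t _; rewrite -mulr_suml.
    have [wt|wt] := eqVneq (cellw t) 0; first by rewrite a0 // mulr0.
    rewrite -[RHS]mul1r; congr (_ * _); apply: (mulIf wt); rewrite mul1r mulr_suml.
    under eq_bigr do rewrite kapw.
    by rewrite (byclass (Q t)) // => u; exact: N0Q.
  rewrite piE; last by rewrite -[X in measurable X]setTI; exact: measurable_snd.
  rewrite empiricalE.
  rewrite (eq_bigr (fun q : T * 'I_n => (kap q * cellw q.1 * (xs q.2 \in A)%:R)%:E)).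
    rewrite sumEFin -(pair_bigA _ (fun t i => kap (t, i) * cellw t * (xs i \in A)%:R)) /=.
    rewrite exchange_big mulr_sumr; congr EFin; apply: eq_bigr => i _ /=.
    by rewrite -mulr_suml marg2.
  move=> [t i] _ /=; have [xA|xA] := boolP (xs i \in A).
    rewrite mulr1 [RHS]EFinM -cellwE; congr (_ * mu _)%E.
    by apply/seteqP; split => [y []//|y yt]; split => //=; rewrite inE in xA.
  rewrite mulr0 (_ : _ `&` _ = set0) ?measure0 ?mule0 //.
  by apply/seteqP; split => // y [/= h _]; rewrite notin_setE in xA.
rewrite piI; last 2 first.
- exact: measurable_cost.
- by move=> z; rewrite lee_fin powR_ge0.
apply: (@le_trans _ _ (\sum_(q : T * 'I_n) (kap q * (cellw q.1 * c q.1 (cell (xs q.2))))%:E)%E).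
  apply: lee_sum => -[t i] _; rewrite [leRHS]EFinM; apply: lee_wpmul2l; first by rewrite lee_fin.
  exact: Qc.
rewrite sumEFin lee_fin.
rewrite -(pair_bigA _ (fun t i => kap (t, i) * (cellw t * c t (cell (xs i))))) /=.
apply: ler_sum => t _.
rewrite -(byclass (fun u => Q t u * c t u)); last by move=> u /N0Q ->; rewrite mul0r.
by apply: ler_sum => i _; rewrite mulrA kapw mulrAC.
Qed.

End Discretization.

(** * Weighted discrepancy between a finite law and its empirical version *)

Section Discrepancy.
Context {R : realType} {T : finType}.
Variables (w : T -> R) (e : nat -> T -> T) (m n : nat).
Hypothesis w_ge0 : forall t, 0 <= w t.
Hypothesis w_sum1 : \sum_t w t = 1.
Hypothesis n_gt0 : (0 < n)%N.
Implicit Types (h : nat -> T -> R) (s : seq T).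

Definition classw l c : R := \sum_(t | e l t == c) w t.
Definition classf l c s : R := (count (fun t => e l t == c) s)%:R / n%:R.
Definition discrepancy h s : R :=
  \sum_(l < m.+1) \sum_c h l c * `|classw l c - classf l c s|.
(** Total weight of the ancestors of t; divided by n, it is the influence of one observation at t on
    [discrepancy]. *)
Definition pathw h t : R := \sum_(l < m.+1) h l (e l t).

Let n0 : 0 < n%:R :> R. Proof. by rewrite ltr0n. Qed.

Lemma classw_ge0 l c : 0 <= classw l c. Proof. exact: sumr_ge0. Qed.

Lemma sum_class l (f : T -> R) (t : T) : \sum_c f c * (e l t == c)%:R = f (e l t).
Proof.
rewrite (bigD1 (e l t)) //= eqxx mulr1 big1 ?addr0 // => c.
by rewrite eq_sym => /negbTE ->; rewrite mulr0.
Qed.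

Lemma discrepancy_bounded_diff h : (forall l c, 0 <= h l c) ->
  bounded_diff (fun t => pathw h t / n%:R) n (discrepancy h).
Proof.
move=> h0 s1 s2 t u _.
rewrite -mulrDl /pathw -big_split /= mulr_suml.
rewrite /discrepancy -sumrB (le_trans (ler_norm_sum _ _ _)) //; apply: ler_sum => l _.
rewrite -(sum_class l (h l) t) -(sum_class l (h l) u) -big_split mulr_suml -sumrB /=.
rewrite (le_trans (ler_norm_sum _ _ _)) //; apply: ler_sum => c _.
rewrite -mulrBr normrM ger0_norm // -mulrDr -mulrA ler_wpM2l //.
rewrite (le_trans (ler_dist_dist _ _)) //.
have subE (a b c' : R) : a - b - (a - c') = c' - b by ring.
rewrite /classf subE -mulrBl normrM [X in _ * X]ger0_norm ?invr_ge0 ?ler0n //.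
rewrite ler_wpM2r ?invr_ge0 ?ler0n // !count_cat /= !natrD.
set a := (count _ s1)%:R; set b := (count _ s2)%:R.
rewrite [_ - _](_ : _ = (e l u == c)%:R - (e l t == c)%:R); last by ring.
rewrite (le_trans (ler_normB _ _)) // addrC.
by rewrite !ger0_norm ?ler0n.
Qed.

Let zeta l c t : R := (e l t == c)%:R - classw l c.

Let zeta_centered l c : \sum_t w t * zeta l c t = 0.
Proof.
rewrite (eq_bigr (fun t => w t * (e l t == c)%:R - w t * classw l c)); last first.
  by move=> t _; rewrite mulrBr.
rewrite sumrB -mulr_suml w_sum1 mul1r /classw [X in _ - X]big_mkcond /= -sumrB big1 // => t _.
by case: ifP; rewrite ?mulr1 ?mulr0 subrr.
Qed.

Let zetaE l c s : size s = n ->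
  classw l c - classf l c s = - (\sum_(t <- s) zeta l c t) / n%:R.
Proof.
move=> sn; rewrite sumrB [X in - (_ - X)](_ : _ = n%:R * classw l c).
  rewrite [\sum_(i <- s) _](_ : _ = (count (fun t => e l t == c) s)%:R).
    by rewrite /classf; field; rewrite gt_eqF.
  by rewrite -sum1_count natr_sum [RHS]big_mkcond; apply: eq_bigr => t _; case: ifP.
by rewrite big_const_seq count_predT sn iter_addr_0 mulr_natl.
Qed.

Lemma Ex_classf_sqr l c :
  Ex w n (fun s => `|classw l c - classf l c s| ^+ 2) <= classw l c / n%:R.
Proof.
rewrite (@eq_Ex _ _ w n _ (fun s => n%:R ^- 2 * (\sum_(t <- s) zeta l c t) ^+ 2)); last first.
  move=> s sn; rewrite real_normK ?num_real // zetaE //.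
  by rewrite mulNr sqrrN expr_div_n mulrC.
rewrite ExZ Ex_sqr_sum_centered //.
have h : \sum_t w t * zeta l c t ^+ 2 <= classw l c.
  apply: (le_trans (y := \sum_t (w t * zeta l c t * (1 - 2 * classw l c) +
     (w t * classw l c - w t * classw l c ^+ 2)))).
    apply: ler_sum => t _; rewrite le_eqVlt; apply/orP; left; apply/eqP.
    by rewrite /zeta; case: (e l t == c) => /=; ring.
  rewrite big_split /= -mulr_suml zeta_centered mul0r add0r sumrB -!mulr_suml w_sum1 !mul1r.
  by rewrite gerBl sqr_ge0.
rewrite [leLHS](_ : _ = (\sum_t w t * zeta l c t ^+ 2) / n%:R).
  by rewrite ler_wpM2r // invr_ge0 ltW.
by field; rewrite gt_eqF.
Qed.

(** First-moment bound, from |a - b| <= a + b. It leads to the p-th moment where the variance bound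
    would lead to square roots of masses. *)
Lemma Ex_classf l c : Ex w n (fun s => `|classw l c - classf l c s|) <= 2 * classw l c.
Proof.
apply: (le_trans (y := Ex w n (fun s => 2 * classw l c + n%:R^-1 * \sum_(t <- s) zeta l c t))).
  apply: le_Ex => // s sn.
  have -> : n%:R^-1 * \sum_(t <- s) zeta l c t = classf l c s - classw l c.
    by rewrite -[RHS]opprB zetaE //; field; rewrite gt_eqF.
  have f0 : 0 <= classf l c s by rewrite divr_ge0.
  have := classw_ge0 l c; rewrite ler_norml; lra.
by rewrite ExD Ex_cst // ExZ Ex_sum_centered // mulr0 addr0.
Qed.

Lemma discrepancyE h s : discrepancy h s =
  \sum_(q : 'I_m.+1 * T) h q.1 q.2 * `|classw q.1 q.2 - classf q.1 q.2 s|.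
Proof. by rewrite /discrepancy pair_bigA. Qed.

Lemma Ex_discrepancy_sqr h : (forall l c, 0 <= h l c) ->
  Ex w n (fun s => discrepancy h s ^+ 2) <=
  (\sum_(l < m.+1) \sum_c h l c * Num.sqrt (classw l c / n%:R)) ^+ 2.
Proof.
move=> h0; rewrite (@eq_Ex _ _ w n _ (fun s => (\sum_(q : 'I_m.+1 * T) h q.1 q.2 *
    `|classw q.1 q.2 - classf q.1 q.2 s|) ^+ 2)); last first.
  by move=> s _; rewrite discrepancyE.
rewrite pair_bigA /=.
apply: (@Ex_sqr_sum _ _ w w_ge0 w_sum1 _ n (fun q : 'I_m.+1 * T => h q.1 q.2)
  (fun q => Num.sqrt (classw q.1 q.2 / n%:R))
  (fun q s => `|classw q.1 q.2 - classf q.1 q.2 s|)) => // q.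
by rewrite sqr_sqrtr; [exact: Ex_classf_sqr | rewrite divr_ge0 // classw_ge0].
Qed.

Lemma Ex_discrepancy h : (forall l c, 0 <= h l c) ->
  Ex w n (discrepancy h) <= 2 * \sum_t w t * pathw h t.
Proof.
move=> h0; rewrite /discrepancy Ex_sum.
apply: (le_trans (y := \sum_(l < m.+1) \sum_c h l c * (2 * classw l c))).
  apply: ler_sum => l _; rewrite Ex_sum; apply: ler_sum => c _.
  by rewrite ExZ ler_wpM2l // Ex_classf.
rewrite mulr_sumr le_eqVlt; apply/orP; left; apply/eqP.
under [RHS]eq_bigr do rewrite /pathw mulr_sumr mulr_sumr.
rewrite [RHS]exchange_big; apply: eq_bigr => l _ /=.
under [RHS]eq_bigr do rewrite -sum_class !mulr_sumr.
rewrite [RHS]exchange_big; apply: eq_bigr => c _ /=.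
rewrite /classw !mulr_sumr big_mkcond; apply: eq_bigr => t _.
by case: ifP => _ /=; ring.
Qed.

(** The cost charges to each pair the weights of both its nodes at every level that separates the
    pair. Summed against the coupling, a node is charged for the mass leaving or entering it, which
    [tree_coupling] bounds by its discrepancy. *)
Lemma tree_transport h (b : T -> R) s : (forall l c, 0 <= h l c) ->
  (forall l t u, e l.+1 t = e l.+1 u -> e l t = e l u) -> size s = n ->
  exists2 Q : T -> T -> R,
    [/\ forall t u, 0 <= Q t u, forall t, \sum_u Q t u = w t
      & forall u, \sum_t Q t u = (count_mem u s)%:R / n%:R] &
  \sum_t \sum_u Q t u * (b t + \sum_(l < m.+1)
     (if e l t != e l u then h l (e l t) + h l (e l u) else 0))
  <= \sum_t w t * b t + discrepancy h s.
Proof.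
move=> h0 nest sn; pose nu u : R := (count_mem u s)%:R / n%:R.
have nuclass l c : \sum_(t | e l t == c) nu t = classf l c s.
  rewrite /nu -mulr_suml /classf -natr_sum; congr (_%:R / _).
  rewrite -sum1_count [RHS]big_mkcond (eq_bigr (fun t => \sum_(u <- s) (u == t : nat))); last first.
    by move=> t _; rewrite -sum1_count big_mkcond; apply: eq_bigr => u _ /=; case: (u == t).
  rewrite exchange_big; apply: eq_bigr => u _ /=.
  case: ifP => hu.
    rewrite (bigD1 u) //= eqxx big1 // => t /andP[_].
    by rewrite eq_sym => /negbTE ->.
  by rewrite big1 // => t ht; case: eqP => // ut; rewrite ut ht in hu.
have nu_sum : \sum_t w t = \sum_t nu t.
  rewrite w_sum1 /nu -mulr_suml -natr_sum.
  rewrite (_ : (\sum_t count_mem t s)%N = n); first by rewrite divff // gt_eqF.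
  rewrite -sn -sum1_size (eq_bigr (fun t => \sum_(u <- s) (u == t : nat))); last first.
    by move=> t _; rewrite -sum1_count big_mkcond; apply: eq_bigr => u _ /=; case: (u == t).
  rewrite exchange_big; apply: eq_bigr => u _ /=.
  by rewrite (bigD1 u) //= eqxx big1 // => t; rewrite eq_sym => /negbTE ->.
case: (@tree_coupling R T w nu T e m w_ge0 _ nu_sum nest).
  by move=> t; rewrite divr_ge0.
move=> Q [Q0 Qw Qnu] Qd; exists Q; first by split.
under eq_bigr => t _ do under eq_bigr => u _ do rewrite mulrDr.
under eq_bigr => t _ do rewrite big_split /= -mulr_suml Qw.
rewrite big_split /= lerD2l.
under eq_bigr => t _ do under eq_bigr => u _ do rewrite mulr_sumr.
under eq_bigr => t _ do rewrite exchange_big /=.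
rewrite exchange_big /discrepancy; apply: ler_sum => l _ /=.
apply: (le_trans (y := \sum_c h l c * \sum_t \sum_u Q t u *
   (if e l t != e l u then (e l t == c)%:R + (e l u == c)%:R else 0))); last first.
  apply: ler_sum => c _; rewrite ler_wpM2l // -nuclass /classw.
  by apply: Qd; rewrite -ltnS.
rewrite le_eqVlt; apply/orP; left; apply/eqP.
under [RHS]eq_bigr => c _ do rewrite mulr_sumr.
rewrite [RHS]exchange_big; apply: eq_bigr => t _ /=.
under [RHS]eq_bigr => c _ do rewrite mulr_sumr.
rewrite [RHS]exchange_big; apply: eq_bigr => u _ /=.
under [RHS]eq_bigr => c _ do rewrite mulrCA.
rewrite -mulr_sumr; congr (_ * _).
case: ifP => _; last by rewrite big1 // => c _; rewrite mulr0.
under [RHS]eq_bigr => c _ do rewrite mulrDr.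
by rewrite big_split /= !sum_class.
Qed.

End Discrepancy.

(** * Nested partitions of the annuli *)

Lemma expn_powR (R : realType) (p : R) l : (2 ^+ l : R) `^ p = (2 `^ p) ^+ l.
Proof. by rewrite -powR_mulrn // powRAC powR_mulrn // powR_ge0. Qed.

Section Hierarchy.
Context {R : realType} {dE : measure_display} {E : measurableType dE}.
Variables (dist : E -> E -> R) (x0 : E) (S : set E) (p beta rho0 : R).
Variables (K : nat) (L : nat -> nat).

Definition radius k : R := rho0 * 2 ^+ k.
Definition mesh k l : R := 2 * radius k / 2 ^+ l.

(* Nested partitions of the annuli radius (k-1) < dist x0 _ <= radius k, k <= K,
   of [S]: [ann] is the annulus of a cell, [lev l] the code of the ancestor of
   a cell at scale [mesh k l], [out] collects what lies outside
   [S `&` cball x0 (radius K)]. *)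
Record hierarchy := Hierarchy {
  hT : finType;
  out : hT;
  ann : hT -> nat;
  cell : E -> hT;
  lev : nat -> hT -> hT;
  cell_measurable : forall t, measurable (cell @^-1` [set t]);
  lev_nested : forall l t u, lev l.+1 t = lev l.+1 u -> lev l t = lev l u;
  ann_lev : forall l t, ann (lev l t) = ann t;
  ann_out : ann out = K.+1;
  cell_in : forall y, cell y <> out ->
    [/\ (ann (cell y) <= K)%N, dist x0 y <= radius (ann (cell y))
      & forall k, ann (cell y) = k.+1 -> radius k < dist x0 y];
  cell_out : forall y, cell y = out -> ~ S y \/ radius K < dist x0 y;
  lev0 : forall y z, cell y <> out -> ann (cell y) = ann (cell z) ->
    lev 0 (cell y) = lev 0 (cell z);
  lev_close : forall l y z, cell y <> out -> ann (cell y) = ann (cell z) ->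
    (l <= L (ann (cell y)))%N -> lev l (cell y) = lev l (cell z) ->
    dist y z <= 4 * mesh (ann (cell y)) l;
  lev_card : forall k l, (k <= K)%N -> (l <= L k)%N -> exists2 A : {set hT},
    #|A|%:R <= (1 + 2 * beta) * (2 `^ p) ^+ (2 * l) &
    forall y, ann (cell y) = k -> lev l (cell y) \in A }.

Hypothesis dist_polish : polish dist.
Hypothesis dist_borel : borel_of_metric dist.
Hypothesis mS : measurable S.
Hypothesis beta0 : 0 < beta.
Hypothesis rho00 : 0 < rho0.
Hypothesis cover : forall rr delta : R, 0 < rr -> 0 < delta -> delta <= 2 * rr ->
  (covering_number dist (S `&` cball dist x0 rr) delta
     <= (beta * (2 * rr / delta) `^ (2 * p))%:E)%E.

Lemma radius_gt0 k : 0 < radius k. Proof. by rewrite mulr_gt0 // exprn_gt0. Qed.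

Lemma mesh_gt0 k l : 0 < mesh k l.
Proof. by rewrite divr_gt0 ?mulr_gt0 ?radius_gt0 ?exprn_gt0. Qed.

(** Since 2 radius / mesh = 2^l, the entropy bound with exponent 2p gives beta 2^(2pl) centres. The
    constant 1 + 2 beta is strictly larger, so that the infimum yields an actual cover, and it is at
    least 1, for the single ball around x0 used at depth 0. From depth 1 on the centres lie in S and
    in the ball, so each is itself covered one level up. *)
Lemma cover_scale k l : exists q : nat * (nat -> E),
  [/\ l = 0%N -> q.1 = 1%N,
      q.1%:R <= (1 + 2 * beta) * (2 `^ p) ^+ (2 * l),
      forall z, S z -> dist x0 z <= radius k ->
        exists2 j, (j < q.1)%N & dist (q.2 j) z <= mesh k l
    & (0 < l)%N -> forall j, (j < q.1)%N -> S (q.2 j) /\ dist x0 (q.2 j) <= radius k].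
Proof.
have r0 := radius_gt0 k.
case: l => [|l].
  exists (1%N, fun=> x0); split => //=; first by rewrite muln0 expr0 mulr1 lerDl mulr_ge0 // ltW.
  by move=> z _ zr; exists 0%N => //; rewrite /mesh expr0; lra.
have m0 := mesh_gt0 k l.+1.
have t0 : 0 < (2 `^ p : R) ^+ (2 * l.+1) by rewrite exprn_gt0 // powR_gt0.
have := cover r0 m0.
have -> : 2 * radius k / mesh k l.+1 = 2 ^+ l.+1.
  by rewrite /mesh; field; rewrite !gt_eqF ?exprn_gt0.
have -> : (2 ^+ l.+1 : R) `^ (2 * p) = (2 `^ p) ^+ (2 * l.+1).
  rewrite mulrC powRrM expn_powR powR_mulrn ?exprn_ge0 ?powR_ge0 //.
  by rewrite -exprM mulnC.
move=> /(_ _) hc.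
have {hc} : (covering_number dist (S `&` cball dist x0 (radius k)) (mesh k l.+1)
   < ((1 + 2 * beta) * (2 `^ p) ^+ (2 * l.+1))%:E)%E.
  apply: le_lt_trans (hc _) _.
    rewrite /mesh ler_pdivrMr ?exprn_gt0 // ler_peMr //; first lra.
    by rewrite exprn_ege1 //; lra.
  by rewrite lte_fin ltr_pM2r //; have := beta0; lra.
move=> /ereal_inf_lt[_ [m [y [yS yc]] <-]]; rewrite lte_fin => mlt.
exists (m, fun j => if (insub j : option 'I_m) is Some i then y i else x0).
split => //=; first exact: ltW.
  move=> z Sz zr; have [//|i hi] := yc z; exists (val i) => //=.
  by case: insubP => [i' _ /val_inj -> //|]; rewrite ltn_ord.
by move=> _ j jm; rewrite (insubT (fun j => (j < m)%N) jm); exact: yS.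
Qed.

Section FromCovers.
Variables (N : nat -> nat -> nat) (cen : nat -> nat -> nat -> E).
Variable par : nat -> nat -> nat -> nat.
Hypothesis N0 : forall k, N k 0 = 1%N.
Hypothesis N_le : forall k l, (N k l)%:R <= (1 + 2 * beta) * (2 `^ p) ^+ (2 * l).
Hypothesis cenP : forall k l z, S z -> dist x0 z <= radius k ->
  exists2 j, (j < N k l)%N & dist (cen k l j) z <= mesh k l.
Hypothesis parP : forall k l j, (j < N k l.+1)%N ->
  (par k l j < N k l)%N /\ dist (cen k l (par k l j)) (cen k l.+1 j) <= mesh k l.

Definition Nmax : nat := \max_(k < K.+1) \max_(l < (L k).+1) N k l.

Lemma N_le_max k l : (k <= K)%N -> (l <= L k)%N -> (N k l <= Nmax)%N.
Proof.
move=> kK lL; rewrite /Nmax.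
have := @leq_bigmax_cond _ xpredT (fun k : 'I_K.+1 => \max_(l < (L k).+1) N k l)
  (inord k) isT.
apply: leq_trans; rewrite inordK ?ltnS //.
have := @leq_bigmax_cond _ xpredT (fun l : 'I_(L k).+1 => N k l) (inord l) isT.
by apply: leq_trans; rewrite inordK ?ltnS.
Qed.

(** Ancestor d generations above the finest depth [L k]. All indices live in one ordinal type, and
    [anc_spec] shows that [inord] does not truncate. *)
Fixpoint anc k d (j : 'I_Nmax.+1) : 'I_Nmax.+1 :=
  if d is d'.+1 then inord (par k (L k - d'.+1) (anc k d' j)) else j.

(** The error 2 mesh reproduces itself going up: mesh(l) + 2 mesh(l+1) = 2 mesh(l). *)
Lemma anc_spec k d (j : 'I_Nmax.+1) y : (k <= K)%N -> (j < N k (L k))%N ->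
  (d <= L k)%N -> dist (cen k (L k) j) y <= mesh k (L k) ->
  (anc k d j < N k (L k - d))%N /\
  dist (cen k (L k - d) (anc k d j)) y <= 2 * mesh k (L k - d).
Proof.
move=> kK jN + jy; elim: d => [_|d IH dL].
  by rewrite /= subn0; split => //; have := mesh_gt0 k (L k); lra.
have [h1 h2] := IH (ltnW dL).
have eL : (L k - d = (L k - d.+1).+1)%N by rewrite subnSK.
rewrite /=; move: h1 h2; rewrite eL => h1 h2; have [h3 h4] := parP h1.
rewrite inordK; last by rewrite ltnS ltnW // (leq_trans h3) // N_le_max // leq_subr.
split => //.
have := dist_triangle dist_polish (cen k (L k - d.+1).+1 (anc k d j))
  (cen k (L k - d.+1) (par k (L k - d.+1) (anc k d j))) y.
have : mesh k (L k - d.+1) = 2 * mesh k (L k - d.+1).+1.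
  by rewrite /mesh exprS; field; rewrite expf_neq0.
lra.
Qed.

(** The first component ranges over the annuli 0, ..., K and the extra value K+1, reserved for the
    outer cell [o]. *)
Let T : finType := ('I_K.+2 * 'I_Nmax.+1)%type.
Let o : T := (ord_max, ord0).

Definition region (t : T) : set E := [set y | [/\ (t.1 <= K)%N /\ (t.2 < N t.1 (L t.1))%N,
  S y, dist x0 y <= radius t.1, (t.1 == 0 :> nat) \/ radius t.1.-1 < dist x0 y
  & dist (cen t.1 (L t.1) t.2) y <= mesh t.1 (L t.1)]].

Lemma measurable_region t : measurable (region t).
Proof.
have [h|h] := pselect ((t.1 <= K)%N /\ (t.2 < N t.1 (L t.1))%N); last first.
  by rewrite (_ : region t = set0) //; apply/seteqP; split=> // y [].
have -> : region t = S `&` cball dist x0 (radius t.1)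
   `&` (if t.1 == 0 :> nat then setT else ~` cball dist x0 (radius t.1.-1))
   `&` cball dist (cen t.1 (L t.1) t.2) (mesh t.1 (L t.1)).
  apply/seteqP; split => y.
    move=> [_ Sy d1 d2 d3]; split => //; split => //.
    case: d2 => [->//|d2]; case: ifP => // _; rewrite /cball /= => d4.
    by move: d2; rewrite ltNge d4.
  move=> [[[Sy d1] d2] d3]; split => //; move: d2; case: ifP => [h0 _|_]; first by left.
  by move=> /negP d2; right; rewrite ltNge.
apply: measurableI; last exact: measurable_cball.
apply: measurableI; first by apply: measurableI => //; exact: measurable_cball.
by case: ifP => _ //; apply: measurableC; exact: measurable_cball.
Qed.

(** The regions overlap, as a point may be close to several centres. Recording all memberships and
    letting [cell_of] pick one region makes them disjoint while keeping the cells measurable. *)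
Definition code y : {ffun T -> bool} := [ffun t => `[< region t y >]].
Definition cell_of (b : {ffun T -> bool}) : T := odflt o [pick t | b t].

Lemma code_measurable b : measurable (code @^-1` [set b]).
Proof.
rewrite (_ : code @^-1` [set b] = \bigcap_(t in [set: T])
   (if b t then region t else ~` region t)).
  apply: fin_bigcap_measurable => // t _; case: ifP => _.
    exact: measurable_region.
  exact/measurableC/measurable_region.
apply/seteqP; split => y /=.
  by move=> <- t _; rewrite ffunE; case: asboolP.
move=> h; apply/ffunP => t; rewrite ffunE; have := h t Logic.I.
by case: (b t) => ?; apply/asboolP.
Qed.

Lemma region_cell y : cell_of (code y) <> o -> region (cell_of (code y)) y.
Proof.
by rewrite /cell_of; case: pickP => [t|] //=; rewrite ffunE => /asboolP.
Qed.

Lemma region_cover y : S y -> dist x0 y <= radius K -> cell_of (code y) <> o.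
Proof.
move=> Sy yK.
(* The least k with dist x0 y <= radius k is the index of the annulus of y. *)
have [k /andP[yk kK] hk] : exists2 k, (dist x0 y <= radius k) && (k <= K)%N
    & (k == 0)%N \/ radius k.-1 < dist x0 y.
  have ex : exists k, dist x0 y <= radius k by exists K.
  case: (ex_minnP ex) => k yk kmin; exists k; first by rewrite yk kmin.
  case: k yk kmin => [|k] yk kmin; first by left.
  by right => /=; rewrite ltNge; apply/negP => /kmin; rewrite ltnn.
have [j jN hj] := @cenP k (L k) y Sy yk.
have jm : (j < Nmax.+1)%N by rewrite ltnS ltnW // (leq_trans jN) // N_le_max.
have km : (k < K.+2)%N by rewrite ltnS leqW.
have rt : region (Ordinal km, Ordinal jm) y by [].
rewrite /cell_of; case: pickP => [t|/(_ (Ordinal km, Ordinal jm))] /=; last first.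
  by rewrite ffunE; move/asboolP: rt => ->.
rewrite ffunE => /asboolP[[tK _] _ _ _ _] to; move: tK; rewrite to /=.
by rewrite ltnn.
Qed.

Definition level l (t : T) : T := (t.1, anc t.1 (L t.1 - l) t.2).

Lemma hierarchy_from_covers : hierarchy.
Proof.
have cell_anc l y : cell_of (code y) <> o -> let t := cell_of (code y) in
    (l <= L t.1)%N -> (anc t.1 (L t.1 - l) t.2 < N t.1 l)%N /\
    dist (cen t.1 l (anc t.1 (L t.1 - l) t.2)) y <= 2 * mesh t.1 l.
  move=> /region_cell [[tK tN] _ _ _ d3] t lL.
  by have := anc_spec tK tN (leq_subr l (L t.1)) d3; rewrite subKn.
have cell_o y (z : E) : cell_of (code y) <> o ->
    (cell_of (code y)).1 = (cell_of (code z)).1 :> nat -> cell_of (code z) <> o.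
  move=> hy e1 h; have [[tK _] _ _ _ _] := region_cell hy.
  by move: tK; rewrite e1 h /= ltnn.
apply: (@Hierarchy T o (fun t => t.1) (fun y => cell_of (code y)) level).
- move=> t.
  have -> : (fun y => cell_of (code y)) @^-1` [set t] =
     \bigcup_(b in [set b | cell_of b = t]) (code @^-1` [set b]).
    by apply/seteqP; split => [y <-|y [b <- <-]] //=; exists (code y).
  by apply: fin_bigcup_measurable => // b _; exact: code_measurable.
- move=> l [k j] [k' j']; rewrite /level /= => -[<-].
  (* Past depth [L k] the truncated subtraction is 0 and the levels no longer change. *)
  have [lL|lL] := ltnP l (L k); last first.
    have -> : (L k - l = L k - l.+1)%N by lia.
    by move=> ->.
  have -> : (L k - l = (L k - l.+1).+1)%N by lia.
  by move=> /= ->.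
- by [].
- by [].
- move=> y /region_cell [[tK tN] _ d1 d2 d3]; split => // k ek.
  by case: d2; rewrite ek.
- move=> y yo; have [Sy|] := pselect (S y); last by left.
  by right; rewrite ltNge; apply/negP => h; apply: (region_cover Sy h).
- move=> y z hy e1; have hz := cell_o y z hy e1.
  have [a1 _] := cell_anc 0%N y hy (leq0n _).
  have [a2 _] := cell_anc 0%N z hz (leq0n _).
  rewrite /level; move: a1 a2 e1; rewrite !N0 !ltnS !leqn0 => /eqP a1 /eqP a2 e1.
  by congr (_, _); apply: val_inj; [exact: e1 | exact: (etrans a1 (esym a2))].
- move=> l y z hy e1 lL; have hz := cell_o y z hy e1.
  have [_ a1] := cell_anc l y hy lL.
  have lLz : (l <= L (cell_of (code z)).1)%N by rewrite -e1.
  have [_ a2] := cell_anc l z hz lLz.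
  rewrite /level => -[_ e2]; rewrite -e2 -e1 in a2.
  move: a1 a2; set c := cen _ _ _ => a1 a2.
  by have := dist_triangle dist_polish c y z; rewrite (dist_sym dist_polish y c); lra.
- move=> k l kK lL; have km : (k < K.+2)%N by rewrite ltnS leqW.
  pose f (i : 'I_(N k l)) : T := (Ordinal km, widen_ord (leqW (N_le_max kK lL)) i).
  exists (f @: 'I_(N k l))%SET.
    apply: le_trans (N_le k l); rewrite ler_nat -[leqRHS]card_ord.
    exact: leq_imset_card.
  move=> y ek; have hy : cell_of (code y) <> o.
    by move=> h; move: (kK); rewrite -ek h /= ltnn.
  have [] := cell_anc l y hy; first by rewrite ek.
  move=> + _; rewrite {3}ek => hlt; apply/imsetP; exists (Ordinal hlt) => //.
  by rewrite /level /f; congr (_, _); apply: val_inj.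
Qed.

End FromCovers.

Lemma hierarchy_exists : inhabited hierarchy.
Proof.
have [F HF] := choice (fun q : nat * nat => cover_scale q.1 q.2).
pose N k l := (F (k, l)).1; pose cen k l := (F (k, l)).2.
(* The parent of a centre is any centre of the coarser cover whose ball contains it. *)
have hpar (q : nat * nat * nat) : exists j', (q.2 < N q.1.1 q.1.2.+1)%N ->
    (j' < N q.1.1 q.1.2)%N /\
    dist (cen q.1.1 q.1.2 j') (cen q.1.1 q.1.2.+1 q.2) <= mesh q.1.1 q.1.2.
  case: q => -[k l] j /=.
  have [jN|jN] := boolP (j < N k l.+1)%N; last by exists 0%N.
  have [_ _ _ /(_ isT j jN)[h1 h2]] := HF (k, l.+1).
  have [_ _ /(_ _ h1 h2)[j' j'N hj'] _] := HF (k, l).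
  by exists j'.
have [G HG] := choice hpar.
apply: inhabits; apply: (@hierarchy_from_covers N cen (fun k l j => G (k, l, j))).
- by move=> k; have [/(_ erefl)] := HF (k, 0%N).
- by move=> k l; have [] := HF (k, l).
- by move=> k l z Sz zr; have [_ _ /(_ z Sz zr)] := HF (k, l).
- by move=> k l j; exact: (HG (k, l, j)).
Qed.

End Hierarchy.

(** * Transport cost in terms of the discrepancy on a hierarchy *)

Lemma powR_ge0_mono (R : realType) (p a b : R) : 0 <= p -> 0 <= a -> a <= b ->
  a `^ p <= b `^ p.
Proof. by move=> p0 a0 ab; apply: ge0_ler_powR; rewrite ?nnegrE // (le_trans a0). Qed.

Lemma powR_add_le (R : realType) (p a b : R) : 0 <= p -> 0 <= a -> 0 <= b ->
  (a + b) `^ p <= 2 `^ p * (a `^ p + b `^ p).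
Proof.
move=> p0 a0 b0; wlog ab : a b a0 b0 / a <= b.
  move=> h; have [ab|/ltW ba] := leP a b; first exact: h.
  by rewrite addrC [X in _ * X]addrC; exact: h.
apply: (le_trans (y := (2 * b) `^ p)).
  by apply: powR_ge0_mono; rewrite ?addr_ge0 //; lra.
by rewrite powRM // ler_wpM2l ?powR_ge0 // lerDr powR_ge0.
Qed.

Section Transport.
Context {R : realType} {dE : measure_display} {E : measurableType dE}.
Variables (dist : E -> E -> R) (x0 : E) (S : set E) (p beta rho0 : R).
Variables (K : nat) (L : nat -> nat).
Hypothesis dist_polish : polish dist.
Hypothesis dist_borel : borel_of_metric dist.
Hypothesis p_ge1 : 1 <= p.
Hypothesis rho00 : 0 < rho0.
Variable H : hierarchy dist x0 S p beta rho0 K L.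
Variables (mu : probability E R) (mS : measurable S) (mu_S : mu S = 1%E).

Local Notation T := (hT H).
Local Notation w := (cellw mu (cell H)).
Local Notation ce := (cell H).
Local Notation th := (2 `^ p).
Local Notation r := (radius rho0).

Definition scale k : R := r k `^ p.
Definition Lmax : nat := \max_(k < K.+1) L k.
(** The constant 16 comes from two points first separated at depth l: they share a class at depth l
    - 1, so their distance is at most 4 mesh(l-1) = 16 radius / 2^l. The weight is 0 below the depth
    of the annulus, because all annuli are summed up to the common [Lmax]. *)
Definition linkw l (c : T) : R :=
  if (ann c <= K)%N && (l <= L (ann c))%N then 16 `^ p * (scale (ann c) / th ^+ l) else 0.
Definition leafw (t : T) : R :=
  if (ann t <= K)%N then 16 `^ p * (scale (ann t) / th ^+ L (ann t)) else 0.

Let p0 : 0 <= p. Proof. by have := p_ge1; lra. Qed.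

Lemma th_gt0 : 0 < th :> R. Proof. exact: powR_gt0. Qed.
Let th0 := th_gt0.

Lemma scale_ge0 k : 0 <= scale k. Proof. exact: powR_ge0. Qed.

Lemma linkw_ge0 l c : 0 <= linkw l c.
Proof.
rewrite /linkw; case: ifP => // _.
by rewrite mulr_ge0 ?powR_ge0 // divr_ge0 ?scale_ge0 // exprn_ge0 // ltW.
Qed.

Lemma leafw_ge0 t : 0 <= leafw t.
Proof.
rewrite /leafw; case: ifP => // _.
by rewrite mulr_ge0 ?powR_ge0 // divr_ge0 ?scale_ge0 // exprn_ge0 // ltW.
Qed.

Lemma L_le_max k : (k <= K)%N -> (L k <= Lmax)%N.
Proof.
move=> kK; have := @leq_bigmax_cond _ xpredT (fun k : 'I_K.+1 => L k) (inord k) isT.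
by rewrite inordK.
Qed.

Lemma link_le (f : nat -> R) l : (forall l, 0 <= f l) -> (l <= Lmax)%N ->
  f l <= \sum_(i < Lmax.+1) f i.
Proof.
move=> f0 lL; rewrite -ltnS in lL; rewrite (bigD1 (Ordinal lL)) //= lerDl sumr_ge0 //.
Qed.

Lemma scale_close k l (d : R) : 0 <= d -> d <= 16 * (r k / 2 ^+ l) ->
  d `^ p <= 16 `^ p * (scale k / th ^+ l).
Proof.
move=> d0 h; have r0 := radius_gt0 rho00 k.
apply: (le_trans (powR_ge0_mono p0 d0 h)).
rewrite powRM //; last by rewrite divr_ge0 ?exprn_ge0 // ltW.
rewrite ler_wpM2l ?powR_ge0 // powRM ?invr_ge0 ?exprn_ge0 //; last exact: ltW.
rewrite /scale ler_wpM2l ?powR_ge0 // -powR_inv1 ?exprn_ge0 // powRAC expn_powR.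
by rewrite powR_inv1 // exprn_ge0 // ltW.
Qed.

(** Points of different annuli are paid for at depth 0, points of one annulus at the first depth
    that separates them (never 0, by [lev0]), and points never separated by the leaf term. *)
Lemma pointwise_cost y z : ce y <> out H -> ce z <> out H ->
  dist y z `^ p <= leafw (ce y) + \sum_(l < Lmax.+1)
    (if lev l (ce y) != lev l (ce z) then
       linkw l (lev l (ce y)) + linkw l (lev l (ce z)) else 0).
Proof.
move=> hy hz; have d0 := dist_ge0 dist_polish y z.
set F := fun l => if lev l (ce y) != lev l (ce z) then
  linkw l (lev l (ce y)) + linkw l (lev l (ce z)) else 0.
have F0 l : 0 <= F l by rewrite /F; case: ifP => // _; rewrite addr_ge0 // linkw_ge0.
have b0 := leafw_ge0 (ce y).
have [yK dy _] := cell_in hy; have [zK dz _] := cell_in hz.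
have dyz : dist y z <= r (ann (ce y)) + r (ann (ce z)).
  have := dist_triangle dist_polish x0 y z.
  by rewrite (dist_sym dist_polish y x0); lra.
have [eyz|neq] := eqVneq (ann (ce y)) (ann (ce z)); last first.
  apply: (le_trans (y := F 0%N)); last first.
    by rewrite (le_trans (link_le F0 (leq0n _))) // lerDr.
  rewrite /F ifT; last by apply: contra neq => /eqP h; rewrite -(ann_lev 0%N) h ann_lev.
  rewrite /linkw !ann_lev yK zK /= expr0 !divr1 -mulrDr.
  have ry := ltW (radius_gt0 rho00 (ann (ce y))).
  have rz := ltW (radius_gt0 rho00 (ann (ce z))).
  apply: (le_trans (powR_ge0_mono p0 d0 dyz)).
  apply: (le_trans (powR_add_le p0 ry rz)); rewrite ler_wpM2r ?addr_ge0 ?scale_ge0 //.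
  by apply: powR_ge0_mono => //; lra.
set k := ann (ce y) in eyz yK dy.
have [same|hl0] := pselect (forall l, (l <= L k)%N -> lev l (ce y) = lev l (ce z)).
  have h := lev_close hy eyz (leqnn _) (same _ (leqnn _)).
  apply: (le_trans (y := leafw (ce y))); last first.
    by rewrite lerDl sumr_ge0 // => l _; exact: F0.
  rewrite /leafw -/k yK; apply: scale_close => //; apply: (le_trans h).
  rewrite /mesh -/k; have : 0 <= r k / 2 ^+ L k.
    by rewrite divr_ge0 ?exprn_ge0 // ltW // radius_gt0.
  rewrite -!mulrA; lra.
have {hl0} : exists l, (l <= L k)%N && (lev l (ce y) != lev l (ce z)).
  apply: contra_notP hl0 => h l lL; apply/eqP; apply: contraT => h2.
  by exfalso; apply: h; exists l; rewrite lL.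
move=> ex; case: (ex_minnP ex) => -[|l] /andP[lL ne] lmin.
  by move: ne; rewrite (lev0 hy eyz) eqxx.
have same : lev l (ce y) = lev l (ce z).
  apply/eqP; apply: contraT => h; have := lmin l.
  by rewrite (ltnW lL) h ltnn => /(_ isT).
have h := lev_close hy eyz (ltnW lL) same.
apply: (le_trans (y := F l.+1)); last first.
  by rewrite (le_trans (link_le F0 (leq_trans lL (L_le_max yK)))) // lerDr.
rewrite /F ne; apply: (le_trans (y := linkw l.+1 (lev l.+1 (ce y)))); last first.
  by rewrite lerDl linkw_ge0.
rewrite /linkw ann_lev -/k yK lL /=; apply: scale_close => //; apply: (le_trans h).
rewrite /mesh -/k exprS le_eqVlt; apply/orP; left; apply/eqP.
by field; rewrite expf_neq0.
Qed.

Variable tau : R.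
Hypothesis tail_tau : (\int[mu]_(y in [set y | (r K < dist x0 y)%R])
   (dist x0 y `^ p)%:E <= tau%:E)%E.

Let mdx x D : measurable_fun D (fun y => (dist x y `^ p)%:E).
Proof.
apply: measurable_funTS; apply/measurable_EFinP.
exact: (measurableT_comp (measurable_powR p) (measurable_dist dist_polish dist_borel x)).
Qed.

Lemma measurable_far t : measurable [set y | t < dist x0 y].
Proof.
rewrite (_ : mkset _ = ~` cball dist x0 t); first exact/measurableC/measurable_cball.
by apply/seteqP; split => y /=; rewrite /cball /= ltNge => /negP.
Qed.

Lemma mu_SC : mu (~` S) = 0%E.
Proof. by rewrite probability_setC // mu_S subee. Qed.

Lemma out_tail : (\int[mu]_(y in ce @^-1` [set out H]) (dist x0 y `^ p)%:E <= tau%:E)%E.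
Proof.
apply: le_trans tail_tau.
have mo := cell_measurable (out H).
set A := ce @^-1` _ in mo *.
have m1 : measurable (A `&` S) by exact: measurableI.
have m2 : measurable (A `&` ~` S) by apply: measurableI => //; exact: measurableC.
have -> : A = (A `&` S) `|` (A `&` ~` S) by rewrite -setIUr setUv setIT.
rewrite ge0_integral_setU //; last first.
- by rewrite disj_set2E setIACA setICr setI0.
- by move=> y _; rewrite lee_fin powR_ge0.
rewrite [X in (_ + X)%E]null_set_integral ?adde0 //; last first.
  by apply: (subset_measure0 m2 (measurableC mS)); [exact: subIsetr|exact: mu_SC].
apply: ge0_subset_integral => //.
- exact: measurable_far.
- by move=> y _; rewrite lee_fin powR_ge0.
- by move=> y [/cell_out[]].
Qed.

Lemma mu_out_le : w (out H) <= fine (mu (~` cball dist x0 (r K))).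
Proof.
have mF : measurable (~` cball dist x0 (r K)) by exact/measurableC/measurable_cball.
rewrite -lee_fin -(cellwE mu (cell_measurable (h:=H))).
rewrite fineK ?fin_num_measure //.
apply: (@le_trans _ _ (mu (~` S `|` ~` cball dist x0 (r K)))).
  apply: le_measure; rewrite ?inE.
  - exact: cell_measurable.
  - by apply: measurableU => //; exact: measurableC.
  - move=> y /= /cell_out [h|h]; [by left|right; rewrite /cball /=].
    by apply/negP; rewrite -ltNge.
apply: (le_trans (measureU2 mu (measurableC mS) mF)).
by rewrite [X in (X + _)%E]mu_SC add0e.
Qed.

(** Any other cell of annulus index K+1 is the code of no point, hence has no mass. *)
Lemma w_out_class : classw w (lev (h:=H)) 0 (lev 0 (out H)) = w (out H).
Proof.
rewrite /classw (bigD1 (out H)) //= big1 ?addr0 // => t /andP[/eqP h ne].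
have at_ : ann t = K.+1 by rewrite -(ann_lev 0%N) h ann_lev ann_out.
rewrite /cellw (_ : _ @^-1` _ = set0) ?measure0 //.
apply/seteqP; split => // y /= hy.
have : ce y <> out H by rewrite hy; apply/eqP.
by move=> /cell_in [+ _ _]; rewrite hy at_ ltnn.
Qed.

(** The cell [out] has mass to be sent to sample points although it contains none of them. Through
    dist(y,z)^p <= th (dist(x0,y)^p + radius^p), the first part integrates to th * tau and the
    second is paid by the depth-0 weight of the target. *)
Lemma Wpp_le_discrepancy n (xs : 'I_n -> E) : (0 < n)%N ->
  let s := [seq ce (xs i) | i <- enum 'I_n] in
  out H \notin s ->
  (Wpp dist p mu (empirical xs) <= (\sum_t w t * leafw t
     + discrepancy w (lev (h:=H)) Lmax n linkw s + th * tau)%:E)%E.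
Proof.
move=> n0 s outs; set e := lev (h:=H).
have ss : size s = n by rewrite size_map size_enum_ord.
have xso i : ce (xs i) <> out H.
  by move=> h; apply/negP: outs; rewrite negbK; apply/mapP; exists i; rewrite ?mem_enum.
have tau0 : 0 <= tau.
  by rewrite -lee_fin (le_trans _ tail_tau) // integral_ge0 // => y _; rewrite lee_fin powR_ge0.
(* Extra depth-0 weight of the node of [out]. Its empirical mass is 0, so it adds hO times the mass
   of [out], that is th * tau, to the discrepancy; if the mass is 0, so is hO. *)
pose hO := th * tau / w (out H).
have w0 t : 0 <= w t by exact: cellw_ge0 (cell_measurable (h:=H)) t.
have w1 : \sum_t w t = 1 by apply: cellw_sum1; exact: cell_measurable.
have hO0 : 0 <= hO by rewrite divr_ge0 // mulr_ge0 // ltW.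
pose ho l (c : T) : R := if (l == 0)%N && (c == e 0%N (out H)) then hO else 0.
have ho0 l c : 0 <= ho l c by rewrite /ho; case: ifP.
pose h l c := linkw l c + ho l c.
have h0 l c : 0 <= h l c by rewrite addr_ge0 // linkw_ge0.
have [Q [Q0 Qw Qnu] Qc] := @tree_transport _ _ w e Lmax n w0 w1 n0 h leafw s
  h0 (lev_nested (h:=H)) ss.
have disc : discrepancy w e Lmax n h s <= discrepancy w e Lmax n linkw s + th * tau.
  rewrite /discrepancy (eq_bigr (fun l : 'I_Lmax.+1 =>
     \sum_c linkw l c * `|classw w e l c - classf e n l c s| +
     \sum_c ho l c * `|classw w e l c - classf e n l c s|)); last first.
    by move=> l _; rewrite -big_split; apply: eq_bigr => c _; rewrite /h mulrDl.
  rewrite big_split /= lerD2l big_ord_recl /= [X in _ + X]big1 ?addr0; last first.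
    by move=> l _; rewrite big1 // => c _; rewrite /ho /= mul0r.
  rewrite (bigD1 (e 0%N (out H))) //= big1 ?addr0; last first.
    by move=> c /negbTE hc; rewrite /ho hc andbF mul0r.
  rewrite /ho !eqxx /= w_out_class /classf (_ : count _ _ = 0%N).
    rewrite mul0r subr0 ger0_norm // /hO.
    have [->|wo] := eqVneq (w (out H)) 0; first by rewrite mulr0 mulr_ge0 // ltW.
    by rewrite divfK.
  apply/eqP; rewrite -leqn0 leqNgt -has_count; apply/hasPn => t /mapP[i _ ->].
  apply/negP => /eqP hi; have [+ _ _] := cell_in (xso i).
  by rewrite -(ann_lev 0%N) -/e hi ann_lev ann_out ltnn.
apply: (@le_trans _ _ (\sum_t w t * leafw t + discrepancy w e Lmax n h s)%:E); last first.
  by rewrite lee_fin -addrA lerD2l.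
move: Qc; rewrite -lee_fin; apply: le_trans.
apply: Wpp_le_discrete => //.
- exact: cell_measurable.
- move=> u; rewrite Qnu mulrC; congr (_ * _); rewrite /s count_map -sum1_count natr_sum.
  by rewrite big_mkcond big_enum; apply: eq_bigr => i _ /=; case: eqP.
move=> t i; set u := ce (xs i).
set c := (X in _ * X).
have mt := cell_measurable t.
have m1 : measurable_fun (ce @^-1` [set t]) (fun y => (dist y (xs i) `^ p)%:E).
  by under eq_fun do rewrite (dist_sym dist_polish); exact: mdx.
have [wt0|wt0] := eqVneq (w t) 0.
  rewrite null_set_integral ?wt0 ?mul0r //.
  by rewrite [LHS](cellwE mu (cell_measurable (h:=H)) t) wt0.
have [t_out|to] := eqVneq t (out H); last first.
  apply: (@le_trans _ _ (\int[mu]_(y in ce @^-1` [set t]) (cst c%:E) y)%E); last first.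
    by rewrite integral_cst // mulrC EFinM [X in (_ * X)%E](cellwE mu (cell_measurable (h:=H)) t).
  apply: ge0_le_integral => //.
  - by move=> y _; rewrite lee_fin powR_ge0.
  - move=> y /= yt; rewrite lee_fin.
    have yo : ce y <> out H by rewrite yt; apply/eqP.
    apply: (le_trans (pointwise_cost yo (xso i))); rewrite /c yt lerD2l.
    by apply: ler_sum => l _; case: ifP => // _; rewrite /h -/u lerD // lerDl.
rewrite /c t_out -/u => {c m1 mt}; have [uK du _] := cell_in (xso i).
set c := (X in _ * X).
have mo := cell_measurable (out H).
have wE := cellwE mu (cell_measurable (h:=H)) (out H).
set ku := ann (ce (xs i)) in uK du.
apply: (@le_trans _ _ (\int[mu]_(y in ce @^-1` [set out H])
   (th%:E * (dist x0 y `^ p)%:E + (th * scale ku)%:E))%E).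
  apply: ge0_le_integral => //.
  - by move=> y _; rewrite lee_fin powR_ge0.
  - by under eq_fun do rewrite (dist_sym dist_polish); exact: mdx.
  - by apply: emeasurable_funD => //; apply: measurable_funeM; exact: mdx.
  - move=> y _; rewrite -EFinM -EFinD lee_fin -mulrDr.
    have d1 := dist_ge0 dist_polish x0 y.
    apply: (le_trans (y := (dist x0 y + r ku) `^ p)).
      apply: powR_ge0_mono => //; first exact: (dist_ge0 dist_polish).
      have := dist_triangle dist_polish x0 y (xs i).
      by rewrite (dist_sym dist_polish y x0); lra.
    apply: powR_add_le => //; exact/ltW/radius_gt0.
rewrite ge0_integralD //; last 3 first.
- by move=> y _; rewrite -EFinM lee_fin mulr_ge0 ?powR_ge0.
- by apply: measurable_funeM; exact: mdx.
- by move=> y _; rewrite lee_fin mulr_ge0 ?powR_ge0.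
rewrite ge0_integralZl //; last first.
  by move=> y _; rewrite lee_fin powR_ge0.
rewrite (@integral_cst _ _ _ mu _ mo (th * scale ku)%:E).
rewrite [X in (_ + _ * X)%E]wE -EFinM.
apply: (@le_trans _ _ (th%:E * tau%:E + (th * scale ku * w (out H))%:E)%E).
  by apply: leeD => //; apply: lee_wpmul2l; [rewrite lee_fin powR_ge0 | exact: out_tail].
rewrite -EFinM -EFinD lee_fin.
pose F l : R := if lev l (out H) != lev l u then h l (lev l (out H)) + h l (lev l u) else 0.
have F0 l : 0 <= F l by rewrite /F; case: ifP => // _; rewrite addr_ge0.
have hF : F 0%N <= c.
  rewrite /c -[leLHS]add0r lerD ?leafw_ge0 //.
  exact: (link_le F0 (leq0n _)).
have wpos : 0 < w (out H) by rewrite lt0r w0 andbT; rewrite t_out in wt0.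
apply: le_trans (ler_wpM2l (ltW wpos) hF).
rewrite /F ifT; last first.
  apply/eqP => he; move: uK; rewrite /ku -(ann_lev 0%N) -/u -he ann_lev ann_out.
  by rewrite ltnn.
have h1 : hO <= h 0%N (lev 0 (out H)) by rewrite /h /ho !eqxx /= lerDr linkw_ge0.
have h2 : th * scale ku <= h 0%N (lev 0 u).
  apply: (le_trans (y := linkw 0%N (lev 0 u))); last by rewrite lerDl.
  rewrite /linkw ann_lev -/ku uK /= expr0 divr1 ler_wpM2r ?scale_ge0 //.
  by apply: powR_ge0_mono => //; lra.
have -> : th * tau + th * scale ku * w (out H) = w (out H) * (hO + th * scale ku).
  by rewrite /hO; field; rewrite gt_eqF.
by rewrite ler_wpM2l ?lerD // ltW.
Qed.

End Transport.

(** * Sums of weights over the annuli and levels of a hierarchy *)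

Lemma geometric_le2 (R : realType) (x : R) m : 0 <= x -> x <= 1 / 2 ->
  \sum_(l < m) x ^+ l <= 2.
Proof.
move=> x0 x2; suff : \sum_(l < m) x ^+ l <= 2 - 2 * x ^+ m.
  by have : 0 <= x ^+ m by [exact: exprn_ge0]; lra.
elim: m => [|m IH]; first by rewrite big_ord0 expr0; lra.
rewrite big_ord_recr /= exprS; have : 0 <= x ^+ m by exact: exprn_ge0.
by move=> h; nra.
Qed.

Lemma sum_ltn_le (R : realType) m k : \sum_(l < m) (l < k)%:R <= k%:R :> R.
Proof.
suff -> : \sum_(l < m) (l < k)%:R = (minn m k)%:R :> R by rewrite ler_nat geq_minr.
elim: m => [|m IH]; first by rewrite big_ord0 min0n.
rewrite big_ord_recr /= IH -natrD; congr (_%:R).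
by case: ltnP => h; lia.
Qed.

Section HierarchyBounds.
Context {R : realType} {dE : measure_display} {E : measurableType dE}.
Variables (dist : E -> E -> R) (x0 : E) (S : set E) (p beta rho0 : R).
Variables (K : nat) (L : nat -> nat).
Hypothesis dist_polish : polish dist.
Hypothesis dist_borel : borel_of_metric dist.
Hypothesis p_ge1 : 1 <= p.
Hypothesis beta0 : 0 < beta.
Hypothesis rho00 : 0 < rho0.
Variable H : hierarchy dist x0 S p beta rho0 K L.
Variable mu : probability E R.

Local Notation T := (hT H).
Local Notation ce := (cell H).
Local Notation le := (lev (h:=H)).
Local Notation w := (cellw mu ce).
Local Notation th := (2 `^ p).
Local Notation r := (radius rho0).
Local Notation sc := (scale p rho0).
Local Notation Lm := (Lmax K L).
Local Notation k16 := (16 `^ p).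

Let mce := cell_measurable (h:=H).
Let w0 t : 0 <= w t. Proof. exact: cellw_ge0 mce t. Qed.
Let th0 : 0 < th :> R. Proof. exact: powR_gt0. Qed.

Lemma th_ge2 : 2 <= th :> R.
Proof. by apply: le1r_powR => //; lra. Qed.

Lemma scaleS k : sc k.+1 = th * sc k.
Proof.
rewrite /scale /radius exprS mulrCA [LHS]powRM //.
by rewrite mulr_ge0 ?exprn_ge0 // ltW.
Qed.

Lemma scaleE k : sc k = rho0 `^ p * th ^+ k.
Proof. by rewrite /scale /radius powRM ?exprn_ge0 ?expn_powR // ltW. Qed.

Definition annw k : R := \sum_(t : T | ann t == k) w t.
(** Bound on the mass of an annulus that depends on mu only. The index shifts because annulus k+1
    lies beyond radius k; the innermost ball only has the trivial bound 1. *)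
Definition tail_annw k : R :=
  if k is k'.+1 then fine (mu (~` cball dist x0 (r k'))) else 1.

Lemma annw_le k : (k <= K)%N -> annw k <= tail_annw k.
Proof.
move=> kK.
have aE := cellw_sum mu mce (fun t => ann t == k).
have [ma _] := measure_fibers mu (fun t => ann t == k) mce.
rewrite -lee_fin -aE; case: k kK aE ma => [|k] kK aE ma /=; first exact: probability_le1.
have mF : measurable (~` cball dist x0 (r k)) by exact/measurableC/measurable_cball.
rewrite fineK ?fin_num_measure //; apply: le_measure; rewrite ?inE // => y /= /eqP ek.
have yo : ce y <> out H by move=> h; move: kK; rewrite -ek h ann_out ltnn.
have [_ _ /(_ k ek) h] := cell_in yo; rewrite /cball /=; apply/negP.
by rewrite -ltNge.
Qed.

Lemma sum_by_ann (F : T -> R) : (forall c, (K < ann c)%N -> F c = 0) ->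
  \sum_c F c = \sum_(k < K.+1) \sum_(c | ann c == k) F c.
Proof.
move=> F0; under [RHS]eq_bigr do rewrite big_mkcond.
rewrite exchange_big; apply: eq_bigr => c _ /=.
have [cK|cK] := leqP (ann c) K; last first.
  by rewrite F0 // big1 // => k _; case: ifP.
rewrite (bigD1 (inord (ann c))) //= inordK // eqxx big1 ?addr0 // => k hk.
case: eqP => // ek; move: hk; rewrite -val_eqE /= inordK //.
by rewrite ek eqxx.
Qed.

Lemma sum_ann (f : nat -> R) :
  \sum_t w t * (if (ann t <= K)%N then f (ann t) else 0) = \sum_(k < K.+1) f k * annw k.
Proof.
rewrite sum_by_ann; last by move=> c cK; rewrite leqNgt cK mulr0.
apply: eq_bigr => k _; rewrite /annw mulr_sumr; apply: eq_bigr => t /eqP ->.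
by rewrite -ltnS ltn_ord mulrC.
Qed.

Lemma sum_leafw : \sum_t w t * leafw t =
  k16 * \sum_(k < K.+1) sc k / th ^+ L k * annw k.
Proof.
rewrite (eq_bigr (fun t => w t * (if (ann t <= K)%N then
   (fun k => k16 * (sc k / th ^+ L k)) (ann t) else 0))) //.
rewrite (sum_ann (fun k => k16 * (sc k / th ^+ L k))) mulr_sumr.
by apply: eq_bigr => k _; rewrite [RHS]mulrA.
Qed.

Lemma pathw_ge0 t : 0 <= pathw le Lm (linkw (H:=H)) t.
Proof. by apply: sumr_ge0 => l _; exact: linkw_ge0. Qed.

(** Geometric series of ratio 1/th <= 1/2: the influence of a point does not grow with the number of
    levels. *)
Lemma pathw_le t : pathw le Lm (linkw (H:=H)) t <=
  if (ann t <= K)%N then 2 * k16 * sc (ann t) else 0.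
Proof.
rewrite /pathw; case: ifP => tK; last first.
  by rewrite big1 // => l _; rewrite /linkw ann_lev tK.
apply: (le_trans (y := \sum_(l < Lm.+1) k16 * sc (ann t) * th^-1 ^+ l)).
  apply: ler_sum => l _; rewrite /linkw ann_lev tK /= exprVn.
  case: ifP => _; first by rewrite mulrA.
  by rewrite mulr_ge0 ?invr_ge0 ?exprn_ge0 ?mulr_ge0 ?powR_ge0 ?scale_ge0 // ltW.
rewrite -mulr_sumr [leRHS](_ : _ = k16 * sc (ann t) * 2); last by ring.
rewrite ler_wpM2l ?mulr_ge0 ?powR_ge0 ?scale_ge0 //; apply: geometric_le2.
  by rewrite invr_ge0 ltW.
by rewrite div1r lef_pV2 ?posrE ?th0 // th_ge2.
Qed.

Lemma w_support t : w t != 0 -> exists y, ce y = t.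
Proof.
apply: contra_neqP => h; rewrite /cellw (_ : _ @^-1` _ = set0) ?measure0 //.
by apply/seteqP; split => // y hy; apply: h; exists y.
Qed.

(** Cauchy-Schwarz over the at most (1 + 2 beta) th^(2l) classes that carry mass. The resulting th^l
    cancels the factor th^(-l) of [linkw]. *)
Lemma sum_sqrt_class k l : (k <= K)%N -> (l <= L k)%N ->
  \sum_(c | ann c == k) Num.sqrt (classw w le l c)
  <= Num.sqrt (1 + 2 * beta) * th ^+ l * Num.sqrt (annw k).
Proof.
move=> kK lL; have [A cardA hA] := lev_card H kK lL.
have out0 c : ann c == k -> c \notin A -> classw w le l c = 0.
  move=> /eqP ck cA; rewrite /classw big1 // => t /eqP tc.
  apply/eqP; apply: contraNT cA => /w_support[y yt].
  rewrite -tc -yt; apply: hA; by rewrite yt -(ann_lev l) tc.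
pose wA (c : T) : R := (c \in A)%:R.
have wA0 c : 0 <= wA c by exact: ler0n.
pose z (c : T) : R := (ann c == k)%:R * Num.sqrt (classw w le l c).
have cw0 c : 0 <= classw w le l c by exact: classw_ge0.
have cs := @sum_cauchy_schwarz R T wA (fun=> 1) z wA0.
have e1 : \sum_c wA c * (1 * z c) = \sum_(c | ann c == k) Num.sqrt (classw w le l c).
  rewrite [RHS]big_mkcond; apply: eq_bigr => c _; rewrite /wA /z.
  case: ifP => ck; last by rewrite mul0r !mulr0.
  have [cA|cA] := boolP (c \in A); first by rewrite !mul1r.
  by rewrite out0 ?ck // sqrtr0 !mulr0.
have e2 : \sum_c wA c * 1 ^+ 2 = #|A|%:R.
  rewrite -sum1_card natr_sum [RHS]big_mkcond; apply: eq_bigr => c _.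
  by rewrite /wA expr1n mulr1; case: (c \in A).
have e3 : \sum_c wA c * z c ^+ 2 <= annw k.
  have -> : annw k = \sum_c \sum_t (if (ann c == k) && (le l t == c) then w t else 0).
    rewrite exchange_big /annw big_mkcond; apply: eq_bigr => t _ /=.
    rewrite (bigD1 (le l t)) //= eqxx andbT ann_lev big1 ?addr0 // => c.
    by rewrite eq_sym => /negbTE ->; rewrite andbF.
  apply: ler_sum => c _; rewrite /z exprMn sqr_sqrtr //.
  have [ck|ck] := boolP (ann c == k); last first.
    by rewrite /= expr0n mul0r mulr0; apply: sumr_ge0.
  rewrite expr1n mul1r /= /classw [in leRHS]big_mkcond /= -big_mkcond /=.
  by rewrite /wA; case: (c \in A); rewrite ?mul1r // mul0r sumr_ge0.
rewrite e1 e2 in cs.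
have s0 : 0 <= \sum_(c | ann c == k) Num.sqrt (classw w le l c).
  by apply: sumr_ge0 => c _; exact: sqrtr_ge0.
rewrite -(ger0_norm s0) -sqrtr_sqr.
have -> : Num.sqrt (1 + 2 * beta) * th ^+ l * Num.sqrt (annw k) =
   Num.sqrt ((1 + 2 * beta) * th ^+ (2 * l) * annw k).
  have b0 : 0 <= 1 + 2 * beta by have := beta0; lra.
  rewrite sqrtrM ?mulr_ge0 ?exprn_ge0 ?(ltW th0) // sqrtrM //.
  by rewrite mulnC exprM sqrtr_sqr ger0_norm // exprn_ge0 // ltW.
apply: ler_wsqrtr; apply: (le_trans cs); apply: ler_pM => //.
by apply: sumr_ge0 => c _; rewrite mulr_ge0 ?sqr_ge0.
Qed.

Lemma sum_linkw_sqrt n : (0 < n)%N ->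
  \sum_(l < Lm.+1) \sum_c (linkw (H:=H) l c) * Num.sqrt (classw w le l c / n%:R)
  <= k16 * Num.sqrt ((1 + 2 * beta) / n%:R) *
     \sum_(k < K.+1) (L k).+1%:R * sc k * Num.sqrt (annw k).
Proof.
move=> n0; have nn : 0 <= (n%:R : R)^-1 by rewrite invr_ge0.
have b0 : 0 <= 1 + 2 * beta by have := beta0; lra.
set C := k16 * Num.sqrt ((1 + 2 * beta) / n%:R).
have C0 : 0 <= C by rewrite mulr_ge0 ?powR_ge0 ?sqrtr_ge0.
apply: (le_trans (y := \sum_(l < Lm.+1) \sum_(k < K.+1)
   (l < (L k).+1)%:R * (C * (sc k * Num.sqrt (annw k))))); last first.
  rewrite exchange_big mulr_sumr; apply: ler_sum => k _ /=.
  rewrite -mulr_suml -mulrA mulrCA.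
  apply: ler_wpM2l => //.
  by rewrite ler_wpM2r ?sum_ltn_le // mulr_ge0 ?scale_ge0 ?sqrtr_ge0.
apply: ler_sum => l _; rewrite sum_by_ann; last first.
  by move=> c cK; rewrite /linkw leqNgt cK mul0r.
apply: ler_sum => k _; have kK : (k <= K)%N by rewrite -ltnS ltn_ord.
have [lL|lL] := leqP l (L k); last first.
  rewrite big1; first by rewrite ltnNge lL mul0r.
  by move=> c /eqP ck; rewrite /linkw ck kK /= leqNgt lL mul0r.
rewrite (eq_bigr (fun c => k16 * (sc k / th ^+ l) * (Num.sqrt n%:R^-1) *
   Num.sqrt (classw w le l c))); last first.
  move=> c /eqP ck; rewrite /linkw ck kK lL /= sqrtrM; last exact: classw_ge0.
  by ring.
rewrite -mulr_sumr ltnS lL mul1r.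
apply: (le_trans (ler_wpM2l _ (sum_sqrt_class kK lL))).
  by rewrite !mulr_ge0 ?powR_ge0 ?scale_ge0 ?sqrtr_ge0 // invr_ge0 exprn_ge0 // ltW.
rewrite /C sqrtrM // le_eqVlt; apply/orP; left; apply/eqP.
by field; rewrite expf_neq0 // gt_eqF.
Qed.

Lemma sum_pathw : \sum_t w t * pathw le Lm (linkw (H:=H)) t <=
  2 * k16 * \sum_(k < K.+1) sc k * annw k.
Proof.
rewrite mulr_sumr; under [leRHS]eq_bigr do rewrite mulrA.
rewrite -(sum_ann (fun k => 2 * k16 * sc k)); apply: ler_sum => t _.
by rewrite ler_wpM2l // pathw_le.
Qed.

Lemma sum_pathw_sqr : \sum_t w t * pathw le Lm (linkw (H:=H)) t ^+ 2 <=
  4 * k16 ^+ 2 * \sum_(k < K.+1) sc k ^+ 2 * annw k.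
Proof.
rewrite mulr_sumr; under [leRHS]eq_bigr do rewrite mulrA.
rewrite -(sum_ann (fun k => 4 * k16 ^+ 2 * sc k ^+ 2)); apply: ler_sum => t _.
rewrite ler_wpM2l //; have h := pathw_le t; have h0 := pathw_ge0 t.
apply: (le_trans (y := (if (ann t <= K)%N then 2 * k16 * sc (ann t) else 0) ^+ 2)).
  by rewrite ler_sqr ?nnegrE // (le_trans h0).
by case: ifP => _; [rewrite le_eqVlt; apply/orP; left; apply/eqP; ring | rewrite expr0n].
Qed.

Lemma integral_cell (G : T -> R) : (forall t, 0 <= G t) ->
  (\int[mu]_y (G (ce y))%:E = (\sum_t w t * G t)%:E)%E.
Proof.
move=> G0.
have mi t : measurable_fun setT (fun y => ((G t)%:E * (\1_(ce @^-1` [set t]) y : R)%:E)%E).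
  apply: measurable_funeM; apply/measurable_EFinP; exact: measurable_indic.
transitivity (\int[mu]_y (\sum_t (G t)%:E * (\1_(ce @^-1` [set t]) y)%:E))%E.
  apply: eq_integral => y _; rewrite (bigD1 (ce y)) //= big1 ?adde0.
    by rewrite indicE mem_set ?mule1.
  by move=> t ht; rewrite indicE memNset ?mule0 //= => h; move: ht; rewrite h eqxx.
rewrite ge0_integral_sum //; last first.
  by move=> t y _; rewrite mule_ge0 // lee_fin.
rewrite -sumEFin; apply: eq_bigr => t _.
rewrite ge0_integralZl //; last 2 first.
- by apply/measurable_EFinP; exact: measurable_indic.
- by rewrite lee_fin.
rewrite integral_indic // setIT [X in (_ * X)%E](cellwE mu mce t).
by rewrite -EFinM mulrC.
Qed.

(** On annulus k+1 the distance exceeds radius k, so scale(k+1) = th scale(k) <= th dist^p: apart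
    from the innermost ball the sum is dominated by th times the p-th moment. *)
Lemma sum_scale_annw (M : R) : (pmoment dist mu x0 p <= M%:E)%E ->
  \sum_(k < K.+1) sc k * annw k <= sc 0 + th * M.
Proof.
move=> hM; rewrite big_ord_recl /=; apply: lerD.
  by rewrite ler_piMr ?scale_ge0 // (le_trans (annw_le (leq0n _))).
pose G (t : T) : R := if (ann t <= K)%N then (fun k => if k is k'.+1 then sc k' else 0) (ann t) else 0.
have G0 t : 0 <= G t by rewrite /G; case: ifP => // _; case: (ann t) => // k; exact: scale_ge0.
have -> : \sum_(i < K) sc (bump 0 i) * annw (bump 0 i) = th * \sum_t w t * G t.
  rewrite (sum_ann (fun k => if k is k'.+1 then sc k' else 0)) big_ord_recl /= mul0r add0r.
  by rewrite mulr_sumr; apply: eq_bigr => i _; rewrite scaleS mulrA.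
rewrite ler_wpM2l ?(ltW th0) // -lee_fin -integral_cell //.
have mG : measurable_fun setT (fun y => (G (ce y))%:E).
  rewrite (_ : (fun y => _) = (fun y => \sum_t (G t)%:E * (\1_(ce @^-1` [set t]) y : R)%:E)%E).
    apply: emeasurable_sum => t; apply: measurable_funeM; apply/measurable_EFinP.
    exact: measurable_indic.
  apply/funext => y; rewrite (bigD1 (ce y)) //= big1 ?adde0.
    by rewrite indicE mem_set ?mule1.
  by move=> t ht; rewrite indicE memNset ?mule0 //= => h; move: ht; rewrite h eqxx.
apply: le_trans hM; apply: ge0_le_integral => //.
- by move=> y _; rewrite lee_fin.
- apply/measurable_EFinP.
  exact: (measurableT_comp (measurable_powR p) (measurable_dist dist_polish dist_borel x0)).
move=> y _; rewrite lee_fin /G; case: ifP => [yK|]; last by rewrite powR_ge0.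
have yo : ce y <> out H by move=> h; move: yK; rewrite h ann_out ltnn.
have [_ _ hk] := cell_in yo.
case ek : (ann (ce y)) => [|k]; first by rewrite powR_ge0.
apply: powR_ge0_mono; [by have := p_ge1; lra | exact/ltW/radius_gt0 | exact/ltW/hk].
Qed.

End HierarchyBounds.

(** * Deviation bounds for a fixed choice of scales *)

Section DeviationBounds.
Context {R : realType} {dE : measure_display} {E : measurableType dE}.
Variables (dist : E -> E -> R) (x0 : E) (S : set E) (p beta : R).
Hypothesis dist_polish : polish dist.
Hypothesis dist_borel : borel_of_metric dist.
Hypothesis p_ge1 : 1 <= p.
Hypothesis beta0 : 0 < beta.
Hypothesis mS : measurable S.
Hypothesis cover : forall rr delta : R, 0 < rr -> 0 < delta -> delta <= 2 * rr ->
  (covering_number dist (S `&` cball dist x0 rr) delta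
     <= (beta * (2 * rr / delta) `^ (2 * p))%:E)%E.
Variable mu : probability E R.
Hypothesis mu_S : mu S = 1%E.
Context {dO : measure_display} {Om : measurableType dO} {P : probability Om R}.
Variables (n : nat) (X : 'I_n -> Om -> E).
Hypothesis n0 : (0 < n)%N.
Hypothesis iidX : iid_law P X mu.
Variables (rho0 : R) (K : nat) (L : nat -> nat) (tau : R).
Hypothesis rho00 : 0 < rho0.
Hypothesis tail_tau : (\int[mu]_(y in [set y | (radius rho0 K < dist x0 y)%R])
   (dist x0 y `^ p)%:E <= tau%:E)%E.

Local Notation th := (2 `^ p).
Local Notation sc := (scale p rho0).
Local Notation k16 := (16 `^ p).
Local Notation eta := (tail_annw dist x0 rho0 mu).
Local Notation W := (fun om => Wpp dist p mu (empirical (fun i => X i om))).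

(** [det_cost], [mean_cost] and [tail_prob] involve tails of mu instead of cell masses, so they do
    not depend on the hierarchy that is chosen later. *)
Definition det_cost : R := k16 * \sum_(k < K.+1) sc k / th ^+ L k * eta k + th * tau.
Definition mean_cost : R := k16 * Num.sqrt ((1 + 2 * beta) / n%:R) *
  \sum_(k < K.+1) (L k).+1%:R * sc k * Num.sqrt (eta k).
Definition tail_prob : R := n%:R * fine (mu (~` cball dist x0 (radius rho0 K))).

Let nR : 0 < n%:R :> R. Proof. by rewrite ltr0n. Qed.

Section WithHierarchy.
Variable H : hierarchy dist x0 S p beta rho0 K L.
Local Notation ce := (cell H).
Local Notation lv := (lev (h:=H)).
Local Notation lw := (linkw (H:=H)).
Local Notation w := (cellw mu ce).
Local Notation D := (discrepancy w lv (Lmax K L) n lw).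

Let mce := cell_measurable (h:=H).
Let w0 t : 0 <= w t. Proof. exact: cellw_ge0 mce t. Qed.
Let w1 : \sum_t w t = 1. Proof. exact: cellw_sum1. Qed.
Let lw0 l c : 0 <= lw l c. Proof. exact: linkw_ge0. Qed.

Lemma deviation_le_Pr (x s0 : R) : \sum_t w t * leafw t + th * tau + s0 <= x ->
  (P [set om | (x%:E < W om)%E] <= (tail_prob + Pr w n (fun s => s0 < D s))%:E)%E.
Proof.
move=> hx.
pose A s := (out H \in s) || (s0 < D s).
have [mA PA] := iid_cell_event mce A iidX.
have mX : forall i, measurable_fun setT (X i) by case: iidX.
have mW := measurable_Wpp_gt dist_polish dist_borel mu p_ge1 x0 x n0 mX.
apply: (@le_trans _ _ (P [set om | A [seq ce (X i om) | i <- enum 'I_n]])).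
  apply: le_measure; rewrite ?inE // => om /= hW; apply: contraT.
  case/norP => o1 /negP o2; have {}o2 : D [seq ce (X i om) | i <- enum 'I_n] <= s0.
    by rewrite leNgt; apply/negP.
  have hD := Wpp_le_discrepancy dist_polish dist_borel p_ge1 rho00 mS mu_S tail_tau n0 o1.
  move: (lt_le_trans hW hD); rewrite lte_fin => h.
  by exfalso; move: h; rewrite ltNge => /negP; apply; lra.
rewrite PA lee_fin; apply: (le_trans (Pr_orb w0 n _ _)); apply: lerD => //.
apply: (le_trans (Pr_mem w0 w1 n (out H))).
by rewrite ler_wpM2l ?ler0n // mu_out_le.
Qed.

Lemma sum_leafw_le : \sum_t w t * leafw t + th * tau <= det_cost.
Proof.
rewrite lerD2r sum_leafw ler_wpM2l ?powR_ge0 //; apply: ler_sum => k _.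
rewrite ler_wpM2l ?divr_ge0 ?scale_ge0 ?exprn_ge0 ?powR_ge0 // annw_le //.
by rewrite -ltnS ltn_ord.
Qed.

Lemma discrepancy_sqr_le : Ex w n (fun s => D s ^+ 2) <= mean_cost ^+ 2.
Proof.
apply: (le_trans (Ex_discrepancy_sqr lv (Lmax K L) w0 w1 n0 lw0)).
have h0 : 0 <= \sum_(l < (Lmax K L).+1) \sum_c lw l c * Num.sqrt (classw w lv l c / n%:R).
  by apply: sumr_ge0 => l _; apply: sumr_ge0 => c _; rewrite mulr_ge0 ?sqrtr_ge0.
rewrite ler_sqr ?nnegrE //.
  apply: (le_trans (sum_linkw_sqrt beta0 H mu n0)).
  rewrite ler_wpM2l ?mulr_ge0 ?powR_ge0 ?sqrtr_ge0 //; apply: ler_sum => k _.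
  rewrite ler_wpM2l ?mulr_ge0 ?scale_ge0 ?ler0n // ler_wsqrtr // annw_le //.
  by rewrite -ltnS ltn_ord.
apply: mulr_ge0; first by rewrite mulr_ge0 ?powR_ge0 ?sqrtr_ge0.
by apply: sumr_ge0 => k _; rewrite !mulr_ge0 ?scale_ge0 ?sqrtr_ge0 ?ler0n.
Qed.

Lemma mean_cost_ge0 : 0 <= mean_cost.
Proof.
apply: mulr_ge0; first by rewrite mulr_ge0 ?powR_ge0 ?sqrtr_ge0.
by apply: sumr_ge0 => k _; rewrite !mulr_ge0 ?scale_ge0 ?sqrtr_ge0 ?ler0n.
Qed.

Lemma Ex_discrepancy_le : Ex w n D <= mean_cost.
Proof.
apply: (le_trans (Ex_le_sqrt w0 w1 n D)).
rewrite -[leRHS](ger0_norm mean_cost_ge0) -sqrtr_sqr.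
exact: ler_wsqrtr discrepancy_sqr_le.
Qed.

Lemma scale_le k : (k <= K)%N -> sc k <= sc K.
Proof.
move=> kK; apply: powR_ge0_mono; first by have := p_ge1; lra.
  exact/ltW/radius_gt0.
by rewrite ler_wpM2l ?(ltW rho00) // ler_weXn2l //; lra.
Qed.

(** By [pathw_le] one observation has influence at most G = 2 k16 sc(K) / n, whence the last
    condition, 2 G q <= a. The 16 is the 4 of the variance proxy times the 4 of [sum_pathw_sqr]. *)
Lemma Pr_discrepancy (q a V : R) : 0 < q -> 0 < a -> 0 < V ->
  16 * k16 ^+ 2 * (\sum_(k < K.+1) sc k ^+ 2 * eta k) / n%:R <= V ->
  4 * k16 * sc K * q / n%:R <= a ->
  Pr w n (fun s => Ex w n D + a < D s) <= expR (q ^+ 2) * (V / a ^+ 2) `^ (q / 2).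
Proof.
move=> q0 a0 V0 hV ha.
pose g t := pathw lv (Lmax K L) lw t / n%:R.
have g0 t : 0 <= g t by rewrite divr_ge0 // ?pathw_ge0 // ltW.
have gG t : g t <= 2 * k16 * sc K / n%:R.
  rewrite ler_wpM2r ?invr_ge0 ?(ltW nR) //; apply: (le_trans (pathw_le p_ge1 t)).
  case: ifP => tK; first by rewrite ler_wpM2l ?mulr_ge0 ?powR_ge0 // scale_le.
  by rewrite !mulr_ge0 ?powR_ge0 ?scale_ge0.
apply: (Pr_fuk_nagaev w0 w1 g0 gG) => //; last exact: discrepancy_bounded_diff.
- apply: le_trans hV.
  have -> : n%:R * (4 * \sum_t w t * g t ^+ 2) =
      4 * (\sum_t w t * pathw lv (Lmax K L) lw t ^+ 2) / n%:R.
    rewrite (eq_bigr (fun t => w t * pathw lv (Lmax K L) lw t ^+ 2 * n%:R^-1 ^+ 2)); last first.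
      by move=> t _; rewrite /g; ring.
    by rewrite -mulr_suml; field; rewrite gt_eqF.
  rewrite ler_wpM2r ?invr_ge0 ?(ltW nR) //.
  have h1 : \sum_(k < K.+1) sc k ^+ 2 * annw H mu k <= \sum_(k < K.+1) sc k ^+ 2 * eta k.
    apply: ler_sum => k _; rewrite ler_wpM2l ?sqr_ge0 // annw_le //.
    by rewrite -ltnS ltn_ord.
  have h2 := sum_pathw_sqr p_ge1 H mu.
  have h3 := ler_wpM2l (sqr_ge0 k16) h1.
  lra.
- apply: le_trans ha; rewrite le_eqVlt; apply/orP; left; apply/eqP.
  by field; rewrite gt_eqF.
Qed.

End WithHierarchy.

Let getH : exists H : hierarchy dist x0 S p beta rho0 K L, True.
Proof.
by have [H] := hierarchy_exists K L dist_polish dist_borel mS beta0 rho00 cover; exists H.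
Qed.

(** The raw second moment of the discrepancy is used, so its mean needs no separate share of x. *)
Lemma deviation_chebyshev (x s0 : R) : 0 < s0 -> det_cost + s0 <= x ->
  (P [set om | (x%:E < W om)%E] <= (tail_prob + mean_cost ^+ 2 / s0 ^+ 2)%:E)%E.
Proof.
move=> s00 hx; have [H _] := getH.
have hx' := sum_leafw_le H.
apply: (le_trans (@deviation_le_Pr H x s0 _)); first lra.
rewrite lee_fin lerD2l (le_trans (Pr_chebyshev _ _ _ s00)) //.
  exact: cellw_ge0 (cell_measurable (h:=H)).
by rewrite ler_wpM2r ?invr_ge0 ?sqr_ge0 // discrepancy_sqr_le.
Qed.

Lemma deviation_fuk_nagaev (x m q a V : R) : 0 < q -> 0 < a -> 0 < V ->
  mean_cost <= m -> det_cost + m + a <= x ->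
  16 * k16 ^+ 2 * (\sum_(k < K.+1) sc k ^+ 2 * eta k) / n%:R <= V ->
  4 * k16 * sc K * q / n%:R <= a ->
  (P [set om | (x%:E < W om)%E] <=
    (tail_prob + expR (q ^+ 2) * (V / a ^+ 2) `^ (q / 2))%:E)%E.
Proof.
move=> q0 a0 V0 hm hx hV ha; have [H _] := getH.
have hx' := sum_leafw_le H; have hE := Ex_discrepancy_le H.
apply: (le_trans (@deviation_le_Pr H x (Ex (cellw mu (cell H)) n
   (discrepancy (cellw mu (cell H)) (lev (h:=H)) (Lmax K L) n
     (linkw (H:=H))) + a) _)); first lra.
by rewrite lee_fin lerD2l Pr_discrepancy.
Qed.

(** With depth 0 everywhere the mean is controlled by the p-th moment. In 5 k16, one unit is the
    leaf cost and four are the mean: 2 from [Ex_discrepancy] times 2 from [sum_pathw]. *)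
Lemma deviation_fuk_nagaev_moment (x M q a V : R) : 0 < q -> 0 < a -> 0 < V ->
  (forall k, L k = 0%N) -> (pmoment dist mu x0 p <= M%:E)%E ->
  5 * k16 * (sc 0 + th * M) + th * tau + a <= x ->
  16 * k16 ^+ 2 * (\sum_(k < K.+1) sc k ^+ 2 * eta k) / n%:R <= V ->
  4 * k16 * sc K * q / n%:R <= a ->
  (P [set om | (x%:E < W om)%E] <=
    (tail_prob + expR (q ^+ 2) * (V / a ^+ 2) `^ (q / 2))%:E)%E.
Proof.
move=> q0 a0 V0 L0 hM hx hV ha; have [H _] := getH.
have mce := cell_measurable (h:=H).
have hs := sum_scale_annw dist_polish dist_borel p_ge1 rho00 H hM.
have hE := Ex_discrepancy (lev (h:=H)) (Lmax K L) (cellw_ge0 mu mce) (cellw_sum1 mu mce) n0 (linkw_ge0 (H:=H)).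
have hp := sum_pathw p_ge1 H mu.
have hl : \sum_t cellw mu (cell H) t * leafw t <= k16 * (sc 0 + th * M).
  rewrite sum_leafw ler_wpM2l ?powR_ge0 // (le_trans _ hs) //.
  by apply: ler_sum => k _; rewrite L0 expr0 divr1.
have h4 := ler_wpM2l (powR_ge0 16 p) hs.
apply: (le_trans (@deviation_le_Pr H x (Ex (cellw mu (cell H)) n
   (discrepancy (cellw mu (cell H)) (lev (h:=H)) (Lmax K L) n
     (linkw (H:=H))) + a) _)); last by rewrite lee_fin lerD2l Pr_discrepancy.
lra.
Qed.

End DeviationBounds.

(** * Tail integrals *)

Local Notation ico a b := ([set` Interval (BLeft a%R) (BLeft b%R)]%classic).

Lemma geometric_le (R : realType) (x : R) m : 0 <= x -> x < 1 ->
  \sum_(l < m) x ^+ l <= (1 - x)^-1.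
Proof.
move=> x0 x1; have h : 0 < 1 - x by rewrite subr_gt0.
suff -> : \sum_(l < m) x ^+ l = (1 - x ^+ m) / (1 - x).
  by rewrite ler_pdivrMr // mulVf ?gt_eqF // gerBl exprn_ge0.
elim: m => [|m IH]; first by rewrite big_ord0 expr0 subrr mul0r.
by rewrite big_ord_recr /= IH exprS; field; rewrite gt_eqF.
Qed.

Lemma geometric_integral_le d (Y : measurableType d) (R : realType)
    (m : {measure set Y -> \bar R}) (F : nat -> set Y) (f : Y -> \bar R) (A x : R) :
  0 <= A -> 0 <= x -> x < 1 -> (forall j, measurable (F j)) -> trivIset setT F ->
  measurable_fun (\bigcup_j F j) f -> (forall y, 0 <= f y)%E ->
  (forall j, \int[m]_(y in F j) f y <= (A * x ^+ j)%:E)%E ->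
  (\int[m]_(y in \bigcup_j F j) f y <= (A / (1 - x))%:E)%E.
Proof.
move=> A0 x0 x1 mF tF mf f0 hF; rewrite ge0_integral_bigcup //.
apply: lime_le.
  by apply: is_cvg_nneseries => k _ _; apply: integral_ge0.
apply: nearW => k; apply: (@le_trans _ _ (\sum_(0 <= j < k) (A * x ^+ j)%:E)%E).
  by apply: lee_sum => j _; exact: hF.
by rewrite sumEFin big_mkord -mulr_sumr lee_fin ler_wpM2l // geometric_le.
Qed.

Lemma integral_cst_ico (R : realType) (a b c : R) : a < b ->
  (\int[lebesgue_measure]_(t in ico a b) (cst c%:E) t = (c * (b - a))%:E)%E.
Proof.
move=> ab; apply: (eq_trans (integral_cst _ _ _)) => //; rewrite EFinM.
congr (_ * _)%E; apply: (eq_trans (lebesgue_measure_itv _)).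
by rewrite /= lte_fin ab EFinB.
Qed.

Lemma le1_powR_lt1 (R : realType) (a s : R) : 1 < a -> s < 0 -> a `^ s < 1.
Proof.
move=> a1 s0; rewrite /powR gt_eqF; last lra.
by rewrite -expR0 ltr_expR nmulr_rlt0 // ln_gt0.
Qed.

Lemma mulr_powRN (R : realType) (a r : R) : 0 < a -> a * a `^ (- r) = a `^ (1 - r).
Proof.
by move=> a0; rewrite powRD ?powRr1 ?(ltW a0) // (gt_eqF a0) implybT.
Qed.

(** * Comparison of dyadic sums of tails with I and with weak moments *)

Section TailCalculus.
Context {R : realType} {dE : measure_display} {E : measurableType dE}.
Variables (dist : E -> E -> R) (x0 : E) (p : R).
Hypothesis dist_polish : polish dist.
Hypothesis dist_borel : borel_of_metric dist.
Hypothesis p_ge1 : 1 <= p.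
Variable mu : probability E R.

Definition tailf (t : R) : R := fine (tailH dist mu x0 t).
Local Notation Ht := tailf.
Local Notation th := (2 `^ p).
Local Notation f := (fun t : R => (Num.sqrt (Ht t) * t `^ (p - 1))%:E).

Let p0 : 0 < p. Proof. by have := p_ge1; lra. Qed.
Let mC t : measurable (~` cball dist x0 t).
Proof. exact/measurableC/measurable_cball. Qed.

Lemma tailfE t : mu (~` cball dist x0 t) = (Ht t)%:E.
Proof. by rewrite fineK // fin_num_measure. Qed.

Lemma tailf_ge0 t : 0 <= Ht t.
Proof. by rewrite -lee_fin -tailfE measure_ge0. Qed.

Lemma tailf_le1 t : Ht t <= 1.
Proof. by rewrite -lee_fin -tailfE probability_le1. Qed.

Lemma tailf_mono s t : s <= t -> Ht t <= Ht s.
Proof.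
move=> st; rewrite -lee_fin -!tailfE le_measure ?inE // => y /= h; apply: contra_not h.
by rewrite /cball /= => /le_trans; apply.
Qed.

Lemma measurable_intg D : measurable D -> measurable_fun D f.
Proof.
move=> mD; apply/measurable_EFinP; apply: measurable_funM; last first.
  exact: measurable_funTS (measurable_powR _).
by apply: nonincreasing_measurable => // s t st; rewrite ler_wsqrtr // tailf_mono.
Qed.

Let f0 t : (0 <= f t)%E.
Proof. by rewrite lee_fin mulr_ge0 ?sqrtr_ge0 ?powR_ge0. Qed.

Lemma I2ppE : I2pp dist mu x0 p = (\int[lebesgue_measure]_(t in [set t : R | (0 <= t)%R]) f t)%E.
Proof. by []. Qed.

Let pos_itv : [set t : R | (0 <= t)%R] = `[0, +oo[%classic.
Proof. by apply/seteqP; split => t /=; rewrite in_itv /= andbT. Qed.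

Let mul_pow (a : R) : 0 < a -> a `^ (p - 1) * a = a `^ p.
Proof. by move=> a0; rewrite mulrC mulr_powRB1 // ltW. Qed.

Lemma dyadic_lower (a : R) : 0 < a ->
  ((Num.sqrt (Ht (2 * a)) * a `^ p)%:E <=
     \int[lebesgue_measure]_(t in ico a (2 * a)) f t)%E.
Proof.
move=> a0; set c := Num.sqrt (Ht (2 * a)) * a `^ (p - 1).
have c0 : 0 <= c by rewrite mulr_ge0 ?sqrtr_ge0 ?powR_ge0.
apply: (@le_trans _ _ (\int[lebesgue_measure]_(t in ico a (2 * a)) (cst c%:E) t)%E).
  rewrite integral_cst_ico; last lra.
  rewrite lee_fin [2 * a - a](_ : _ = a); last by ring.
  by rewrite /c -mulrA mul_pow.
apply: ge0_le_integral => //.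
- exact: measurable_intg.
move=> t; rewrite /= in_itv /= => /andP[at1 at2]; rewrite lee_fin /c.
apply: ler_pM; rewrite ?sqrtr_ge0 ?powR_ge0 //.
  by rewrite ler_wsqrtr // tailf_mono // ltW.
by apply: powR_ge0_mono => //; [have := p_ge1; lra | lra].
Qed.

(** On [t/2, t) the integrand of I is at least sqrt(H(t)) (t/2)^(p-1). *)
Lemma sqrt_tail_le (t : R) : 0 < t ->
  ((t `^ p * Num.sqrt (Ht t))%:E <= th%:E * I2pp dist mu x0 p)%E.
Proof.
move=> t0; have h : 0 < t / 2 by lra.
have := dyadic_lower h; rewrite (_ : 2 * (t / 2) = t); last by field.
move=> h1; apply: (@le_trans _ _ (th%:E * (Num.sqrt (Ht t) * (t / 2) `^ p)%:E)%E).
  rewrite -EFinM lee_fin mulrCA -powRM //; last lra.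
  by rewrite (_ : 2 * (t / 2) = t) 1?mulrC //; field.
apply: lee_wpmul2l; first by rewrite lee_fin powR_ge0.
apply: (le_trans h1); rewrite I2ppE pos_itv; apply: ge0_subset_integral => //.
- exact: measurable_intg.
- by move=> u; rewrite /= !in_itv /= => /andP[]; lra.
Qed.

(** Annulus k+1 is compared with the integral over [radius k / 2, radius k), where the tail is at
    least H(radius k). These blocks are disjoint, and scale(k+1) = th^2 (radius k / 2)^p accounts
    for th^2. *)
Lemma sum_scale_sqrt_tail (rho0 : R) K : 0 < rho0 ->
  ((\sum_(k < K) scale p rho0 k.+1 * Num.sqrt (Ht (radius rho0 k)))%:E
     <= (th ^+ 2)%:E * I2pp dist mu x0 p)%E.
Proof.
move=> rho00.
suff : ((\sum_(k < K) scale p rho0 k.+1 * Num.sqrt (Ht (radius rho0 k)))%:E <=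
   (th ^+ 2)%:E * \int[lebesgue_measure]_(t in ico 0 (radius rho0 K / 2)) f t)%E.
  move=> h; apply: (le_trans h); apply: lee_wpmul2l; first by rewrite lee_fin sqr_ge0.
  rewrite I2ppE pos_itv; apply: ge0_subset_integral => //.
  - exact: measurable_intg.
  - by move=> u; rewrite /= !in_itv /= => /andP[->].
elim: K => [|K IH].
  rewrite big_ord0; apply: mule_ge0; first by rewrite lee_fin sqr_ge0.
  by apply: integral_ge0 => t _.
have rK := radius_gt0 rho00 K.
have r2 : radius rho0 K.+1 / 2 = radius rho0 K by rewrite /radius exprS; field.
rewrite big_ord_recr /= r2 EFinD.
have -> : ico 0 (radius rho0 K) =
   ico 0 (radius rho0 K / 2) `|` ico (radius rho0 K / 2) (radius rho0 K).
  apply/seteqP; split => t /=; rewrite !in_itv /=.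
    move=> /andP[t0 tK]; have [h|h] := ltP t (radius rho0 K / 2).
      by left; rewrite t0.
    by right.
  by case => /andP[h1 h2]; apply/andP; split; lra.
rewrite ge0_integral_setU //; last 2 first.
- by apply: measurable_intg; exact: measurableU.
- apply/disj_set2P; apply/seteqP; split => // t [/=]; rewrite !in_itv /= => /andP[_ h1] /andP[h2 _].
  by move: (lt_le_trans h1 h2); rewrite ltxx.
rewrite ge0_muleDr; [|by apply: integral_ge0 => t _|by apply: integral_ge0 => t _].
apply: leeD => //.
have h : 0 < radius rho0 K / 2 by lra.
have := dyadic_lower h; rewrite (_ : 2 * (radius rho0 K / 2) = radius rho0 K); last by field.
move=> h1.
apply: (@le_trans _ _ ((th ^+ 2)%:E * (Num.sqrt (Ht (radius rho0 K)) * (radius rho0 K / 2) `^ p)%:E)%E).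
  rewrite -EFinM lee_fin scaleS // /scale.
  have -> : radius rho0 K `^ p = th * (radius rho0 K / 2) `^ p.
    rewrite -powRM //; last lra.
    by congr (_ `^ _); field.
  by rewrite le_eqVlt; apply/orP; left; apply/eqP; ring.
by apply: lee_wpmul2l => //; rewrite lee_fin sqr_ge0.
Qed.

Section PowerTail.
Variables (r om : R).
Hypothesis om0 : 0 <= om.
Hypothesis weak : forall t, 0 < t -> t `^ (r * p) * Ht t <= om.

Lemma tail_le_power t : 0 < t -> Ht t <= om * (t `^ p) `^ (- r).
Proof.
move=> t0; rewrite -powRrM mulrN powRN ler_pdivlMr ?powR_gt0 // mulrC [p * r]mulrC.
exact: weak.
Qed.

(** Over the dyadic shells beyond M the contributions decrease geometrically with ratio th^(1-r). *)
Lemma tail_integral_le (M : R) : 1 < r -> 0 < M ->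
  (\int[mu]_(y in [set y | (M < dist x0 y)%R]) (dist x0 y `^ p)%:E
    <= (th * om * (M `^ p) `^ (1 - r) / (1 - th `^ (1 - r)))%:E)%E.
Proof.
move=> r1 M0.
have mdx D : measurable_fun D (fun y => (dist x0 y `^ p)%:E).
  apply: measurable_funTS; apply/measurable_EFinP.
  exact: (measurableT_comp (measurable_powR p) (measurable_dist dist_polish dist_borel x0)).
pose F j : set E := cball dist x0 (M * 2 ^+ j.+1) `\` cball dist x0 (M * 2 ^+ j).
have FE j y : F j y -> M * 2 ^+ j < dist x0 y /\ dist x0 y <= M * 2 ^+ j.+1.
  by rewrite /F /cball /= => -[h1 /negP]; rewrite -ltNge.
have mF j : measurable (F j) by apply: measurableD; exact: measurable_cball.
have mono (i j : nat) : (i <= j)%N -> M * 2 ^+ i <= M * 2 ^+ j.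
  by move=> ij; rewrite ler_wpM2l ?(ltW M0) // ler_weXn2l //; lra.
have tF : trivIset setT F.
  apply/trivIsetP => i j _ _ ij; apply/seteqP; split => // y [/FE[i1 i2] /FE[j1 j2]].
  move: ij; rewrite neq_ltn => /orP[ij|ij].
    by move: (le_lt_trans (le_trans i2 (mono _ _ ij)) j1); rewrite ltxx.
  by move: (le_lt_trans (le_trans j2 (mono _ _ ij)) i1); rewrite ltxx.
have cov : [set y | (M < dist x0 y)%R] = \bigcup_j F j.
  apply/seteqP; split => y /=; last first.
    move=> [j _ /FE[h _]]; apply: le_lt_trans h.
    by rewrite -{1}[M](mulr1) -(expr0 2) mono.
  move=> My.
  have ex : exists j, dist x0 y <= M * 2 ^+ j.
    have d0 : 0 <= dist x0 y / M by rewrite divr_ge0 ?(dist_ge0 dist_polish) // ltW.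
    exists (Num.bound (dist x0 y / M)); rewrite mulrC -ler_pdivrMr //.
    have := archi_boundP d0; move: (Num.bound _) => N hN; apply: (le_trans (ltW hN)).
    rewrite -natrX ler_nat; exact: ltnW (ltn_expl _ _).
  case: (ex_minnP ex) => -[|j] hj jmin.
    by move: hj; rewrite expr0 mulr1 leNgt My.
  exists j => //; split => // hj'; have := jmin j hj'; by rewrite ltnn.
have thr : th `^ (1 - r) < 1.
  by apply: le1_powR_lt1; [have := th_ge2 p_ge1; lra | lra].
rewrite cov; apply: geometric_integral_le => //.
- by rewrite !mulr_ge0 ?powR_ge0.
- by move=> y; rewrite lee_fin powR_ge0.
move=> j; have Mj : 0 < M * 2 ^+ j by rewrite mulr_gt0 ?exprn_gt0.
apply: (@le_trans _ _ (\int[mu]_(y in F j) (cst ((M * 2 ^+ j.+1) `^ p)%:E) y)%E).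
  apply: ge0_le_integral => //.
  - by move=> y _; rewrite lee_fin powR_ge0.
  - move=> y /FE[_ h]; rewrite lee_fin; apply: powR_ge0_mono => //; first exact: ltW.
    exact: (dist_ge0 dist_polish).
rewrite integral_cst //.
apply: (@le_trans _ _ (((M * 2 ^+ j.+1) `^ p)%:E * (Ht (M * 2 ^+ j))%:E)%E).
  apply: lee_wpmul2l; first by rewrite lee_fin powR_ge0.
  rewrite -tailfE; apply: le_measure; rewrite ?inE // => y []//.
rewrite -EFinM lee_fin.
apply: (le_trans (ler_wpM2l (powR_ge0 _ _) (tail_le_power Mj))).
have -> : (M * 2 ^+ j.+1) `^ p = th * (M * 2 ^+ j) `^ p.
  by rewrite exprS [M * _]mulrCA [LHS]powRM // ltW.
have A0 : 0 < (M * 2 ^+ j) `^ p by rewrite powR_gt0.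
have AE : (M * 2 ^+ j) `^ p = M `^ p * th ^+ j.
  by rewrite powRM ?expn_powR ?exprn_ge0 // ltW.
have key : (M * 2 ^+ j) `^ p * ((M * 2 ^+ j) `^ p) `^ (- r) =
    (M `^ p) `^ (1 - r) * (th `^ (1 - r)) ^+ j.
  rewrite mulr_powRN //.
  rewrite AE powRM ?powR_ge0 ?exprn_ge0 ?powR_ge0 //; congr (_ * _).
  by rewrite -powR_mulrn ?powR_ge0 // powRAC powR_mulrn // powR_ge0.
rewrite le_eqVlt; apply/orP; left; apply/eqP.
rewrite [LHS](_ : _ = th * om * ((M * 2 ^+ j) `^ p * ((M * 2 ^+ j) `^ p) `^ (- r))); last by ring.
by rewrite key; ring.
Qed.

Lemma dyadic_upper (a : R) : 0 < a ->
  (\int[lebesgue_measure]_(t in ico a (2 * a)) f t <=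
    (th * Num.sqrt om * (a `^ p) `^ (1 - r / 2))%:E)%E.
Proof.
move=> a0; set c := Num.sqrt (Ht a) * (2 * a) `^ (p - 1).
have a2 : 0 < 2 * a by rewrite mulr_gt0.
have c0 : 0 <= c by rewrite mulr_ge0 ?sqrtr_ge0 ?powR_ge0.
apply: (@le_trans _ _ (\int[lebesgue_measure]_(t in ico a (2 * a)) (cst c%:E) t)%E).
  apply: ge0_le_integral => //; first exact: measurable_intg.
  move=> t; rewrite /= in_itv /= => /andP[t1 t2]; rewrite lee_fin /c.
  apply: ler_pM; rewrite ?sqrtr_ge0 ?powR_ge0 //.
    by rewrite ler_wsqrtr // tailf_mono.
  apply: powR_ge0_mono; [by have := p_ge1; lra | | exact: ltW].
  exact: le_trans (ltW a0) t1.
rewrite integral_cst_ico; last lra.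
rewrite lee_fin [2 * a - a](_ : _ = a); last by ring.
have A0 : 0 < a `^ p by rewrite powR_gt0.
have hs : Num.sqrt (Ht a) <= Num.sqrt om * (a `^ p) `^ (- (r / 2)).
  have -> : (a `^ p) `^ (- (r / 2)) = Num.sqrt ((a `^ p) `^ (- r)).
    by rewrite -[RHS](powR12_sqrt (powR_ge0 _ _)) -[RHS]powRrM mulNr.
  by rewrite -sqrtrM // ler_wsqrtr // tail_le_power.
have hc : (2 * a) `^ (p - 1) * a <= th * a `^ p.
  have -> : th * a `^ p = (2 * a) `^ (p - 1) * (2 * a).
    by rewrite mul_pow // [RHS]powRM // ltW.
  by rewrite ler_wpM2l ?powR_ge0 //; lra.
have c1 : 0 <= (2 * a) `^ (p - 1) * a by rewrite mulr_ge0 ?powR_ge0 // ltW.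
rewrite /c -[leLHS]mulrA; apply: (le_trans (ler_pM (sqrtr_ge0 _) c1 hs hc)).
rewrite -mulr_powRN // le_eqVlt; apply/orP; left; apply/eqP; ring.
Qed.

(** The weak moment makes the blocks [2^j, 2^(j+1)) contribute geometrically with ratio th^(1-r/2);
    this is where r > 2 is used in (1). On [0, 1) the integrand is at most 1. *)
Lemma I2pp_fin : 2 < r -> (I2pp dist mu x0 p < +oo)%E.
Proof.
move=> r2; rewrite I2ppE.
pose F j : set R := `[2 ^+ j, 2 ^+ j.+1[%classic.
have FE j (t : R) : F j t <-> 2 ^+ j <= t /\ t < 2 ^+ j.+1.
  by rewrite /F /= in_itv /=; split => [/andP[]|[-> ->]].
have mono (i j : nat) : (i <= j)%N -> (2 ^+ i : R) <= 2 ^+ j.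
  by move=> ij; rewrite ler_weXn2l //; lra.
have tF : trivIset setT F.
  apply/trivIsetP => i j _ _ ij; apply/seteqP; split => // t [/FE[i1 i2] /FE[j1 j2]].
  move: ij; rewrite neq_ltn => /orP[ij|ij].
    by move: (lt_le_trans i2 (le_trans (mono _ _ ij) j1)); rewrite ltxx.
  by move: (lt_le_trans j2 (le_trans (mono _ _ ij) i1)); rewrite ltxx.
have cov : [set t : R | (0 <= t)%R] = ico 0 1 `|` \bigcup_j F j.
  apply/seteqP; split => t /=; last first.
    case; first by rewrite in_itv /= => /andP[].
    by move=> [j _ /FE[h _]]; apply: le_trans h; rewrite exprn_ge0.
  move=> t0; have [t1|t1] := ltP t 1; first by left; rewrite in_itv /= t0.
  right; have ex : exists j, t < 2 ^+ j.
    exists (Num.bound t); apply: (lt_trans (archi_boundP t0)).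
    by rewrite -natrX ltr_nat ltn_expl.
  case: (ex_minnP ex) => -[|j] hj jmin; first by move: hj; rewrite expr0 ltNge t1.
  exists j => //; apply/FE; split => //; rewrite leNgt; apply/negP => /jmin.
  by rewrite ltnn.
have mFj j : measurable (F j) by exact: measurable_itv.
have mU : measurable (\bigcup_j F j) by exact: bigcupT_measurable.
rewrite cov ge0_integral_setU //; last 2 first.
- by apply: measurable_intg; exact: measurableU.
- apply/disj_set2P; apply/seteqP; split => // t [/=]; rewrite in_itv /= => /andP[_ h1] [j _ /FE[h2 _]].
  have h3 : (1 : R) <= 2 ^+ j by rewrite exprn_ege1 //; lra.
  by move: (lt_le_trans h1 (le_trans h3 h2)); rewrite ltxx.
have thr : th `^ (1 - r / 2) < 1.
  by apply: le1_powR_lt1; [have := th_ge2 p_ge1; lra | lra].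
have hF j : (\int[lebesgue_measure]_(t in F j) f t <=
    (th * Num.sqrt om * (th `^ (1 - r / 2)) ^+ j)%:E)%E.
  have aj : 0 < (2 ^+ j : R) by rewrite exprn_gt0.
  rewrite /F exprS; apply: (le_trans (dyadic_upper aj)).
  by rewrite expn_powR -[in leLHS]powR_mulrn ?powR_ge0 // powRAC powR_mulrn ?powR_ge0.
apply: lte_add_pinfty.
  apply: (@le_lt_trans _ _ (\int[lebesgue_measure]_(t in ico 0 1) (cst 1%:E) t)%E).
    apply: ge0_le_integral => //; first exact: measurable_intg.
    move=> t; rewrite /= in_itv /= => /andP[t0 t1]; rewrite lee_fin.
    rewrite -[leRHS]mulr1; apply: ler_pM; rewrite ?sqrtr_ge0 ?powR_ge0 //.
      by rewrite -[leRHS]sqrtr1 ler_wsqrtr // tailf_le1.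
    have := @powR_ge0_mono R (p - 1) t 1; rewrite powR1; apply; try lra.
    by have := p_ge1; lra.
  by rewrite integral_cst_ico // ltry.
apply: (@le_lt_trans _ _ (th * Num.sqrt om / (1 - th `^ (1 - r / 2)))%:E); last exact: ltry.
apply: geometric_integral_le => //.
by apply: measurable_intg.
Qed.

End PowerTail.

Lemma weak_moment_le (s : R) t : (weak_moment dist mu x0 s < +oo)%E -> 0 <= t ->
  t `^ s * Ht t <= fine (weak_moment dist mu x0 s).
Proof.
move=> wfin t0.
have h : ((t `^ s * Ht t)%:E <= weak_moment dist mu x0 s)%E.
  by apply: ereal_sup_ubound; exists t => //; rewrite EFinM -tailfE.
by rewrite -lee_fin fineK // ge0_fin_numE // (le_trans _ h) // lee_fin mulr_ge0 ?powR_ge0 ?tailf_ge0.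
Qed.

End TailCalculus.

(** * Choice of the scales *)

(** The truncation radius is fixed by Mp and divided by 2 until the innermost ball, whose mass has
    no useful bound, has p-th power of radius below eps. *)
Lemma choose_scale (R : realType) (p Mp eps : R) : 1 <= p -> 0 < Mp -> 0 < eps ->
  exists rho0 K, [/\ 0 < rho0, scale p rho0 K = Mp & scale p rho0 0 <= eps].
Proof.
move=> p1 M0 e0; have pn0 : p != 0 by rewrite gt_eqF //; lra.
have th1 := th_ge2 p1.
pose K := Num.bound (Mp / eps).
have rho00 : 0 < Mp `^ p^-1 / 2 ^+ K by rewrite divr_gt0 ?powR_gt0 ?exprn_gt0.
exists (Mp `^ p^-1 / 2 ^+ K), K.
have h1 : scale p (Mp `^ p^-1 / 2 ^+ K) K = Mp.
  rewrite /scale /radius divfK ?expf_neq0 // -powRrM mulVf // powRr1 //; exact: ltW.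
split => //.
have hM : scale p (Mp `^ p^-1 / 2 ^+ K) 0 * (2 `^ p) ^+ K = Mp.
  by rewrite -[RHS]h1 !scaleE // expr0 mulr1.
have h2 : Mp / eps <= (2 `^ p) ^+ K.
  have d0 : 0 <= Mp / eps by rewrite divr_ge0 // ltW.
  apply: (le_trans (ltW (archi_boundP d0))); rewrite -/K.
  apply: (le_trans (y := 2 ^+ K)).
    by rewrite -natrX ler_nat ltnW // ltn_expl.
  by rewrite lerXn2r // nnegrE; lra.
rewrite ler_pdivrMr // in h2.
rewrite -(ler_pM2r (x := (2 `^ p) ^+ K)); last by rewrite exprn_gt0 //; lra.
by rewrite hM mulrC.
Qed.

(** l is the least integer above 2 Lam. As ln 2 >= 1/2, 2^l is at least e^Lam; minimality gives l +
    1 < 2 Lam + 2, at most 4 Lam because Lam >= 1. *)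
Lemma log_levels (R : realType) (Z : R) : 0 <= Z -> exists l : nat,
  Z <= 2 ^+ l /\ l.+1%:R <= 4 * ln (expR 1 + Z).
Proof.
move=> Z0; set Lam := ln (expR 1 + Z).
have e1 := expR_gt0 (1 : R).
have Lam1 : 1 <= Lam.
  by rewrite -[leLHS](expRK 1) ler_ln ?posrE //; lra.
have ex : exists l : nat, 2 * Lam <= l%:R.
  have d0 : 0 <= 2 * Lam by lra.
  by exists (Num.bound (2 * Lam)); exact: ltW (archi_boundP d0).
case: (ex_minnP ex) => l hl lmin; exists l; split.
  have ln2 : (1 / 2 : R) <= ln 2.
    have := @le_ln1Dx R (- (1 / 2)); rewrite (_ : 1 + - (1 / 2) = 2^-1); last by field.
    by rewrite lnV ?posrE // => /(_ ltac:(lra)); lra.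
  have -> : (2 ^+ l : R) = expR (l%:R * ln 2) by rewrite mulr_natl -lnXn // lnK // posrE exprn_gt0.
  apply: (le_trans (y := expR Lam)); first by rewrite lnK ?posrE; lra.
  by rewrite ler_expR; nra.
case: l hl lmin => [|l] hl lmin; first by rewrite mulr0n in hl; lra.
have : (l%:R : R) < 2 * Lam by rewrite ltNge; apply/negP => /lmin; rewrite ltnn.
by rewrite -!natr1; lra.
Qed.

Lemma sum_sqr_le_sqr_sum (R : realType) n (F : 'I_n -> R) : (forall i, 0 <= F i) ->
  \sum_i F i ^+ 2 <= (\sum_i F i) ^+ 2.
Proof.
move=> F0; rewrite expr2 mulr_sumr; apply: ler_sum => i _.
rewrite expr2 ler_wpM2r // (bigD1 i) //= lerDl; exact: sumr_ge0.
Qed.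

(** * Fuk-Nagaev bounds with the truncation radius adjusted to n and x *)

Section UpperRegime.
Context {R : realType} {dE : measure_display} {E : measurableType dE}.
Variables (dist : E -> E -> R) (x0 : E) (S : set E) (p beta : R).
Hypothesis dist_polish : polish dist.
Hypothesis dist_borel : borel_of_metric dist.
Hypothesis p_ge1 : 1 <= p.
Hypothesis beta0 : 0 < beta.
Hypothesis mS : measurable S.
Hypothesis cover : forall rr delta : R, 0 < rr -> 0 < delta -> delta <= 2 * rr ->
  (covering_number dist (S `&` cball dist x0 rr) delta
     <= (beta * (2 * rr / delta) `^ (2 * p))%:E)%E.
Variable mu : probability E R.
Hypothesis mu_S : mu S = 1%E.
Context {dO : measure_display} {Om : measurableType dO} {P : probability Om R}.
Variables (n : nat) (X : 'I_n -> Om -> E).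
Hypothesis n0 : (0 < n)%N.
Hypothesis iidX : iid_law P X mu.

Local Notation th := (2 `^ p).
Local Notation k16 := (16 `^ p).
Local Notation W := (fun om => Wpp dist p mu (empirical (fun i => X i om))).
Local Notation Ht := (tailf dist x0 mu).

Let nR : 0 < n%:R :> R. Proof. by rewrite ltr0n. Qed.
Let th2 : 2 <= th :> R. Proof. exact: th_ge2. Qed.
Let th0 : 0 < th :> R. Proof. exact: powR_gt0. Qed.
Let k0 : 0 < k16 :> R. Proof. exact: powR_gt0. Qed.

(* With no mass away from x0, Chebyshev's bound holds at arbitrarily small scale. *)
Lemma deviation_degenerate (x : R) : 0 < x -> (forall t, 0 < t -> Ht t = 0) ->
  (P [set om | (x%:E < W om)%E] <= 0)%E.
Proof.
move=> x_gt0 H0; apply/lee_addgt0Pr => eps eps0; rewrite add0e.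
set C1 := (k16 * Num.sqrt ((1 + 2 * beta) / n%:R)) ^+ 2 / (x / 2) ^+ 2.
have C10 : 0 <= C1 by rewrite divr_ge0 ?sqr_ge0.
(* The three terms give a deterministic cost of at most x/2, dl^2 <= dl, and a Chebyshev term of at
   most eps. *)
pose dl := Num.min (Num.min (x / (2 * k16)) 1) (eps / (C1 + 1)).
have dl0 : 0 < dl.
  rewrite !lt_min ltr01 !divr_gt0 ?mulr_gt0 //=; lra.
have [d1 d2 d3] : [/\ dl <= x / (2 * k16), dl <= 1 & dl <= eps / (C1 + 1)].
  by rewrite /dl !ge_min !lexx !orbT.
have pn0 : p != 0 by rewrite gt_eqF //; have := p_ge1; lra.
have rho00 : 0 < dl `^ p^-1 by rewrite powR_gt0.
have sc0 : scale p (dl `^ p^-1) 0 = dl.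
  rewrite /scale /radius expr0 mulr1 -powRrM mulVf // powRr1 //; exact: ltW.
have tau0 : (\int[mu]_(y in [set y | (radius (dl `^ p^-1) 0 < dist x0 y)%R])
    (dist x0 y `^ p)%:E <= 0%:E)%E.
  rewrite null_set_integral //.
  - exact: measurable_far.
  - apply: measurable_funTS; apply/measurable_EFinP.
    exact: (measurableT_comp (measurable_powR p) (measurable_dist dist_polish dist_borel x0)).
  - rewrite (_ : mkset _ = ~` cball dist x0 (radius (dl `^ p^-1) 0)).
      by rewrite [LHS](tailfE x0 dist_polish dist_borel) H0 // radius_gt0.
    by apply/seteqP; split => y /=; rewrite /cball /= ltNge => /negP.
have x2 : 0 < x / 2 by lra.
apply: (le_trans (deviation_chebyshev dist_polish dist_borel p_ge1 beta0 mS cover mu_S n0 iidX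
   (L := fun=> 0%N) rho00 tau0 x2 _)).
  rewrite /det_cost big_ord_recl big_ord0 /= expr0 divr1 mulr1 addr0 mulr0 addr0 sc0.
  have : k16 * dl <= x / 2 by rewrite mulrC -ler_pdivlMr // -mulrA -invfM.
  lra.
rewrite lee_fin /tail_prob -/(tailf dist x0 mu _) H0 ?radius_gt0 // mulr0 add0r.
rewrite /mean_cost big_ord_recl big_ord0 /= sqrtr1 mulr1 mul1r addr0 sc0 exprMn mulrAC -/C1.
apply: (le_trans (y := C1 * dl)).
  by rewrite ler_wpM2l // expr2 ler_piMl // ltW.
apply: (le_trans (y := (C1 + 1) * dl)); first by rewrite ler_wpM2r ?(ltW dl0) //; lra.
by rewrite mulrC -ler_pdivlMr //; lra.
Qed.

Let c16 (q : R) : 0 < q -> 0 < 16 * k16 * q.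
Proof. by move=> q0; apply: mulr_gt0 => //; apply: mulr_gt0. Qed.

(** V / a^2 = conc_const (I/x)^2 / n for V = 32 k16^2 th^4 I^2 / n and a = x/4. *)
Definition conc_const : R := 512 * k16 ^+ 2 * th ^+ 4.

Lemma conc_const_gt0 : 0 < conc_const.
Proof.
apply: mulr_gt0; last by rewrite exprn_gt0.
by apply: mulr_gt0; [rewrite ltr0n | rewrite exprn_gt0].
Qed.

(** The first term covers the case in which the far transport cost is not small, the second the
    probability of a point beyond the truncation, the third the concentration bound. *)
Definition FN_const (q r : R) : R := 8 * th ^+ 2 * (16 * k16 * q) `^ (r - 1) / (1 - th `^ (1 - r))
  + (16 * k16 * q) `^ r + expR (q ^+ 2) * conc_const `^ (q / 2).

Lemma FN_const_gt0 q r : 0 < q -> 1 < r -> 0 < FN_const q r.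
Proof.
move=> q0 r1; rewrite /FN_const.
have h1 : 0 <= 8 * th ^+ 2 * (16 * k16 * q) `^ (r - 1) / (1 - th `^ (1 - r)).
  rewrite divr_ge0 ?mulr_ge0 ?sqr_ge0 ?powR_ge0 // subr_ge0 ltW // le1_powR_lt1 //; last lra.
  by have := th2; lra.
have h2 : 0 <= (16 * k16 * q) `^ r by exact: powR_ge0.
have h3 : 0 < expR (q ^+ 2) * conc_const `^ (q / 2).
  by apply: mulr_gt0; [exact: expR_gt0 | apply: powR_gt0; exact: conc_const_gt0].
lra.
Qed.

Section Core.
Variables (q r om x : R).
Hypothesis q0 : 0 < q.
Hypothesis r1 : 1 < r.
Hypothesis om0 : 0 <= om.
Hypothesis x_gt0 : 0 < x.
Hypothesis weak : forall t, 0 < t -> t `^ (r * p) * Ht t <= om.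
Hypothesis Ifin : (I2pp dist mu x0 p < +oo)%E.

Let I := fine (I2pp dist mu x0 p).
Hypothesis I_gt0 : 0 < I.

Let v := om / (x `^ r * n%:R `^ (r - 1)).
Let u := I `^ q / (x `^ q * n%:R `^ (q / 2)).
(** The p-th power of the truncation radius, chosen so that 4 k16 Mp q / n is exactly a = x/4, the
    limit allowed by [Pr_fuk_nagaev]. *)
Let Mp := n%:R * x / (16 * k16 * q).
Let a := x / 4.
Let V := 32 * k16 ^+ 2 * th ^+ 4 * I ^+ 2 / n%:R.

Let Mp0 : 0 < Mp.
Proof. by apply: divr_gt0; [exact: mulr_gt0 | exact: c16]. Qed.

Lemma v_ge0 : 0 <= v. Proof. by rewrite divr_ge0 // mulr_ge0 ?powR_ge0. Qed.
Lemma u_ge0 : 0 <= u. Proof. by rewrite divr_ge0 ?powR_ge0 // mulr_ge0 ?powR_ge0. Qed.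

Let I2E : I2pp dist mu x0 p = I%:E.
Proof.
rewrite fineK // ge0_fin_numE //; apply: integral_ge0 => t _.
by rewrite lee_fin mulr_ge0 ?sqrtr_ge0 ?powR_ge0.
Qed.

Let om_v : om = v * (x `^ r * n%:R `^ (r - 1)).
Proof. by rewrite /v divfK // mulf_neq0 // gt_eqF // powR_gt0. Qed.

Lemma om_Mp : om * Mp `^ (1 - r) = v * x * (16 * k16 * q) `^ (r - 1).
Proof.
have c0 : 0 < 16 * k16 * q by exact: c16.
rewrite {1}om_v /Mp powRM ?mulr_ge0 ?invr_ge0 ?(ltW x_gt0) ?(ltW c0) //.
rewrite powRM ?(ltW x_gt0) //.
have -> : (16 * k16 * q)^-1 `^ (1 - r) = (16 * k16 * q) `^ (r - 1).
  by rewrite -powR_inv1 ?(ltW c0) // -powRrM; congr (_ `^ _); ring.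
have e1 : n%:R `^ (r - 1) * n%:R `^ (1 - r) = 1 :> R.
  by rewrite -[1 - r]opprB powRN divff // gt_eqF // powR_gt0.
have e2 : x `^ r * x `^ (1 - r) = x.
  rewrite -powRD; last by rewrite (gt_eqF x_gt0) implybT.
  by rewrite (_ : r + (1 - r) = 1) ?powRr1 ?(ltW x_gt0) //; ring.
set c := (16 * k16 * q) `^ (r - 1).
rewrite [LHS](_ : _ = v * (x `^ r * x `^ (1 - r)) * (n%:R `^ (r - 1) * n%:R `^ (1 - r)) * c).
  by rewrite e1 e2 mulr1.
by ring.
Qed.

Lemma om_Mp_r : n%:R * (om * Mp `^ (- r)) = v * (16 * k16 * q) `^ r.
Proof.
have c0 : 0 < 16 * k16 * q by exact: c16.
have e : Mp * Mp `^ (- r) = Mp `^ (1 - r) by exact: mulr_powRN.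
apply: (mulfI (x := Mp)); first by rewrite gt_eqF.
rewrite [LHS](_ : _ = n%:R * (om * (Mp * Mp `^ (- r)))); last by ring.
rewrite e om_Mp /Mp.
have -> : (16 * k16 * q) `^ r = (16 * k16 * q) * (16 * k16 * q) `^ (r - 1).
  by apply/esym/mulr_powRB1; [exact: ltW | exact: lt_trans ltr01 r1].
move: (16 * k16 * q) c0 => c c0; field; by rewrite (gt_eqF c0).
Qed.

Lemma V_u : (V / a ^+ 2) `^ (q / 2) = conc_const `^ (q / 2) * u.
Proof.
have -> : V / a ^+ 2 = conc_const * ((I / x) ^+ 2 / n%:R).
  by rewrite /V /a /conc_const; field; rewrite (gt_eqF x_gt0) (gt_eqF nR).
have Ix : 0 <= I / x by rewrite divr_ge0 // ltW.
rewrite powRM ?(ltW conc_const_gt0) //; last by rewrite divr_ge0 ?sqr_ge0 // ltW.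
congr (_ * _).
rewrite powRM ?sqr_ge0 ?invr_ge0 // -powR_mulrn // -powRrM.
have -> : 2 * (q / 2) = q by field.
rewrite /u powRM ?invr_ge0 ?(ltW x_gt0) ?(ltW I_gt0) //.
rewrite -(powR_inv1 (ltW x_gt0)) powRAC powR_inv1 ?powR_ge0 //.
rewrite -(powR_inv1 (ltW nR)) [n%:R `^ (-1) `^ _]powRAC [(_ `^ (q / 2)) `^ (-1)]powR_inv1 ?powR_ge0 //.
by rewrite -mulrA -invfM.
Qed.

Section Scales.
Variables (rho0 : R) (K : nat).
Hypothesis rho00 : 0 < rho0.
Hypothesis scK : scale p rho0 K = Mp.
Hypothesis sc0I : scale p rho0 0 <= I.
Local Notation sc := (scale p rho0).
Local Notation eta := (tail_annw dist x0 rho0 mu).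

Let sI : \sum_(k < K) sc k.+1 * Num.sqrt (Ht (radius rho0 k)) <= th ^+ 2 * I.
Proof.
by rewrite -lee_fin EFinM -I2E; apply: (sum_scale_sqrt_tail x0 dist_polish dist_borel p_ge1).
Qed.

Lemma sum_scale_sqrt : \sum_(k < K.+1) sc k * Num.sqrt (eta k) <= 2 * th ^+ 2 * I.
Proof.
rewrite big_ord_recl /= sqrtr1 mulr1.
have h : I <= th ^+ 2 * I.
  by rewrite ler_peMl ?(ltW I_gt0) // exprn_ege1 //; have := th2; lra.
have h2 : \sum_(i < K) sc (bump 0 i) * Num.sqrt (eta (bump 0 i)) <= th ^+ 2 * I.
  exact: sI.
have := sc0I; lra.
Qed.

(** The variance is bounded by I^2 because a sum of squares is at most the square of the sum,
    applied to scale times square root of the tail. *)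
Lemma sum_scale_sqr : 16 * k16 ^+ 2 * (\sum_(k < K.+1) sc k ^+ 2 * eta k) / n%:R <= V.
Proof.
have h : \sum_(k < K.+1) sc k ^+ 2 * eta k <= 2 * th ^+ 4 * I ^+ 2.
  rewrite big_ord_recl /= mulr1.
  have h1 : sc 0 ^+ 2 <= I ^+ 2 by rewrite ler_sqr ?nnegrE ?scale_ge0 ?(ltW I_gt0).
  have h2 : \sum_(i < K) sc (bump 0 i) ^+ 2 * eta (bump 0 i) <= (th ^+ 2 * I) ^+ 2.
    apply: (le_trans (y := (\sum_(k < K) sc k.+1 * Num.sqrt (Ht (radius rho0 k))) ^+ 2)).
      apply: le_trans (sum_sqr_le_sqr_sum _) => [|i]; last first.
        by rewrite mulr_ge0 ?scale_ge0 ?sqrtr_ge0.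
      apply: ler_sum => i _; rewrite exprMn sqr_sqrtr // tailf_ge0 //.
    rewrite ler_sqr ?nnegrE ?mulr_ge0 ?sqr_ge0 ?(ltW I_gt0) //.
    by apply: sumr_ge0 => i _; rewrite mulr_ge0 ?scale_ge0 ?sqrtr_ge0.
  have h3 : I ^+ 2 <= th ^+ 4 * I ^+ 2.
    by rewrite ler_peMl ?sqr_ge0 // exprn_ege1 //; have := th2; lra.
  have e : (th ^+ 2 * I) ^+ 2 = th ^+ 4 * I ^+ 2 by ring.
  by rewrite e in h2; lra.
rewrite /V ler_wpM2r ?invr_ge0 ?(ltW nR) //.
apply: (le_trans (ler_wpM2l _ h)); first by rewrite mulr_ge0 ?sqr_ge0.
by rewrite le_eqVlt; apply/orP; left; apply/eqP; ring.
Qed.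

Lemma tail_prob_le : tail_prob dist x0 mu n rho0 K <= (16 * k16 * q) `^ r * v.
Proof.
rewrite /tail_prob -/(tailf dist x0 mu _) [leRHS]mulrC -om_Mp_r ler_wpM2l ?ler0n //.
have := tail_le_power weak (radius_gt0 rho00 K).
by rewrite -/(scale p rho0 K) scK.
Qed.

Let tau := th * om * Mp `^ (1 - r) / (1 - th `^ (1 - r)).

Lemma tail_tauP : (\int[mu]_(y in [set y | (radius rho0 K < dist x0 y)%R])
   (dist x0 y `^ p)%:E <= tau%:E)%E.
Proof.
rewrite /tau -scK /scale.
exact: (tail_integral_le dist_polish dist_borel p_ge1 om0 weak r1 (radius_gt0 rho00 K)).
Qed.

(** If this fails, FN_const q r * v exceeds 1 and the bound is trivial. It keeps the transport from
    beyond the truncation below x/8. *)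
Hypothesis small : 8 * th ^+ 2 * (16 * k16 * q) `^ (r - 1) / (1 - th `^ (1 - r)) * v <= 1.

Lemma tau_le : th * tau <= x / 8.
Proof.
have e : th * tau = x / 8 * (8 * th ^+ 2 * (16 * k16 * q) `^ (r - 1) / (1 - th `^ (1 - r)) * v).
  rewrite /tau [th * om * _](_ : _ = th * (om * Mp `^ (1 - r))); last by ring.
  by rewrite om_Mp; set D := (1 - _)^-1; field.
by rewrite e ler_piMr // divr_ge0 // ltW.
Qed.

Lemma conc_le : tail_prob dist x0 mu n rho0 K + expR (q ^+ 2) * (V / a ^+ 2) `^ (q / 2)
  <= FN_const q r * (u + v).
Proof.
rewrite V_u; have h1 := tail_prob_le; rewrite /FN_const.
set c1 := _ / (1 - _); set c2 := (16 * k16 * q) `^ r in h1 *; set c3 := conc_const `^ _.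
have v0 := v_ge0; have u0 := u_ge0.
have c10 : 0 <= c1.
  rewrite divr_ge0 ?mulr_ge0 ?sqr_ge0 ?powR_ge0 // subr_ge0 ltW // le1_powR_lt1 //.
    by have := th2; lra.
  by have := r1; lra.
have c20 : 0 <= c2 by exact: powR_ge0.
have c30 : 0 <= expR (q ^+ 2) * c3 by rewrite mulr_ge0 ?expR_ge0 ?powR_ge0.
have m1 : 0 <= c1 * (u + v) by rewrite mulr_ge0 ?addr_ge0.
have m2 : 0 <= c2 * u by rewrite mulr_ge0.
have m3 : 0 <= expR (q ^+ 2) * c3 * v by rewrite mulr_ge0.
lra.
Qed.

Lemma scale_cond : 4 * k16 * sc K * q / n%:R <= a.
Proof.
rewrite scK /Mp /a le_eqVlt; apply/orP; left; apply/eqP.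
by field; rewrite !gt_eqF.
Qed.

Let V0 : 0 < V.
Proof.
apply: divr_gt0 => //; apply: mulr_gt0; last by rewrite exprn_gt0.
apply: mulr_gt0; last by rewrite exprn_gt0.
by apply: mulr_gt0; [rewrite ltr0n | rewrite exprn_gt0].
Qed.
Let a0 : 0 < a. Proof. by rewrite /a divr_gt0. Qed.

(** The same depth l is used in every annulus. Of x, at most x/8 goes to the finest cells, x/8 to
    the far mass, x/4 to the mean and x/4 to the deviation a. *)
Lemma deviation_levels (l : nat) : 16 * k16 * th ^+ 2 * I / x <= 2 ^+ l ->
  k16 * Num.sqrt ((1 + 2 * beta) / n%:R) * (l.+1%:R * (2 * th ^+ 2 * I)) <= x / 4 ->
  (P [set om | (x%:E < W om)%E] <= (FN_const q r * (u + v))%:E)%E.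
Proof.
move=> hl hm.
apply: (le_trans (deviation_fuk_nagaev dist_polish dist_borel p_ge1 beta0 mS cover mu_S n0 iidX
   (L := fun=> l) (m := x / 4) rho00 tail_tauP q0 a0 V0 _ _ sum_scale_sqr scale_cond)).
- rewrite /mean_cost; apply: le_trans hm; apply: ler_wpM2l.
    by rewrite mulr_ge0 ?powR_ge0 ?sqrtr_ge0.
  rewrite (eq_bigr (fun k : 'I_K.+1 => l.+1%:R * (sc k * Num.sqrt (eta k)))); last first.
    by move=> k _; rewrite mulrA.
  by rewrite -mulr_sumr ler_wpM2l ?ler0n // sum_scale_sqrt.
- rewrite /det_cost; have ht := tau_le.
  have hd : k16 * \sum_(k < K.+1) sc k / th ^+ l * eta k <= x / 8.
    apply: (le_trans (y := k16 * ((2 * th ^+ 2 * I) / th ^+ l))).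
      apply: ler_wpM2l; first exact: ltW.
      apply: (le_trans (y := \sum_(k < K.+1) (sc k * Num.sqrt (eta k)) / th ^+ l)); last first.
        by rewrite -mulr_suml ler_wpM2r ?sum_scale_sqrt // invr_ge0 exprn_ge0 // ltW.
      apply: ler_sum => k _; rewrite [leRHS]mulrAC ler_wpM2l ?divr_ge0 ?scale_ge0 ?exprn_ge0 ?(ltW th0) //.
      (* Tails are at most 1, hence at most their square roots, so the cost of the finest cells is
         bounded by I as well. *)
      have e0 : 0 <= eta k by case: (k : nat) => [|j] //=; exact: tailf_ge0.
      have e1 : eta k <= 1 by case: (k : nat) => [|j] //=; exact: tailf_le1.
      have s1 : Num.sqrt (eta k) <= 1 by rewrite -[leRHS]sqrtr1 ler_wsqrtr.
      by rewrite -{1}(sqr_sqrtr e0) expr2 ler_piMl ?sqrtr_ge0.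
    have hl' : 16 * k16 * th ^+ 2 * I / x <= th ^+ l.
      by apply: (le_trans hl); rewrite lerXn2r // nnegrE; have := th2; lra.
    rewrite ler_pdivrMr // in hl'.
    rewrite mulrA ler_pdivrMr ?exprn_gt0 //; lra.
  by rewrite /a; have := x_gt0; lra.
- by rewrite lee_fin conc_le.
Qed.

(** The constant 40 is 8 times the 5 of [deviation_fuk_nagaev_moment]: the innermost scale and the
    moment term each use at most x/8. *)
Lemma deviation_moment (M : R) : (pmoment dist mu x0 p <= M%:E)%E ->
  40 * k16 * th * M <= x -> scale p rho0 0 <= x / (40 * k16) ->
  (P [set om | (x%:E < W om)%E] <= (FN_const q r * (u + v))%:E)%E.
Proof.
move=> hM hx hs.
apply: (le_trans (deviation_fuk_nagaev_moment dist_polish dist_borel p_ge1 beta0 mS cover mu_S n0 iidX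
   (L := fun=> 0%N) rho00 tail_tauP q0 a0 V0 _ hM _ sum_scale_sqr scale_cond)) => //.
- have ht := tau_le; rewrite ler_pdivlMr ?mulr_gt0 // in hs.
  by rewrite /a mulrDr; have := x_gt0; lra.
- by rewrite lee_fin conc_le.
Qed.

End Scales.
End Core.
End UpperRegime.

(** * Final constants and case distinctions *)

Lemma arith_geometric_le (R : realType) (z : R) m : 0 <= z -> z < 1 ->
  \sum_(j < m) j.+1%:R * z ^+ j <= ((1 - z) ^+ 2)^-1.
Proof.
move=> z0 z1; have h : 0 < 1 - z by rewrite subr_gt0.
have h2 : 0 < (1 - z) ^+ 2 by rewrite exprn_gt0.
suff -> : \sum_(j < m) j.+1%:R * z ^+ j =
    (1 - (m.+1%:R * z ^+ m - m%:R * (z * z ^+ m))) / (1 - z) ^+ 2.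
  rewrite -[leRHS]mul1r ler_wpM2r ?invr_ge0 ?(ltW h2) // gerBl.
  have e0 : 0 <= z ^+ m by exact: exprn_ge0.
  have m0 : 0 <= m%:R :> R by exact: ler0n.
  have : m%:R * (z * z ^+ m) <= m%:R * z ^+ m.
    by rewrite ler_wpM2l // ler_piMl // ltW.
  by rewrite -natr1 mulrDl mul1r; lra.
elim: m => [|m IH].
  by rewrite big_ord0 expr0 mulr1 mul0r subr0 subrr mul0r.
rewrite big_ord_recr /= IH [z ^+ m.+1]exprS -!natr1; field; by rewrite gt_eqF.
Qed.

(** Annuli are counted inwards from the outermost one, where the terms are largest; annulus 0 stays
    apart because its mass has no tail bound. *)
Lemma sum_rev_le (R : realType) (F b : nat -> R) K :
  (forall i, (i < K)%N -> F (K - i)%N <= b i) ->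
  \sum_(k < K.+1) F k <= F 0%N + \sum_(i < K) b i.
Proof.
move=> h; rewrite big_ord_recl lerD2l (reindex_inj rev_ord_inj).
apply: ler_sum => i _; rewrite lift0 /= subnSK //; exact: h.
Qed.

Section Assembly.
Context {R : realType} {dE : measure_display} {E : measurableType dE}.
Variables (dist : E -> E -> R) (x0 : E) (S : set E) (p beta : R).
Hypothesis dist_polish : polish dist.
Hypothesis dist_borel : borel_of_metric dist.
Hypothesis p_ge1 : 1 <= p.
Hypothesis beta0 : 0 < beta.
Hypothesis mS : measurable S.
Hypothesis cover : forall rr delta : R, 0 < rr -> 0 < delta -> delta <= 2 * rr ->
  (covering_number dist (S `&` cball dist x0 rr) delta
     <= (beta * (2 * rr / delta) `^ (2 * p))%:E)%E.
Variable mu : probability E R.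
Hypothesis mu_S : mu S = 1%E.
Context {dO : measure_display} {Om : measurableType dO} {P : probability Om R}.
Variables (n : nat) (X : 'I_n -> Om -> E).
Hypothesis n0 : (0 < n)%N.
Hypothesis iidX : iid_law P X mu.

Local Notation th := (2 `^ p).
Local Notation k16 := (16 `^ p).
Local Notation W := (fun om => Wpp dist p mu (empirical (fun i => X i om))).
Local Notation Ht := (tailf dist x0 mu).

Let nR : 0 < n%:R :> R. Proof. by rewrite ltr0n. Qed.
Let th2 : 2 <= th :> R. Proof. exact: th_ge2. Qed.
Let th0 : 0 < th :> R. Proof. exact: powR_gt0. Qed.
Let k0 : 0 < k16 :> R. Proof. exact: powR_gt0. Qed.
Let b0 : 0 < 1 + 2 * beta. Proof. by have := beta0; lra. Qed.

(** The 2 matches the prefactor e^2: an exponent of at most 2 makes the bound trivial, while an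
    exponent above 2 is the inequality that puts the mean below x/4. The other factors are those of
    the mean with at most 4 Lam levels. *)
Definition rate_const : R := 2 / ((32 * k16 * th ^+ 2) ^+ 2 * (1 + 2 * beta)).
Definition log_const : R := 16 * k16 * th ^+ 2.
Definition moment_const : R := 40 * k16 * th.

Lemma rate_const_gt0 : 0 < rate_const.
Proof.
by apply: divr_gt0 => //; apply: mulr_gt0 => //; rewrite exprn_gt0.
Qed.

Lemma log_const_gt0 : 0 < log_const.
Proof. by apply: mulr_gt0; [apply: mulr_gt0 => //; rewrite ltr0n | rewrite exprn_gt0]. Qed.

Lemma moment_const_gt0 : 0 < moment_const.
Proof. by apply: mulr_gt0 => //; apply: mulr_gt0 => //; rewrite ltr0n. Qed.

Lemma deviation_le1 (x : R) : (P [set om | (x%:E < W om)%E] <= 1%:E)%E.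
Proof.
apply: probability_le1; apply: measurable_Wpp_gt => //.
by case: iidX.
Qed.

Section Large.
Variables (q r om x : R).
Hypothesis q0 : 0 < q.
Hypothesis r1 : 1 < r.
Hypothesis om0 : 0 <= om.
Hypothesis x_gt0 : 0 < x.
Hypothesis weak : forall t, 0 < t -> t `^ (r * p) * Ht t <= om.
Hypothesis Ifin : (I2pp dist mu x0 p < +oo)%E.
Let I := fine (I2pp dist mu x0 p).
Let v := om / (x `^ r * n%:R `^ (r - 1)).
Let u := I `^ q / (x `^ q * n%:R `^ (q / 2)).
Let Lam := ln (expR 1 + log_const * I / x).
Let ind : R := if (x%:E <= moment_const%:E * pmoment dist mu x0 p)%E then 1 else 0.

Let I2E : I2pp dist mu x0 p = I%:E.
Proof.
rewrite fineK // ge0_fin_numE //; apply: integral_ge0 => t _.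
by rewrite lee_fin mulr_ge0 ?sqrtr_ge0 ?powR_ge0.
Qed.

Lemma I_ge0 : 0 <= I.
Proof.
by apply: fine_ge0; apply: integral_ge0 => t _; rewrite lee_fin mulr_ge0 ?sqrtr_ge0 ?powR_ge0.
Qed.

Lemma tailf_eq0 t : I = 0 -> 0 < t -> Ht t = 0.
Proof.
move=> I0 t0; have := sqrt_tail_le x0 dist_polish dist_borel p_ge1 mu t0.
rewrite I2E I0 mule0 lee_fin => h.
have tp : 0 < t `^ p by exact: powR_gt0.
have : Num.sqrt (Ht t) <= 0 by rewrite -(pmulr_rle0 _ tp).
have H0 : 0 <= Ht t by apply: tailf_ge0.
by rewrite le_eqVlt ltNge sqrtr_ge0 orbF sqrtr_eq0 => h1; apply/eqP; rewrite eq_le h1.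
Qed.

(** Squaring the claim with l + 1 replaced by 4 Lam gives G (I Lam)^2 <= n x^2, where rate_const =
    2/G; this is the hypothesis on the exponent. *)
Lemma mean_regime (l : nat) : 0 < I -> l.+1%:R <= 4 * Lam ->
  2 < n%:R * rate_const * (x / (I * Lam)) ^+ 2 ->
  k16 * Num.sqrt ((1 + 2 * beta) / n%:R) * (l.+1%:R * (2 * th ^+ 2 * I)) <= x / 4.
Proof.
move=> I0 hl hr.
have Lam0 : 0 < Lam.
  have : 0 < l.+1%:R :> R by rewrite ltr0n.
  by lra.
set G := (32 * k16 * th ^+ 2) ^+ 2 * (1 + 2 * beta).
have G0 : 0 < G.
  by apply: mulr_gt0 => //; rewrite exprn_gt0.
have IL : 0 < I * Lam by exact: mulr_gt0.
have hG : G * (I * Lam) ^+ 2 <= n%:R * x ^+ 2.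
  move: hr; rewrite /rate_const -/G.
  have -> : n%:R * (2 / G) * (x / (I * Lam)) ^+ 2 =
     2 * ((n%:R * x ^+ 2) / (G * (I * Lam) ^+ 2)).
    by field; rewrite (gt_eqF G0) (gt_eqF I0) (gt_eqF Lam0).
  have gi : 0 < G * (I * Lam) ^+ 2 by apply: mulr_gt0 => //; rewrite exprn_gt0.
  move=> hr; have : 1 < n%:R * x ^+ 2 / (G * (I * Lam) ^+ 2) by lra.
  by rewrite ltr_pdivlMr // mul1r => /ltW.
set Y := k16 * Num.sqrt ((1 + 2 * beta) / n%:R) * (4 * Lam * (2 * th ^+ 2 * I)).
have s0 : 0 <= k16 * Num.sqrt ((1 + 2 * beta) / n%:R).
  by apply: mulr_ge0; [exact: ltW | exact: sqrtr_ge0].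
have t0 : 0 <= 2 * th ^+ 2 * I.
  by apply: mulr_ge0; [apply: mulr_ge0 => //; exact: sqr_ge0 | exact: ltW].
apply: (le_trans (y := Y)); first by apply: ler_wpM2l => //; apply: ler_wpM2r.
have Y0 : 0 <= Y by apply: mulr_ge0 => //; apply: mulr_ge0 => //; lra.
have x4 : 0 <= x / 4 by have := x_gt0; lra.
rewrite -ler_sqr ?nnegrE //.
have -> : Y ^+ 2 = G * (I * Lam) ^+ 2 / (16 * n%:R).
  have -> : Y ^+ 2 = Num.sqrt ((1 + 2 * beta) / n%:R) ^+ 2 *
     (k16 * (4 * Lam * (2 * th ^+ 2 * I))) ^+ 2 by rewrite /Y; ring.
  rewrite sqr_sqrtr; last by apply: divr_ge0; apply: ltW.
  by rewrite /G; field; rewrite (gt_eqF nR).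
rewrite ler_pdivrMr; last by apply: mulr_gt0.
apply: (le_trans hG); rewrite le_eqVlt; apply/orP; left; apply/eqP.
by field.
Qed.

(** [om] is any bound on t^(rp) H(t) and only r > 1 is assumed, so that the lemma serves (1) with
    the weak moment and (2) with a multiple of I^2. *)
Lemma deviation_large : (P [set om | (x%:E < W om)%E] <=
  (expR 2 * expR (- (n%:R * rate_const * (x / (I * Lam)) ^+ 2)) * ind
    + FN_const p q r * (u + v))%:E)%E.
Proof.
have v0 : 0 <= v by apply: v_ge0.
have u0 : 0 <= u by apply: u_ge0.
have F0 := FN_const_gt0 p_ge1 q0 r1.
have ind0 : 0 <= ind by rewrite /ind; case: ifP.
have e0 : 0 <= expR 2 * expR (- (n%:R * rate_const * (x / (I * Lam)) ^+ 2)) * ind.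
  by apply: mulr_ge0 => //; apply: mulr_ge0; exact: expR_ge0.
have FF0 : 0 <= FN_const p q r * (u + v).
  by apply: mulr_ge0; [exact: ltW | exact: addr_ge0].
have triv : 1 <= expR 2 * expR (- (n%:R * rate_const * (x / (I * Lam)) ^+ 2)) * ind
    + FN_const p q r * (u + v) ->
  (P [set om | (x%:E < W om)%E] <=
  (expR 2 * expR (- (n%:R * rate_const * (x / (I * Lam)) ^+ 2)) * ind
    + FN_const p q r * (u + v))%:E)%E.
  by move=> h; apply: (le_trans (deviation_le1 x)); rewrite lee_fin.
have fin : (P [set om | (x%:E < W om)%E] <= (FN_const p q r * (u + v))%:E)%E ->
  (P [set om | (x%:E < W om)%E] <=
  (expR 2 * expR (- (n%:R * rate_const * (x / (I * Lam)) ^+ 2)) * ind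
    + FN_const p q r * (u + v))%:E)%E.
  by move=> h; apply: (le_trans h); rewrite lee_fin lerDr.
have [I0|In0] := eqVneq I 0.
  apply: (@le_trans _ _ 0%E); last by rewrite lee_fin addr_ge0.
  apply: (deviation_degenerate dist_polish dist_borel p_ge1 beta0 mS cover mu_S n0 iidX x_gt0).
  by move=> t t0; exact: tailf_eq0.
have I_gt0 : 0 < I by rewrite lt0r In0 I_ge0.
set c1 := 8 * th ^+ 2 * (16 * k16 * q) `^ (r - 1) / (1 - th `^ (1 - r)).
have c1F : c1 <= FN_const p q r.
  rewrite /FN_const -/c1 -addrA lerDl addr_ge0 ?powR_ge0 //.
  by apply: mulr_ge0; [exact: expR_ge0 | exact: powR_ge0].
(* The first summand of [FN_const] is c1, so c1 v > 1 makes the right-hand side exceed 1. *)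
have [small|big] := leP (c1 * v) 1; last first.
  apply: triv; apply: (le_trans (ltW big)).
  apply: (le_trans (y := FN_const p q r * (u + v))); last by rewrite lerDr.
  apply: (le_trans (ler_wpM2r v0 c1F)); apply: ler_wpM2l; first exact: ltW.
  by rewrite lerDr.
have Mp0 : 0 < n%:R * x / (16 * k16 * q).
  apply: divr_gt0; first exact: mulr_gt0.
  by apply: mulr_gt0 => //; apply: mulr_gt0 => //; rewrite ltr0n.
have c40 : 0 < 40 * k16 by apply: mulr_gt0 => //; rewrite ltr0n.
have eps0 : 0 < Num.min I (x / (40 * k16)).
  by rewrite lt_min I_gt0 /=; exact: divr_gt0.
have [rho0 [K [rho00 scK sc0]]] := choose_scale p_ge1 Mp0 eps0.
move: sc0; rewrite le_min => /andP[sc0I sc0x].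
have [hind|hind] := boolP (x%:E <= moment_const%:E * pmoment dist mu x0 p)%E.
  have [hr|hr] := leP (n%:R * rate_const * (x / (I * Lam)) ^+ 2) 2.
    apply: triv; rewrite /ind hind mulr1 -expRD.
    apply: (le_trans (y := expR (2 - n%:R * rate_const * (x / (I * Lam)) ^+ 2))).
      by rewrite -[leLHS]expR0 ler_expR subr_ge0.
    by rewrite lerDl.
  apply: fin.
  have Z0 : 0 <= log_const * I / x.
    by apply: divr_ge0; [apply: mulr_ge0; apply: ltW => //; exact: log_const_gt0 | exact: ltW].
  have [l [hl1 hl2]] := log_levels Z0.
  apply: (deviation_levels dist_polish dist_borel p_ge1 beta0 mS cover mu_S n0 iidX q0 r1 om0 x_gt0
    weak Ifin I_gt0 rho00 scK sc0I small hl1).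
  exact: mean_regime.
apply: fin.
have mom0 : (0 <= pmoment dist mu x0 p)%E.
  by apply: integral_ge0 => y _; rewrite lee_fin powR_ge0.
have mc := moment_const_gt0.
(* An infinite moment would have put x in the range of the indicator. *)
have momfin : pmoment dist mu x0 p \is a fin_num.
  rewrite ge0_fin_numE // ltNge leye_eq; apply: contra hind => /eqP ->.
  by rewrite gt0_muley ?lte_fin // leey.
have hM : (pmoment dist mu x0 p <= (fine (pmoment dist mu x0 p))%:E)%E by rewrite fineK.
apply: (deviation_moment dist_polish dist_borel p_ge1 beta0 mS cover mu_S n0 iidX q0 r1 om0 x_gt0
    weak Ifin I_gt0 rho00 scK sc0I small hM) => //.
move: hind; rewrite -ltNge -(fineK momfin) -EFinM lte_fin => /ltW.
by rewrite /moment_const.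
Qed.

End Large.

Section Small.
Variables (r om x : R).
Hypothesis r1 : 1 < r.
Hypothesis r2 : r < 2.
Hypothesis om0 : 0 <= om.
Hypothesis x_gt0 : 0 < x.
Hypothesis weak : forall t, 0 < t -> t `^ (r * p) * Ht t <= om.
Let v := om / (x `^ r * n%:R `^ (r - 1)).
(** Counting i inwards from the truncation, the scale decreases like th^(-i) while the tail grows at
    most like s^(2i). The mean terms are then (i+1) z^i and the deterministic terms z^(2i), and z <
    1 is the condition r < 2. *)
Let s := Num.sqrt (th `^ r).
Let z := s / th.
Let Gam := 1 + s / (1 - z) ^+ 2.

(** The terms are, in order: a point beyond the truncation, Chebyshev's bound, and the two
    thresholds below which the finest cells and the far mass cost at most x/8 each. *)
Definition small_const : R := 1 + 4 * k16 ^+ 2 * (1 + 2 * beta) * Gam ^+ 2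
  + 8 * k16 * s ^+ 2 / (1 - z ^+ 2) + 8 * th ^+ 2 / (1 - th `^ (1 - r)).

Let s0 : 0 < s. Proof. by rewrite sqrtr_gt0 powR_gt0. Qed.
Let s2 : s ^+ 2 = th `^ r. Proof. by rewrite sqr_sqrtr ?powR_ge0. Qed.
Let z0 : 0 < z. Proof. exact: divr_gt0. Qed.
Let z1 : z < 1.
Proof.
rewrite ltr_pdivrMr // mul1r -ltr_sqr ?nnegrE ?(ltW s0) ?(ltW th0) // s2.
have -> : th `^ r = th ^+ 2 * th `^ (r - 2).
  rewrite -[th ^+ 2]powR_mulrn ?(ltW th0) // -powRD; last by rewrite (gt_eqF th0) implybT.
  by congr (_ `^ _); ring.
rewrite gtr_pMr ?exprn_gt0 //; apply: le1_powR_lt1; first by have := th2; lra.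
by have := r2; lra.
Qed.
Let zz : 0 < 1 - z ^+ 2. Proof. by rewrite subr_gt0 exprn_ilt1 // ltW. Qed.
Let thr : 0 < 1 - th `^ (1 - r).
Proof. by rewrite subr_gt0; apply: le1_powR_lt1; [have := th2; lra | have := r1; lra]. Qed.
Let g0 : 0 <= 4 * k16 ^+ 2 * (1 + 2 * beta) * Gam ^+ 2.
Proof.
apply: mulr_ge0; last exact: sqr_ge0.
by apply: mulr_ge0; [apply: mulr_ge0 => //; exact: sqr_ge0 | exact: ltW].
Qed.
Let g1 : 0 <= 8 * k16 * s ^+ 2 / (1 - z ^+ 2).
Proof.
apply: divr_ge0; last exact: ltW.
by apply: mulr_ge0; [apply: mulr_ge0 => //; exact: ltW | exact: sqr_ge0].
Qed.
Let g2 : 0 <= 8 * th ^+ 2 / (1 - th `^ (1 - r)).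
Proof. by apply: divr_ge0; [apply: mulr_ge0 => //; exact: sqr_ge0 | exact: ltW]. Qed.

Lemma small_const_gt0 : 0 < small_const.
Proof. by rewrite /small_const; have := g0; have := g1; have := g2; lra. Qed.

Lemma deviation_small :
  (P [set om | (x%:E < W om)%E] <= (small_const * v)%:E)%E.
Proof.
have v0 : 0 <= v by apply: v_ge0.
have C0 := small_const_gt0.
have [om_0|omn0] := eqVneq om 0.
  have -> : v = 0 by rewrite /v om_0 mul0r.
  rewrite mulr0.
  apply: (deviation_degenerate dist_polish dist_borel p_ge1 beta0 mS cover mu_S n0 iidX x_gt0).
  move=> t t0; have H0 : 0 <= Ht t by apply: tailf_ge0.
  have := weak t0; rewrite om_0 pmulr_rle0 ?powR_gt0 // => h.
  by apply/eqP; rewrite eq_le h H0.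
have om_gt0 : 0 < om by rewrite lt0r omn0.
have v_gt0 : 0 < v by apply: divr_gt0 => //; apply: mulr_gt0; exact: powR_gt0.
have [big|small] := leP 1 (small_const * v).
  by apply: (le_trans (deviation_le1 x)); rewrite lee_fin.
have small1 : 8 * k16 * s ^+ 2 / (1 - z ^+ 2) * v <= 1.
  apply: le_trans (ltW small); apply: ler_wpM2r => //.
  by rewrite /small_const; have := g0; have := g1; have := g2; lra.
have small2 : 8 * th ^+ 2 / (1 - th `^ (1 - r)) * v <= 1.
  apply: le_trans (ltW small); apply: ler_wpM2r => //.
  by rewrite /small_const; have := g0; have := g1; have := g2; lra.
pose Mp := n%:R * x.
have Mp0 : 0 < Mp by exact: mulr_gt0.
have k16n : 16 * k16 != 0 by apply: mulf_neq0; rewrite ?gt_eqF // ltr0n.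
(* For q = 1/(16 k16) the factor 16 k16 q is 1, so [om_Mp] and [om_Mp_r] apply to Mp = n x. *)
have q_gt0 : 0 < (16 * k16)^-1.
  by rewrite invr_gt0; apply: mulr_gt0 => //; rewrite ltr0n.
have oM1 : om * Mp `^ (1 - r) = v * x.
  have := om_Mp p n0 r om q_gt0 x_gt0; rewrite mulfV // powR1 mulr1 divr1.
  exact.
have oM2 : n%:R * (om * Mp `^ (- r)) = v.
  have := om_Mp_r p n0 om q_gt0 r1 x_gt0; rewrite mulfV // powR1 mulr1 divr1.
  exact.
have sv : 0 < Num.sqrt (v / n%:R) by rewrite sqrtr_gt0; exact: divr_gt0.
(* The first bound makes the innermost ball cost at most x/8, the second makes its share of the mean
   comparable with that of the outermost annulus. *)
have eps0 : 0 < Num.min (x / (8 * k16)) (Mp * Num.sqrt (v / n%:R)).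
  rewrite lt_min; apply/andP; split; last exact: mulr_gt0.
  by apply: divr_gt0 => //; apply: mulr_gt0.
have [rho0 [K [rho00 scK sc0]]] := choose_scale p_ge1 Mp0 eps0.
move: sc0; rewrite le_min => /andP[sc0x sc0v].
(* The innermost ball gets depth 0 and not K: its mass has no tail bound to compensate for a factor
   K + 1. *)
pose L k := if k is 0 then 0%N else (K - k)%N.
pose tau := th * om * Mp `^ (1 - r) / (1 - th `^ (1 - r)).
have tauP : (\int[mu]_(y in [set y | (radius rho0 K < dist x0 y)%R])
   (dist x0 y `^ p)%:E <= tau%:E)%E.
  rewrite /tau -scK /scale.
  exact: (tail_integral_le dist_polish dist_borel p_ge1 om0 weak r1 (radius_gt0 rho00 K)).
have tau_le : th * tau <= x / 8.
  have -> : th * tau = x / 8 * (8 * th ^+ 2 / (1 - th `^ (1 - r)) * v).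
    rewrite /tau [th * om * _](_ : _ = th * (om * Mp `^ (1 - r))); last by ring.
    by rewrite oM1; move: (1 - th `^ (1 - r))^-1 => D; field.
  by rewrite ler_piMr // divr_ge0 // ltW.
have scE i : (i <= K)%N -> scale p rho0 (K - i) = Mp / th ^+ i.
  by move=> iK; rewrite -scK !scaleE // -{2}(subnK iK) exprD mulrA mulfK.
have etaE i : (i < K)%N ->
    tail_annw dist x0 rho0 mu (K - i) <= v / n%:R * (s ^+ 2) ^+ i.+1.
  move=> iK; rewrite -(subnSK iK) /= -/(tailf dist x0 mu _).
  have := tail_le_power weak (radius_gt0 rho00 (K - i.+1)).
  rewrite -/(scale p rho0 _) scE // => h; apply: (le_trans h).
  have ti : 0 < th ^+ i.+1 by rewrite exprn_gt0.
  rewrite powRM ?(ltW Mp0) ?invr_ge0 ?(ltW ti) //.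
  have -> : (th ^+ i.+1)^-1 `^ (- r) = (s ^+ 2) ^+ i.+1.
    rewrite -(powR_inv1 (ltW ti)) -powRrM mulN1r opprK s2.
    by rewrite -[th ^+ i.+1](powR_mulrn _ (ltW th0)) powRAC powR_mulrn // powR_ge0.
  rewrite mulrA le_eqVlt; apply/orP; left; apply/eqP; congr (_ * _).
  by rewrite -oM2; field; rewrite (gt_eqF nR).
have LE i : (i < K)%N -> L (K - i)%N = i.
  by move=> iK; rewrite -(subnSK iK) /= (subnSK iK) subKn // ltnW.
have x2 : 0 < x / 2 by rewrite divr_gt0.
apply: (le_trans (deviation_chebyshev dist_polish dist_borel p_ge1 beta0 mS cover mu_S n0 iidX
   (L := L) rho00 tauP x2 _)).
- rewrite /det_cost.
  set Sd := \sum_(k < K.+1) _.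
  have hd : Sd <= scale p rho0 0 + x * v * s ^+ 2 / (1 - z ^+ 2).
    apply: (le_trans (sum_rev_le (F := fun k => scale p rho0 k / th ^+ L k *
      tail_annw dist x0 rho0 mu k) (b := fun i => x * v * s ^+ 2 * (z ^+ 2) ^+ i) _)).
      move=> i iK; rewrite LE // scE; last exact: ltnW.
      have ti : 0 < th ^+ i by rewrite exprn_gt0.
      apply: (le_trans (ler_wpM2l _ (etaE i iK))).
        by apply: divr_ge0; [apply: divr_ge0|]; exact: ltW.
      rewrite le_eqVlt; apply/orP; left; apply/eqP.
      rewrite /z /Mp exprS -!exprM exprMn exprVn [(2 * i)%N]mulnC !exprM.
      by field; rewrite (gt_eqF nR) (gt_eqF ti).
    apply: lerD; first by rewrite expr0 divr1 mulr1.
    rewrite -mulr_sumr; apply: ler_wpM2l.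
      by apply: mulr_ge0; [apply: mulr_ge0 => //; exact: ltW | exact: sqr_ge0].
    by apply: geometric_le; [exact: sqr_ge0 | rewrite -subr_gt0].
  have hd2 := ler_wpM2l (ltW k0) hd.
  have hd3 : k16 * (x * v * s ^+ 2 / (1 - z ^+ 2)) <= x / 8.
    have -> : k16 * (x * v * s ^+ 2 / (1 - z ^+ 2)) =
       x / 8 * (8 * k16 * s ^+ 2 / (1 - z ^+ 2) * v) by field; rewrite (gt_eqF zz).
    by rewrite ler_piMr // divr_ge0 // ltW.
  rewrite ler_pdivlMr in sc0x; last by apply: mulr_gt0.
  have := x_gt0; lra.
rewrite lee_fin.
have tp : tail_prob dist x0 mu n rho0 K <= v.
  rewrite /tail_prob -/(tailf dist x0 mu _) -[leRHS]oM2 ler_wpM2l ?ler0n //.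
  have := tail_le_power weak (radius_gt0 rho00 K).
  by rewrite -/(scale p rho0 K) scK.
set D := Mp * Num.sqrt (v / n%:R).
have hsum : \sum_(k < K.+1) (L k).+1%:R * scale p rho0 k *
    Num.sqrt (tail_annw dist x0 rho0 mu k) <= D * Gam.
  apply: (le_trans (sum_rev_le (F := fun k => (L k).+1%:R * scale p rho0 k *
    Num.sqrt (tail_annw dist x0 rho0 mu k)) (b := fun i => D * s * (i.+1%:R * z ^+ i)) _)); last first.
    rewrite /Gam mulrDr mulr1; apply: lerD; first by rewrite sqrtr1 mulr1 mul1r.
    rewrite -mulr_sumr mulrA; apply: ler_wpM2l.
      by apply: mulr_ge0; apply: ltW => //; exact: mulr_gt0.
    by apply: arith_geometric_le => //; exact: ltW.
  move=> i iK; rewrite LE // scE; last exact: ltnW.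
  have ti : 0 < th ^+ i by rewrite exprn_gt0.
  have hs : Num.sqrt (tail_annw dist x0 rho0 mu (K - i)) <= Num.sqrt (v / n%:R) * s ^+ i.+1.
    have -> : Num.sqrt (v / n%:R) * s ^+ i.+1 = Num.sqrt (v / n%:R * (s ^+ 2) ^+ i.+1).
      rewrite [RHS]sqrtrM; last by apply: divr_ge0; apply: ltW.
      by rewrite -exprM mulnC exprM sqrtr_sqr ger0_norm // exprn_ge0 // ltW.
    by apply: ler_wsqrtr; exact: etaE.
  apply: (le_trans (ler_wpM2l _ hs)).
    by apply: mulr_ge0; [exact: ler0n | apply: divr_ge0; exact: ltW].
  rewrite le_eqVlt; apply/orP; left; apply/eqP.
  rewrite /z /D exprS exprMn exprVn.
  by field; rewrite (gt_eqF ti).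
have hmean : mean_cost dist x0 p beta mu n rho0 K L ^+ 2 <=
    k16 ^+ 2 * (1 + 2 * beta) * x ^+ 2 * v * Gam ^+ 2.
  rewrite /mean_cost.
  set Sm := \sum_(k < K.+1) _ in hsum *.
  have Sm0 : 0 <= Sm.
    apply: sumr_ge0 => k _; apply: mulr_ge0; last exact: sqrtr_ge0.
    by apply: mulr_ge0; [exact: ler0n | exact: scale_ge0].
  have Sm2 : Sm ^+ 2 <= (D * Gam) ^+ 2.
    by rewrite ler_sqr ?nnegrE // (le_trans Sm0).
  rewrite exprMn exprMn sqr_sqrtr; last by apply: divr_ge0; apply: ltW.
  apply: (le_trans (ler_wpM2l _ Sm2)).
    by apply: mulr_ge0; [exact: sqr_ge0 | apply: divr_ge0; apply: ltW].
  rewrite /D exprMn exprMn sqr_sqrtr; last by apply: divr_ge0; apply: ltW.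
  rewrite le_eqVlt; apply/orP; left; apply/eqP.
  by rewrite /Mp; field; rewrite (gt_eqF nR).
have x22 : 0 < (x / 2) ^+ 2 by rewrite exprn_gt0.
have h3 : mean_cost dist x0 p beta mu n rho0 K L ^+ 2 / (x / 2) ^+ 2 <=
   4 * k16 ^+ 2 * (1 + 2 * beta) * Gam ^+ 2 * v.
  rewrite ler_pdivrMr //; apply: (le_trans hmean).
  by rewrite le_eqVlt; apply/orP; left; apply/eqP; field.
have h4 := mulr_ge0 g1 v0; have h5 := mulr_ge0 g2 v0.
by rewrite /small_const; lra.
Qed.

End Small.
End Assembly.

Theorem theorem3 (R : realType) (p : R) (hp : 1 <= p) :
  (* constants depending only on p *)
  exists (Cp1 Cp2 : R), 0 < Cp1 /\ 0 < Cp2 /\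
  (* constants depending only on p, q, r *)
  exists Cpqr : R -> R -> R, (forall q r, 2 < r -> r < q -> 0 < Cpqr q r) /\
  forall beta : R, 0 < beta ->
  (* constants depending only on p, alpha = 2p, beta (and r for part 3) *)
  exists (A1 B1 A2 B2 C2 : R), [/\ 0 < A1, 0 < B1, 0 < A2, 0 < B2 & 0 < C2] /\
  exists C3 : R -> R, (forall r, 1 < r -> r < 2 -> 0 < C3 r) /\
  forall (dE : measure_display) (E : measurableType dE) (dist : E -> E -> R)
         (x0 : E) (mu : probability E R) (S : set E),
    polish dist -> borel_of_metric dist ->
    measurable S -> mu S = 1%E ->
    (forall rr delta : R, 0 < rr -> 0 < delta -> delta <= 2 * rr ->
       (covering_number dist (S `&` cball dist x0 rr) delta
          <= (beta * (2 * rr / delta) `^ (2 * p))%:E)%E) ->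
  forall (dO : measure_display) (Om : measurableType dO) (P : probability Om R)
         (n : nat) (X : 'I_n -> Om -> E),
    (0 < n)%N -> iid_law P X mu ->
  let W := fun om => Wpp dist p mu (empirical (fun i => X i om)) in
  let I := fine (I2pp dist mu x0 p) in
  let mom := pmoment dist mu x0 p in
  let nR := (n%:R : R) in
  (* part (1) *)
  (forall r : R, 2 < r -> (weak_moment dist mu x0 (r * p) < +oo)%E ->
   forall q : R, r < q -> forall x : R, 0 < x ->
     (P [set om | (x%:E < W om)%E] <=
      (expR 2 * expR (- (nR * A1 * (x / (I * ln (expR 1 + B1 * I / x))) ^+ 2))
         * (if (x%:E <= Cp1%:E * mom)%E then 1 else 0)
       + Cpqr q r * (I `^ q / (x `^ q * nR `^ (q / 2))
                     + fine (weak_moment dist mu x0 (r * p)) / (x `^ r * nR `^ (r - 1))))%:E)%E)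
  /\
  (* part (2) *)
  ((I2pp dist mu x0 p < +oo)%E -> forall x : R, 0 < x ->
     (P [set om | (x%:E < W om)%E] <=
      (expR 2 * expR (- (nR * A2 * (x / (I * ln (expR 1 + B2 * I / x))) ^+ 2))
         * (if (x%:E <= Cp2%:E * mom)%E then 1 else 0)
       + C2 * (I ^+ 2 / (x ^+ 2 * nR)))%:E)%E)
  /\
  (* part (3) *)
  (forall r : R, 1 < r -> r < 2 -> (weak_moment dist mu x0 (r * p) < +oo)%E ->
   forall x : R, 0 < x ->
     (P [set om | (x%:E < W om)%E] <=
      (C3 r * (fine (weak_moment dist mu x0 (r * p)) / (x `^ r * nR `^ (r - 1))))%:E)%E).
Proof.
exists (moment_const p), (moment_const p); split; first exact: moment_const_gt0.
split; first exact: moment_const_gt0.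
exists (FN_const p); split.
  by move=> q r r2 rq; apply: FN_const_gt0 => //; lra.
move=> beta beta0.
have FN22 : 0 < FN_const p 2 2 by apply: FN_const_gt0 => //; lra.
(* Parts (1) and (2) share their constants. The factor 1 + th^2 of [C2] adds the I^2 of the term in
   u to the (th I)^2 used as weak moment of order 2p. *)
exists (rate_const p beta), (log_const p), (rate_const p beta), (log_const p),
  (FN_const p 2 2 * (1 + (2 `^ p) ^+ 2)).
split.
  have h1 := rate_const_gt0 p beta0; have h2 := log_const_gt0 p.
  by split => //; apply: mulr_gt0.
exists (fun r => small_const p beta r); split.
  by move=> r r1 r2; apply: small_const_gt0.
move=> dE E dist x0 mu S pol bor mS muS cov dO Om P n X n0 iidX W I mom nR.
have nR0 : 0 < nR by rewrite ltr0n.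
have wm_ge0 s : (weak_moment dist mu x0 s < +oo)%E -> 0 <= fine (weak_moment dist mu x0 s).
  move=> wfin; apply: (le_trans _ (weak_moment_le pol bor wfin (lexx 0))).
  by rewrite mulr_ge0 ?powR_ge0 // tailf_ge0.
split; [|split].
- move=> r r2 wfin q rq x x_gt0.
  have weak t : 0 < t -> t `^ (r * p) * tailf dist x0 mu t <= fine (weak_moment dist mu x0 (r * p)).
    by move=> t0; apply: (weak_moment_le pol bor wfin); exact: ltW.
  have q0 : 0 < q by lra.
  have r1 : 1 < r by lra.
  have Ifin := I2pp_fin pol bor hp (wm_ge0 _ wfin) weak r2.
  exact: (deviation_large pol bor hp beta0 mS cov muS n0 iidX q0 r1 (wm_ge0 _ wfin) x_gt0 weak Ifin).
- move=> Ifin x x_gt0.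
  have I2E : I2pp dist mu x0 p = I%:E.
    rewrite fineK // ge0_fin_numE //; apply: integral_ge0 => t _.
    by rewrite lee_fin mulr_ge0 ?sqrtr_ge0 ?powR_ge0.
  have I0 : 0 <= I.
    by apply: fine_ge0; apply: integral_ge0 => t _; rewrite lee_fin mulr_ge0 ?sqrtr_ge0 ?powR_ge0.
  (* Squaring t^p sqrt(H(t)) <= th I gives a weak moment of order 2p from the finiteness of I
     alone. *)
  have weak t : 0 < t -> t `^ (2 * p) * tailf dist x0 mu t <= (2 `^ p * I) ^+ 2.
    move=> t0; have := sqrt_tail_le x0 pol bor hp mu t0; rewrite I2E -EFinM lee_fin => h.
    have H0 : 0 <= tailf dist x0 mu t by exact: tailf_ge0.
    have -> : t `^ (2 * p) * tailf dist x0 mu t = (t `^ p * Num.sqrt (tailf dist x0 mu t)) ^+ 2.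
      by rewrite exprMn sqr_sqrtr // [2 * p]mulrC powRrM powR_mulrn ?powR_ge0.
    by rewrite ler_sqr ?nnegrE // mulr_ge0 ?powR_ge0 ?sqrtr_ge0.
  have two : 0 < 2 :> R by lra.
  have one2 : 1 < 2 :> R by lra.
  (* With q = r = 2 both polynomial terms become multiples of I^2 / (x^2 n). *)
  apply: (le_trans (deviation_large pol bor hp beta0 mS cov muS n0 iidX two one2
    (sqr_ge0 (2 `^ p * I)) x_gt0 weak Ifin)).
  rewrite lee_fin lerD2l -mulrA; apply: ler_wpM2l; first exact: ltW.
  have -> : (2 - 1 : R) = 1 by ring.
  have -> : (2 / 2 : R) = 1 by field.
  rewrite -/I -/nR !powRr1 ?(ltW nR0) // (powR_mulrn 2 I0) (powR_mulrn 2 (ltW x_gt0)).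
  rewrite le_eqVlt; apply/orP; left; apply/eqP.
  by field; rewrite (gt_eqF nR0) (gt_eqF x_gt0).
- move=> r r1 r2 wfin x x_gt0.
  have weak t : 0 < t -> t `^ (r * p) * tailf dist x0 mu t <= fine (weak_moment dist mu x0 (r * p)).
    by move=> t0; apply: (weak_moment_le pol bor wfin); exact: ltW.
  exact: (deviation_small pol bor hp beta0 mS cov muS n0 iidX r1 r2 (wm_ge0 _ wfin) x_gt0 weak).
Qed.
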